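(* Let $r\neq 0$ be a real number. There are coefficients $b_n(r)$ ($n\geq 1$), with $b_0(r)=1$, such that the Barnes $G$-function has the asymptotic expansion $$G(z+1)\sim A^{-1}z^{-\frac{1}{2}z^2-\frac{1}{2}z-\frac{1}{12}}e^{\frac{z^2}{4}}\bigl(\Gamma(z+1)\bigr)^z\left(1+\sum_{n\geq 1}\frac{b_n(r)}{z^{2n}}\right)^{1/r}$$ as $z\to+\infty$, $|\arg z|<\pi$. Moreover, for every integer $m>0$, $$b_n(r)=\sum_{k=0}^{m-1}b_k(r)\,\frac{r\,B_{2n-2k+2}}{(2n-2k)(2n-2k+1)(2n-2k+2)}+\mathcal{O}\!\left(\frac{r\,B_{2n-2m+2}}{(2n-2m)(2n-2m+1)(2n-2m+2)}\right)$$ as $n\to+\infty$.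
   Context: $G$ is the Barnes $G$-function, the entire function with $G(z+1)=\Gamma(z)G(z)$ and $G(1)=1$. $A$ is the Glaisher–Kinkelin constant, $\log A=\frac{1}{12}-\zeta'(-1)$. $B_n$ denotes the $n$-th Bernoulli number. All logarithms and powers use principal branches; $(\Gamma(z+1))^z=\exp(z\log\Gamma(z+1))$. The symbol $\sim$ denotes a Poincaré-type asymptotic expansion: for every $N\ge1$, the ratio of $G(z+1)$ to the prefactor $A^{-1}z^{-\frac12 z^2-\frac12 z-\frac1{12}}e^{z^2/4}(\Gamma(z+1))^z$ equals $\bigl(1+\sum_{n=1}^{N-1}b_n(r)z^{-2n}+\mathcal{O}(z^{-2N})\bigr)^{1/r}$ as $z\to+\infty$ in the stated sector. *)

(* Defs.v *)
From Stdlib Require Import Reals Factorial.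
From Coquelicot Require Import Coquelicot.
Open Scope R_scope.

(** * Complex exponential, principal argument, logarithm and powers *)

Definition Cexp (z : C) : C := (exp (Re z) * cos (Im z), exp (Re z) * sin (Im z)).

(* Values in (-PI, PI] for z <> 0. *)
Definition Carg (z : C) : R :=
  if Rle_dec 0 (Im z) then acos (Re z / Cmod z) else - acos (Re z / Cmod z).

Definition Clog (z : C) : C := (ln (Cmod z), Carg z).

Definition Cpower (z w : C) : C := Cexp (w * Clog z)%C.

(** * Limits and products of complex sequences *)

Definition Clim_seq (u : nat -> C) : C :=
  (real (Lim_seq (fun n => Re (u n))), real (Lim_seq (fun n => Im (u n)))).

(* f 0 * ... * f (n-1) *)
Fixpoint Cprod (f : nat -> C) (n : nat) : C :=
  match n with
  | O => 1%C
  | S k => (Cprod f k * f k)%C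
  end.

(** * The Gamma function and its logarithm *)

(* Euler's limit: Gamma(z) = lim n! n^z / (z (z+1) ... (z+n)) *)
Definition Gamma (z : C) : C :=
  Clim_seq (fun n =>
    (RtoC (INR (fact n)) * Cpower (RtoC (INR n)) z
     / Cprod (fun k => z + RtoC (INR k)) (S n))%C).

Definition slit_plane (z : C) : Prop := ~ (Im z = 0 /\ Re z <= 0).

(* The principal branch of log Gamma: the continuous logarithm of Gamma on the
   plane cut along (-oo, 0] that is real on the positive axis.  It is not the
   composite of [Clog] with [Gamma], which jumps wherever Gamma crosses the
   negative axis. *)
Definition is_log_Gamma (L : C -> C) : Prop :=
  (forall z, slit_plane z -> continuous L z) /\
  (forall z, slit_plane z -> Cexp (L z) = Gamma z) /\
  (forall x : R, 0 < x -> Im (L (RtoC x)) = 0).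

(** * The Riemann zeta function and the Glaisher-Kinkelin constant *)

Definition analytic_at (f : C -> C) (z0 : C) : Prop :=
  exists (a : nat -> C) (rho : R), 0 < rho /\
    forall h : C, Cmod h < rho ->
      is_pseries (K := C_AbsRing) (V := C_NormedModule) a h (f (z0 + h)%C).

(* The analytic continuation to C \ {1} of the Dirichlet series. *)
Definition is_Riemann_zeta (zeta : C -> C) : Prop :=
  (forall s : C, s <> RtoC 1 -> analytic_at zeta s) /\
  (forall s : C, 1 < Re s ->
     is_series (K := C_AbsRing) (V := C_NormedModule)
       (fun n => Cpower (RtoC (INR (S n))) (- s)%C) (zeta s)).

(* log A = 1/12 - zeta'(-1) *)
Definition Glaisher (zeta : C -> C) : C :=
  Cexp (RtoC (1 / 12) - C_derive zeta (RtoC (-1)))%C.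

(** * The Barnes G-function *)

Definition Euler_gamma : R :=
  real (Lim_seq (fun n => sum_n (fun k => / INR (S k)) n - ln (INR (S n)))).

(* Barnes' Weierstrass product
     G(w+1) = (2 pi)^(w/2) exp (- (w + w^2 (1 + gamma)) / 2)
              prod_(k >= 1) (1 + w/k)^k exp (w^2 / (2 k) - w).
   The functional equation G(z+1) = Gamma(z) G(z) and G(1) = 1 do not by
   themselves single out G among entire functions: one may multiply by any
   entire function of period 1 taking the value 1 at 1. *)
Definition Barnes_G (z : C) : C :=
  let w := (z - 1)%C in
  (Cpower (RtoC (2 * PI)) (w / 2)
   * Cexp (- (w + w ^ 2 * (1 + RtoC Euler_gamma)) / 2)
   * Clim_seq (Cprod (fun j =>
       let k := RtoC (INR (S j)) in
       (1 + w / k) ^ (S j) * Cexp (w ^ 2 / (2 * k) - w))))%C.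

(** * Bernoulli numbers *)

(* [Bernoulli_upto n] agrees with B_0, ..., B_n on 0, ..., n; each new value comes
   from sum_(j <= n) binomial(n+1, j) B_j = 0 for n >= 1. *)
Fixpoint Bernoulli_upto (n : nat) : nat -> R :=
  match n with
  | O => fun _ => 1
  | S p => fun k =>
      if Nat.eqb k (S p)
      then - / INR (S (S p))
           * sum_n (fun j => Binomial.C (S (S p)) j * Bernoulli_upto p j) p
      else Bernoulli_upto p k
  end.

Definition Bernoulli (n : nat) : R := Bernoulli_upto n n.

(* B_{2j+2} / (2j (2j+1) (2j+2)), for j >= 1 *)
Definition Bernoulli_coef (j : nat) : R :=
  Bernoulli (2 * j + 2) / (INR (2 * j) * INR (2 * j + 1) * INR (2 * j + 2)).

(** * The asymptotic expansion *)

(* A^-1 z^(-z^2/2 - z/2 - 1/12) e^(z^2/4) Gamma(z+1)^z *)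
Definition prefactor (zeta log_Gamma : C -> C) (z : C) : C :=
  (/ Glaisher zeta
   * Cpower z (- (1 / 2) * z ^ 2 - (1 / 2) * z - 1 / 12)
   * Cexp (z ^ 2 / 4)
   * Cexp (z * log_Gamma (z + 1)))%C.

(* f(z) ~ g(z) (1 + sum_(n >= 1) b_n z^(-2n))^p as z -> oo in |arg z| < PI, the
   error terms being uniform on each closed subsector |arg z| <= PI - delta. *)
Definition Poincare_expansion_power
    (f g : C -> C) (b : nat -> R) (p : R) : Prop :=
  forall N : nat, (1 <= N)%nat ->
  forall delta : R, 0 < delta < PI ->
  exists M K : R, 0 < K /\
  forall z : C, K <= Cmod z -> Rabs (Carg z) <= PI - delta ->
  exists w : C, Cmod w <= M / Cmod z ^ (2 * N) /\
    (f z / g z)%C =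
    Cpower (1 + sum_n_m (fun n => RtoC (b n) / z ^ (2 * n)) 1 (N - 1) + w)%C
           (RtoC p).

(* Main.v *)
(** By Euler-Maclaurin summation of [z log z], the logarithm of the quotient of [G(z+1)] by
    the prefactor differs from [sum_k B_(2k+2) / (2k (2k+1) (2k+2)) z^(-2k)] (k < N) by
    [O(z^(-2N))], uniformly in closed subsectors.  The constant of the summation formula is
    [- zeta'(-1)], because the same formula applied to [x^(-s)] continues [(1-s) zeta(s)]
    analytically to a neighbourhood of [-1].  The [b_n(r)] are hence the coefficients of
    [exp (r sum_k a_k x^k)] with [a_k = B_(2k+2) / (2k (2k+1) (2k+2))].  As the [|a_k|] grow
    factorially (this needs only Euler's quadratic recursion for the Bernoulli numbers),
    the linear terms [r b_k a_(n-k)] dominate, as in Bender's theorem. *)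
Require Import Defs.
From Stdlib Require Import Reals Lra Lia Psatz Factorial.
From Coquelicot Require Import Coquelicot.
Open Scope R_scope.

(** The factor Gamma(z+1)^z is what makes one summation formula suffice: the logarithms of the
    partial products of G carry the weights k, those of Gamma(z+1)^z the weight z, and the
    difference of the two has the summand (z+k) log(z+k). The harmonic sums, log n! and the sums of
    k log k that remain produce the constants of Euler, Stirling and Glaisher, all obtained from the
    same chain of derivatives. No contour integrals or complex derivatives occur. Estimates run
    along real segments, through a mean value inequality for complex-valued functions, and the
    remainder of Euler-Maclaurin is the sum of its one-step errors instead of an integral.
    Uniformity in a sector comes down to |z+x| >= sin(delta/2) (|z|+x) for x >= 0. Analyticity of a
    limit is replaced by Taylor remainders with geometric bounds uniform in the order, which pass to
    the limit; zeta is followed from 2 to -1 on a path above the pole at 1. The branch of log Gamma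
    is given only by its characteristic properties, so it is identified with the limit of the
    logarithms of Euler's product. *)

(** * Real and imaginary parts, modulus *)

Lemma Ceq (a b : C) : Re a = Re b -> Im a = Im b -> a = b.
Proof. destruct a, b; simpl; congruence. Qed.

Lemma Re_plus (a b : C) : Re (a + b)%C = Re a + Re b.
Proof. reflexivity. Qed.
Lemma Im_plus (a b : C) : Im (a + b)%C = Im a + Im b.
Proof. reflexivity. Qed.
Lemma Re_opp (a : C) : Re (- a)%C = - Re a.
Proof. reflexivity. Qed.
Lemma Im_opp (a : C) : Im (- a)%C = - Im a.
Proof. reflexivity. Qed.
Lemma Re_minus (a b : C) : Re (a - b)%C = Re a - Re b.
Proof. reflexivity. Qed.
Lemma Im_minus (a b : C) : Im (a - b)%C = Im a - Im b.
Proof. reflexivity. Qed.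
Lemma Re_mult (a b : C) : Re (a * b)%C = Re a * Re b - Im a * Im b.
Proof. reflexivity. Qed.
Lemma Im_mult (a b : C) : Im (a * b)%C = Re a * Im b + Im a * Re b.
Proof. reflexivity. Qed.

Lemma Cmod_sqr (z : C) : Cmod z * Cmod z = Re z * Re z + Im z * Im z.
Proof. generalize (Cmod2_alt z). simpl. nra. Qed.

Lemma Cmod_le_sqr (z : C) (m : R) : 0 <= m -> Re z * Re z + Im z * Im z <= m * m -> Cmod z <= m.
Proof. intros Hm H. rewrite <- Cmod_sqr in H. generalize (Cmod_ge_0 z). nra. Qed.

Lemma Cmod_RtoC_pos (x : R) : 0 <= x -> Cmod (RtoC x) = x.
Proof. intros; rewrite Cmod_R, Rabs_pos_eq; auto. Qed.

Lemma im_le_Cmod (z : C) : Rabs (Im z) <= Cmod z.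
Proof. destruct z as [x y]. eapply Rle_trans; [|apply Rmax_Cmod]. apply Rmax_r. Qed.

Lemma Cmod_le_Re_Im (z : C) : Cmod z <= Rabs (Re z) + Rabs (Im z).
Proof.
  apply Cmod_le_sqr.
  - generalize (Rabs_pos (Re z)) (Rabs_pos (Im z)); lra.
  - generalize (Rsqr_abs (Re z)) (Rsqr_abs (Im z)) (Rabs_pos (Re z)) (Rabs_pos (Im z)).
    unfold Rsqr; nra.
Qed.

Lemma Cmod_triangle_rev (a b : C) : Cmod a - Cmod b <= Cmod (a + b)%C.
Proof.
  generalize (Cmod_triangle (a + b) (- b)). rewrite Cmod_opp.
  replace (a + b + - b)%C with a by ring. lra.
Qed.

Lemma Cmod_minus_sym (a b : C) : Cmod (a - b)%C = Cmod (b - a)%C.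
Proof. rewrite <- Cmod_opp. f_equal; ring. Qed.

Lemma Cmod_minus_triangle (a b : C) : Cmod (a - b)%C <= Cmod a + Cmod b.
Proof. unfold Cminus. rewrite <- (Cmod_opp b). apply Cmod_triangle. Qed.

Lemma INR_S_pos (n : nat) : 0 < INR (S n).
Proof. apply lt_0_INR; lia. Qed.

(** * Finite sums *)

Fixpoint Csum (f : nat -> C) (n : nat) : C :=
  match n with O => 0%C | S k => (Csum f k + f k)%C end.

Fixpoint Rsum (f : nat -> R) (n : nat) : R :=
  match n with O => 0 | S k => Rsum f k + f k end.

Lemma Csum_S f n : Csum f (S n) = (Csum f n + f n)%C.
Proof. reflexivity. Qed.

Lemma Rsum_S f n : Rsum f (S n) = Rsum f n + f n.
Proof. reflexivity. Qed.

Lemma Csum_ext (f g : nat -> C) n : (forall k, (k < n)%nat -> f k = g k) -> Csum f n = Csum g n.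
Proof. induction n; simpl; intros H; auto. rewrite IHn, H; auto. Qed.

Lemma Rsum_ext (f g : nat -> R) n : (forall k, (k < n)%nat -> f k = g k) -> Rsum f n = Rsum g n.
Proof. induction n; simpl; intros H; auto. rewrite IHn, H; auto. Qed.

Lemma Csum_plus f g n : Csum (fun k => f k + g k)%C n = (Csum f n + Csum g n)%C.
Proof. induction n; simpl; [|rewrite IHn]; ring. Qed.

Lemma Csum_minus f g n : Csum (fun k => f k - g k)%C n = (Csum f n - Csum g n)%C.
Proof. induction n; simpl; [|rewrite IHn]; ring. Qed.

Lemma Csum_scal c f n : Csum (fun k => c * f k)%C n = (c * Csum f n)%C.
Proof. induction n; simpl; [|rewrite IHn]; ring. Qed.

Lemma Rsum_plus f g n : Rsum (fun k => f k + g k) n = Rsum f n + Rsum g n.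
Proof. induction n; simpl; [|rewrite IHn]; ring. Qed.

Lemma Rsum_scal c f n : Rsum (fun k => c * f k) n = c * Rsum f n.
Proof. induction n; simpl; [|rewrite IHn]; ring. Qed.

Lemma Csum_telescope (f : nat -> C) n : Csum (fun k => f (S k) - f k)%C n = (f n - f O)%C.
Proof. induction n; simpl; [|rewrite IHn]; ring. Qed.

Lemma Csum_shift f n : Csum f (S n) = (f O + Csum (fun k => f (S k)) n)%C.
Proof. induction n; simpl in *; [|rewrite IHn]; ring. Qed.

Lemma Rsum_shift f n : Rsum f (S n) = f O + Rsum (fun k => f (S k)) n.
Proof. induction n; simpl in *; [|rewrite IHn]; ring. Qed.

Lemma Csum_zero (f : nat -> C) n : (forall k, (k < n)%nat -> f k = 0%C) -> Csum f n = 0%C.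
Proof. induction n; simpl; intros H; auto. rewrite IHn, H; auto. ring. Qed.

Lemma Re_Csum f n : Re (Csum f n) = Rsum (fun k => Re (f k)) n.
Proof. induction n; simpl Csum; simpl Rsum; [reflexivity|rewrite Re_plus, IHn; reflexivity]. Qed.

Lemma Im_Csum f n : Im (Csum f n) = Rsum (fun k => Im (f k)) n.
Proof. induction n; simpl Csum; simpl Rsum; [reflexivity|rewrite Im_plus, IHn; reflexivity]. Qed.

Lemma Csum_RtoC f n : Csum (fun k => RtoC (f k)) n = RtoC (Rsum f n).
Proof. induction n; simpl; auto. rewrite IHn, RtoC_plus; auto. Qed.

Lemma Csum_Cmod (f : nat -> C) (g : nat -> R) n :
  (forall k, (k < n)%nat -> Cmod (f k) <= g k) -> Cmod (Csum f n) <= Rsum g n.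
Proof.
  induction n; simpl; intros H. rewrite Cmod_0; lra.
  eapply Rle_trans; [apply Cmod_triangle|]. apply Rplus_le_compat; auto.
Qed.

Lemma Rsum_le f g n : (forall k, (k < n)%nat -> f k <= g k) -> Rsum f n <= Rsum g n.
Proof. induction n; simpl; intros H; [lra|]. apply Rplus_le_compat; auto. Qed.

Lemma Rsum_pos f n : (forall k, (k < n)%nat -> 0 <= f k) -> 0 <= Rsum f n.
Proof. induction n; simpl; intros H; [lra|]. apply Rplus_le_le_0_compat; auto. Qed.

Lemma Csum_split f n m : Csum f (n + m) = (Csum f n + Csum (fun k => f (n + k)%nat) m)%C.
Proof.
  induction m; simpl. rewrite Nat.add_0_r; ring.
  rewrite Nat.add_succ_r; simpl; rewrite IHm; ring.
Qed.

Lemma Rsum_split f n m : Rsum f (n + m) = Rsum f n + Rsum (fun k => f (n + k)%nat) m.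
Proof.
  induction m; simpl. rewrite Nat.add_0_r; ring.
  rewrite Nat.add_succ_r; simpl; rewrite IHm; ring.
Qed.

Lemma sum_n_Rsum (f : nat -> R) n : sum_n f n = Rsum f (S n).
Proof.
  induction n. rewrite sum_O; simpl; ring.
  rewrite sum_Sn, IHn. reflexivity.
Qed.

Lemma sum_n_Csum (f : nat -> C) n : sum_n (G := C_AbelianMonoid) f n = Csum f (S n).
Proof.
  induction n. rewrite sum_O; simpl; ring.
  rewrite sum_Sn, IHn. reflexivity.
Qed.

(** * Limits of complex sequences *)

(** Convergence part by part, because [Clim_seq] takes the limits of the parts; since [Lim_seq] has
    a value for divergent sequences too, each use of [Clim_seq] goes through a proof of [Clim]. *)
Definition Clim (u : nat -> C) (l : C) : Prop :=
  is_lim_seq (fun n => Re (u n)) (Re l) /\ is_lim_seq (fun n => Im (u n)) (Im l).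

Lemma Clim_seq_eq u l : Clim u l -> Clim_seq u = l.
Proof.
  intros [H1 H2]. unfold Clim_seq.
  rewrite (is_lim_seq_unique _ _ H1), (is_lim_seq_unique _ _ H2). destruct l; reflexivity.
Qed.

Lemma Clim_unique u l l' : Clim u l -> Clim u l' -> l = l'.
Proof. intros H H'. rewrite <- (Clim_seq_eq _ _ H). apply Clim_seq_eq; auto. Qed.

Lemma Clim_ext u v l : (forall n, u n = v n) -> Clim u l -> Clim v l.
Proof.
  intros E [H1 H2]; split; eapply is_lim_seq_ext; try eassumption; intros; simpl; rewrite E; auto.
Qed.

Lemma Clim_ext_loc u v l N : (forall n, (N <= n)%nat -> u n = v n) -> Clim u l -> Clim v l.
Proof.
  intros E [H1 H2]; split.
  - apply (is_lim_seq_ext_loc (fun n => Re (u n))); auto.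
    exists N; intros n Hn; rewrite E; auto.
  - apply (is_lim_seq_ext_loc (fun n => Im (u n))); auto.
    exists N; intros n Hn; rewrite E; auto.
Qed.

Lemma Clim_const a : Clim (fun _ => a) a.
Proof. split; apply is_lim_seq_const. Qed.

Lemma Clim_plus u v a b : Clim u a -> Clim v b -> Clim (fun n => u n + v n)%C (a + b)%C.
Proof. intros [H1 H2] [H3 H4]; split; apply is_lim_seq_plus'; auto. Qed.

Lemma Clim_opp u a : Clim u a -> Clim (fun n => - u n)%C (- a)%C.
Proof.
  intros [H1 H2]; split.
  - apply -> (is_lim_seq_opp (fun n => Re (u n)) (Re a)); auto.
  - apply -> (is_lim_seq_opp (fun n => Im (u n)) (Im a)); auto.
Qed.

Lemma Clim_minus u v a b : Clim u a -> Clim v b -> Clim (fun n => u n - v n)%C (a - b)%C.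
Proof. intros; apply Clim_plus; auto; apply Clim_opp; auto. Qed.

Lemma Clim_mult u v a b : Clim u a -> Clim v b -> Clim (fun n => u n * v n)%C (a * b)%C.
Proof.
  intros [H1 H2] [H3 H4]; split.
  - apply is_lim_seq_minus'; apply is_lim_seq_mult'; auto.
  - apply is_lim_seq_plus'; apply is_lim_seq_mult'; auto.
Qed.

Lemma Clim_RtoC u (a : R) : is_lim_seq u a -> Clim (fun n => RtoC (u n)) (RtoC a).
Proof. intros H; split; simpl; auto. apply is_lim_seq_const. Qed.

Lemma Clim_incr_1 u l : Clim (fun n => u (S n)) l <-> Clim u l.
Proof.
  split; intros [H1 H2]; split.
  - apply (is_lim_seq_incr_1 (fun n => Re (u n))); auto.
  - apply (is_lim_seq_incr_1 (fun n => Im (u n))); auto.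
  - apply -> (is_lim_seq_incr_1 (fun n => Re (u n))); auto.
  - apply -> (is_lim_seq_incr_1 (fun n => Im (u n))); auto.
Qed.

Lemma is_lim_seq_squeeze0 (u v : nat -> R) :
  (forall n, Rabs (u n) <= v n) -> is_lim_seq v 0 -> is_lim_seq u 0.
Proof.
  intros H Hv. apply is_lim_seq_abs_0.
  apply (is_lim_seq_le_le (fun _ => 0) _ v); auto.
  - intros n; split; [apply Rabs_pos|auto].
  - apply is_lim_seq_const.
Qed.

Lemma is_lim_seq_minus0 (u : nat -> R) (l : R) :
  is_lim_seq (fun n => u n - l) 0 -> is_lim_seq u l.
Proof.
  intros H. apply is_lim_seq_ext with (fun n => (u n - l) + l). intros; ring.
  replace (Finite l) with (Finite (0 + l)) by (f_equal; ring).
  apply is_lim_seq_plus'; auto. apply is_lim_seq_const.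
Qed.

Lemma Clim_squeeze u l (v : nat -> R) N :
  (forall n, (N <= n)%nat -> Cmod (u n - l)%C <= v n) -> is_lim_seq v 0 -> Clim u l.
Proof.
  intros H Hv.
  assert (H' : forall n, Cmod (u (n + N)%nat - l)%C <= v (n + N)%nat) by (intros; apply H; lia).
  apply (is_lim_seq_incr_n v N) in Hv.
  split; [apply (is_lim_seq_incr_n _ N)|apply (is_lim_seq_incr_n _ N)];
    apply is_lim_seq_minus0; (eapply is_lim_seq_squeeze0; [|apply Hv]); intros n;
    (eapply Rle_trans; [|apply H']).
  - rewrite <- Re_minus. apply re_le_Cmod.
  - rewrite <- Im_minus. apply im_le_Cmod.
Qed.

Lemma Clim_Cmod u l : Clim u l -> is_lim_seq (fun n => Cmod (u n)) (Cmod l).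
Proof.
  intros [H1 H2]. unfold Cmod.
  apply is_lim_seq_continuous with (f := sqrt).
  - apply continuity_pt_filterlim. apply continuous_sqrt.
  - apply is_lim_seq_plus'; simpl; rewrite Rmult_1_r.
    + eapply is_lim_seq_ext; [intros n; symmetry; rewrite Rmult_1_r; reflexivity|].
      exact (is_lim_seq_mult' _ _ _ _ H1 H1).
    + eapply is_lim_seq_ext; [intros n; symmetry; rewrite Rmult_1_r; reflexivity|].
      exact (is_lim_seq_mult' _ _ _ _ H2 H2).
Qed.

Lemma Clim_Cmod_le u l (M : R) N :
  Clim u l -> (forall n, (N <= n)%nat -> Cmod (u n) <= M) -> Cmod l <= M.
Proof.
  intros H HM. apply Clim_Cmod in H.
  apply (is_lim_seq_le_loc (fun n => Cmod (u n)) (fun _ => M) (Cmod l) M).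
  - exists N; auto.
  - auto.
  - apply is_lim_seq_const.
Qed.

Lemma Clim_cvg_of_summable (u : nat -> C) (b : nat -> R) :
  (forall n, Cmod (u n) <= b n) -> ex_series b -> exists l, Clim (Csum u) l.
Proof.
  intros H Hb.
  assert (H1 : ex_series (fun n => Re (u n))).
  { apply (ex_series_le (V := R_CompleteNormedModule)) with b; auto.
    intros n. eapply Rle_trans; [apply re_le_Cmod|auto]. }
  assert (H2 : ex_series (fun n => Im (u n))).
  { apply (ex_series_le (V := R_CompleteNormedModule)) with b; auto.
    intros n. eapply Rle_trans; [apply im_le_Cmod|auto]. }
  destruct H1 as [a Ha], H2 as [c Hc].
  exists (a, c). apply Clim_incr_1.
  split; simpl.
  - eapply is_lim_seq_ext; [|exact Ha]. intros n. rewrite sum_n_Rsum, Re_Csum; reflexivity.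
  - eapply is_lim_seq_ext; [|exact Hc]. intros n. rewrite sum_n_Rsum, Im_Csum; reflexivity.
Qed.

(** * Derivatives of complex-valued functions of a real variable *)

(** Differentiation in a real variable suffices: complex arguments are always varied along a
    line. *)
Definition dC (g : R -> C) (t : R) (l : C) : Prop :=
  is_derive (fun t => Re (g t)) t (Re l) /\ is_derive (fun t => Im (g t)) t (Im l).

Lemma dC_ext_loc f g t l : locally t (fun s => f s = g s) -> dC f t l -> dC g t l.
Proof.
  intros E [H1 H2]; split; (eapply is_derive_ext_loc; [|eassumption]);
    (eapply filter_imp; [|exact E]); simpl; intros s ->; auto.
Qed.

Lemma dC_ext f g t l : (forall s, f s = g s) -> dC f t l -> dC g t l.
Proof. intros E; apply dC_ext_loc; apply filter_forall; auto. Qed.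

Lemma dC_eq f t l l' : dC f t l -> l = l' -> dC f t l'.
Proof. intros H <-; auto. Qed.

Lemma dC_const c t : dC (fun _ => c) t 0%C.
Proof. split; simpl; apply (is_derive_const (V := R_NormedModule)). Qed.

Lemma dC_plus f g t a b : dC f t a -> dC g t b -> dC (fun t => f t + g t)%C t (a + b)%C.
Proof. intros [H1 H2] [H3 H4]; split; simpl; apply (is_derive_plus (V := R_NormedModule)); auto. Qed.

Lemma dC_opp f t a : dC f t a -> dC (fun t => - f t)%C t (- a)%C.
Proof. intros [H1 H2]; split; simpl; apply (is_derive_opp (V := R_NormedModule)); auto. Qed.

Lemma dC_minus f g t a b : dC f t a -> dC g t b -> dC (fun t => f t - g t)%C t (a - b)%C.
Proof. intros; apply dC_plus; auto; apply dC_opp; auto. Qed.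

Lemma is_derive_eq (f : R -> R) x l l' : is_derive f x l -> l = l' -> is_derive f x l'.
Proof. intros H <-; auto. Qed.

Lemma is_derive_Rmult (f g : R -> R) x a b :
  is_derive f x a -> is_derive g x b -> is_derive (fun x => f x * g x) x (a * g x + f x * b).
Proof. intros; apply (is_derive_mult f g); auto. intros; apply Rmult_comm. Qed.

Lemma dC_mult f g t a b :
  dC f t a -> dC g t b -> dC (fun t => f t * g t)%C t (a * g t + f t * b)%C.
Proof.
  intros [H1 H2] [H3 H4]; split; simpl.
  - eapply is_derive_eq.
    + apply (is_derive_minus (V := R_NormedModule)); apply is_derive_Rmult; eassumption.
    + unfold minus, plus, opp; simpl. unfold Re, Im. ring.
  - eapply is_derive_eq.
    + apply (is_derive_plus (V := R_NormedModule)); apply is_derive_Rmult; eassumption.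
    + unfold plus; simpl. unfold Re, Im. ring.
Qed.

Lemma dC_RtoC f t a : is_derive f t a -> dC (fun t => RtoC (f t)) t (RtoC a).
Proof. intros H; split; simpl; auto. apply (is_derive_const (V := R_NormedModule)). Qed.

Lemma dC_id t : dC RtoC t 1%C.
Proof. apply (dC_RtoC (fun t => t)). apply (is_derive_id (K := R_AbsRing)). Qed.

Lemma dC_scal c f t a : dC f t a -> dC (fun t => c * f t)%C t (c * a)%C.
Proof.
  intros H. eapply dC_eq; [exact (dC_mult _ _ _ _ _ (dC_const c t) H)|]. cbv beta. ring.
Qed.

Lemma dC_Csum (f : nat -> R -> C) (a : nat -> C) t n :
  (forall k, (k < n)%nat -> dC (f k) t (a k)) -> dC (fun t => Csum (fun k => f k t) n) t (Csum a n).
Proof.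
  induction n; simpl; intros H. apply dC_const. apply dC_plus; auto.
Qed.

Lemma dC_pow f t a n : dC f t a -> dC (fun t => f t ^ n)%C t (INR n * f t ^ (n - 1) * a)%C.
Proof.
  intros H. induction n.
  - eapply dC_eq; [exact (dC_const 1%C t)|]. simpl. ring.
  - eapply dC_eq; [exact (dC_mult _ _ _ _ _ H IHn)|].
    replace (S n - 1)%nat with n by lia. rewrite S_INR, RtoC_plus.
    destruct n; simpl. ring. rewrite Nat.sub_0_r. ring.
Qed.

Lemma dC_continuous_Im f t a : dC f t a -> continuous (fun t => Im (f t)) t.
Proof. intros [_ H]. apply (ex_derive_continuous (V := R_NormedModule)). eexists; eauto. Qed.

(** * Mean value inequality and Taylor's formula with bound *)

Lemma real_mvt_le (f f' : R -> R) (T : R) :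
  0 <= T -> (forall t, 0 <= t <= T -> is_derive f t (f' t)) ->
  (forall t, 0 <= t <= T -> 0 <= f' t) -> f 0 <= f T.
Proof.
  intros HT Hd Hp. destruct HT as [HT|HT]; [|subst; lra].
  destruct (MVT_gen f 0 T f') as [c [Hc E]].
  - intros x Hx. rewrite Rmin_left, Rmax_right in Hx by lra. apply Hd; lra.
  - intros x Hx. rewrite Rmin_left, Rmax_right in Hx by lra.
    apply continuity_pt_filterlim, (ex_derive_continuous (V := R_NormedModule)). exists (f' x); apply Hd; lra.
  - rewrite Rmin_left, Rmax_right in Hc by lra. specialize (Hp c Hc). nra.
Qed.

(* Applied to the real part of h rotated so that h T - h 0 becomes positive. *)
Lemma mean_value_inequality (h h' : R -> C) (phi phi' : R -> R) (T : R) :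
  0 <= T ->
  (forall t, 0 <= t <= T -> dC h t (h' t)) ->
  (forall t, 0 <= t <= T -> is_derive phi t (phi' t)) ->
  (forall t, 0 <= t <= T -> Cmod (h' t) <= phi' t) ->
  Cmod (h T - h 0)%C <= phi T - phi 0.
Proof.
  intros HT Hh Hphi Hle.
  set (w := (h T - h 0)%C).
  assert (Hre : forall u : C, Cmod u <= 1 -> Re (u * w)%C <= phi T - phi 0).
  { intros u Hu.
    assert (H := real_mvt_le (fun t => phi t - Re (u * h t)%C)
                   (fun t => phi' t - Re (u * h' t)%C) T HT).
    cbv beta in H.
    assert (H' : phi 0 - Re (u * h 0)%C <= phi T - Re (u * h T)%C).
    { apply H.
      - intros t Ht. apply (is_derive_minus (V := R_NormedModule)); auto.
        apply (dC_scal u h t (h' t)); auto.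
      - intros t Ht. specialize (Hle t Ht).
        generalize (re_le_Cmod (u * h' t)%C) (Rle_abs (Re (u * h' t)%C)).
        rewrite Cmod_mult. generalize (Cmod_ge_0 (h' t)) (Cmod_ge_0 u). nra. }
    unfold w. rewrite !Re_mult in H'. rewrite Re_mult, Re_minus, Im_minus. nra. }
  destruct (Req_dec (Cmod w) 0) as [E|E].
  - rewrite E. specialize (Hre 0%C). rewrite Cmod_0 in Hre.
    replace (Re (0 * w)%C) with 0 in Hre by (rewrite Re_mult; simpl; ring). lra.
  - assert (Hpos : 0 < Cmod w) by (generalize (Cmod_ge_0 w); lra).
    specialize (Hre (/ Cmod w * Cconj w)%C).
    assert (Hm : Cmod (/ Cmod w * Cconj w)%C = 1).
    { rewrite Cmod_mult, Cmod_conj, <- RtoC_inv, Cmod_RtoC_pos; [now apply Rinv_l| |exact E].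
      left; apply Rinv_0_lt_compat; auto. }
    rewrite Hm in Hre. specialize (Hre (Rle_refl 1)).
    replace (/ Cmod w * Cconj w * w)%C with (RtoC (Cmod w)) in Hre; [exact Hre|].
    replace (/ Cmod w * Cconj w * w)%C with (/ Cmod w * (w * Cconj w))%C by ring.
    rewrite <- Cmod2_conj. rewrite RtoC_pow. field.
    intros H; apply E. apply RtoC_inj; auto.
Qed.

(** The derivative of the Taylor remainder of order L + 1 of [g 0] is the remainder of order L of
    [g 1], so the induction integrates a bound with the mean value inequality. The derivatives are
    supplied as a sequence [g], which keeps explicit formulas available in the applications. *)
Lemma Taylor_chain (L : nat) : forall (g : nat -> R -> C) (M : R),
  (forall j t, 0 <= t <= 1 -> dC (g j) t (g (S j) t)) ->
  (forall t, 0 <= t <= 1 -> Cmod (g L t) <= M) ->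
  forall t, 0 <= t <= 1 ->
  Cmod (g 0%nat t - Csum (fun i => g i 0 * RtoC (t ^ i / INR (fact i))) L)%C
    <= M * (t ^ L / INR (fact L)).
Proof.
  induction L; intros g M Hg HM t Ht.
  - simpl. replace (g 0%nat t - 0)%C with (g 0%nat t) by ring.
    specialize (HM t Ht). lra.
  - set (h := fun t => (g 0%nat t - Csum (fun i => g i 0 * RtoC (t ^ i / INR (fact i))) (S L))%C).
    set (h' := fun t => (g 1%nat t - Csum (fun i => g (S i) 0 * RtoC (t ^ i / INR (fact i))) L)%C).
    set (phi := fun t => M * (t ^ S L / INR (fact (S L)))).
    assert (Hd : forall i t, is_derive (fun t => t ^ S i / INR (fact (S i))) t (t ^ i / INR (fact i))).
    { intros i s. eapply is_derive_eq.
      - apply is_derive_Rmult.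
        + apply is_derive_Reals, derivable_pt_lim_pow.
        + apply (is_derive_const (V := R_NormedModule)).
      - rewrite fact_simpl, mult_INR. simpl pred. change (@zero R_NormedModule) with 0.
        match goal with |- ?a = ?b => change (@eq R a b) end. field. split; [apply INR_fact_neq_0|apply not_0_INR; lia]. }
    assert (Hh0 : h 0 = 0%C).
    { unfold h. rewrite Csum_shift. rewrite (Csum_zero (fun k => _)).
      - simpl. replace (1 / 1) with 1 by field. ring.
      - intros k _. replace (0 ^ S k / INR (fact (S k))) with 0 by (simpl; unfold Rdiv; ring). ring. }
    assert (H := mean_value_inequality h h' phi (fun t => M * (t ^ L / INR (fact L))) t (proj1 Ht)).
    rewrite Hh0 in H. replace (phi 0) with 0 in H by (unfold phi; simpl; unfold Rdiv; ring).
    replace (h t - 0)%C with (h t) in H by ring. rewrite Rminus_0_r in H. apply H.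
    + intros s Hs. unfold h, h'. apply dC_minus. apply Hg; lra.
      eapply dC_ext; [intros u; symmetry; apply Csum_shift|].
      replace (Csum _ L) with (0 + Csum (fun i => g (S i) 0 * RtoC (s ^ i / INR (fact i))) L)%C by ring.
      apply dC_plus.
      * eapply dC_ext; [|apply (dC_const (g 0%nat 0))]. intros; simpl.
        replace (1 / 1) with 1 by field. ring.
      * apply dC_Csum. intros k _. apply dC_scal. apply dC_RtoC. apply Hd.
    + intros s Hs. unfold phi. apply (is_derive_scal (fun t => t ^ S L / INR (fact (S L)))). apply Hd.
    + intros s Hs. unfold h'. apply (IHL (fun j => g (S j))); auto. lra.
Qed.

(** * Exponential and logarithm *)

Lemma Cexp_plus (a b : C) : Cexp (a + b)%C = (Cexp a * Cexp b)%C.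
Proof.
  unfold Cexp. rewrite Re_plus, Im_plus, exp_plus, cos_plus, sin_plus.
  apply Ceq; rewrite ?Re_mult, ?Im_mult; simpl; ring.
Qed.

Lemma Cexp_0 : Cexp 0%C = 1%C.
Proof. apply Ceq; unfold Cexp; simpl; rewrite exp_0, ?cos_0, ?sin_0; ring. Qed.

Lemma Cexp_nz z : Cexp z <> 0%C.
Proof.
  intros H. assert (E : (Cexp z * Cexp (- z))%C = 1%C).
  { rewrite <- Cexp_plus, <- Cexp_0. f_equal; ring. }
  rewrite H in E. apply C1_nz. rewrite <- E. ring.
Qed.

Lemma Cexp_opp z : Cexp (- z)%C = (/ Cexp z)%C.
Proof.
  assert (E : (Cexp z * Cexp (- z))%C = 1%C).
  { rewrite <- Cexp_plus, <- Cexp_0. f_equal; ring. }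
  assert (H := Cexp_nz z).
  replace (Cexp (- z)) with ((Cexp z * Cexp (- z)) / Cexp z)%C by (field; auto).
  rewrite E. field; auto.
Qed.

Lemma Cexp_minus a b : Cexp (a - b)%C = (Cexp a / Cexp b)%C.
Proof. unfold Cminus; rewrite Cexp_plus, Cexp_opp; reflexivity. Qed.

Lemma Cexp_RtoC x : Cexp (RtoC x) = RtoC (exp x).
Proof. apply Ceq; unfold Cexp; simpl; rewrite ?cos_0, ?sin_0; ring. Qed.

Lemma Cmod_Cexp z : Cmod (Cexp z) = exp (Re z).
Proof.
  assert (H := Cmod_sqr (Cexp z)). unfold Cexp in H at 3 4 5 6. simpl in H.
  assert (H1 := sin2_cos2 (Im z)). unfold Rsqr in H1.
  generalize (Cmod_ge_0 (Cexp z)) (exp_pos (Re z)). nra.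
Qed.

Lemma Cexp_pow z n : (Cexp z ^ n)%C = Cexp (INR n * z)%C.
Proof.
  induction n. simpl. rewrite <- Cexp_0. f_equal; ring.
  rewrite Cpow_S, IHn, <- Cexp_plus, S_INR, RtoC_plus. f_equal; ring.
Qed.

Lemma Clim_Cexp u l : Clim u l -> Clim (fun n => Cexp (u n)) (Cexp l).
Proof.
  intros [H1 H2]. split; simpl; apply is_lim_seq_mult'.
  all: (apply is_lim_seq_continuous; [|assumption]); apply derivable_continuous.
  all: first [apply derivable_exp|apply derivable_cos|apply derivable_sin].
Qed.

Lemma dC_Cexp f t a : dC f t a -> dC (fun t => Cexp (f t)) t (Cexp (f t) * a)%C.
Proof.
  intros [H1 H2]; split; unfold Cexp; simpl.
  - eapply is_derive_eq; [apply is_derive_Rmult; apply (is_derive_comp (V := R_NormedModule)); try eassumption|].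
    apply is_derive_exp. apply is_derive_cos.
    unfold scal; simpl; unfold mult; simpl. unfold Re, Im; ring.
  - eapply is_derive_eq; [apply is_derive_Rmult; apply (is_derive_comp (V := R_NormedModule)); try eassumption|].
    apply is_derive_exp. apply is_derive_sin.
    unfold scal; simpl; unfold mult; simpl. unfold Re, Im; ring.
Qed.

(** * The principal logarithm on the slit plane *)

Lemma slit_plane_den z : slit_plane z -> 0 < Cmod z + Re z.
Proof.
  intros H. assert (E := Cmod_sqr z). assert (H0 := Cmod_ge_0 z).
  destruct (Rlt_dec 0 (Re z)) as [Hr|Hr]; [lra|].
  destruct (Req_dec (Im z) 0) as [Hi|Hi]; [exfalso; apply H; lra|].
  assert (0 < Im z * Im z) by (apply Rsqr_pos_lt; auto). nra.
Qed.

Lemma slit_plane_nz z : slit_plane z -> z <> 0%C.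
Proof. intros H ->; apply H; simpl; lra. Qed.

Lemma slit_plane_Cmod z : slit_plane z -> 0 < Cmod z.
Proof. intros H; apply Cmod_gt_0, slit_plane_nz, H. Qed.

Lemma slit_plane_RtoC x : 0 < x -> slit_plane (RtoC x).
Proof. intros H [_ H']; simpl in H'; lra. Qed.

(** Half-angle formula. Unlike the definition through [acos], it has no case distinction on the sign
    of the imaginary part and is smooth across the positive axis; its denominator is positive off
    the cut. *)
Lemma Carg_atan z : slit_plane z -> Carg z = 2 * atan (Im z / (Cmod z + Re z)).
Proof.
  intros H. assert (Hd := slit_plane_den z H). assert (Hm := slit_plane_Cmod z H).
  assert (E := Cmod_sqr z).
  set (u := Im z / (Cmod z + Re z)). set (th := atan u).
  assert (Hb := atan_bound u). fold th in Hb.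
  assert (Hc : cos (2 * th) = Re z / Cmod z).
  { rewrite cos_2a_cos. unfold th. rewrite cos_atan.
    assert (Hs : sqrt (1 + u²) * sqrt (1 + u²) = 1 + u²).
    { apply sqrt_sqrt. generalize (Rle_0_sqr u); lra. }
    assert (Hp : 0 < 1 + u²) by (generalize (Rle_0_sqr u); lra).
    assert (Hsp : 0 < sqrt (1 + u²)) by (apply sqrt_lt_R0; auto).
    replace (2 * (1 / sqrt (1 + u²)) * (1 / sqrt (1 + u²)))
      with (2 / (sqrt (1 + u²) * sqrt (1 + u²))) by (field; lra).
    rewrite Hs. unfold u, Rsqr.
    replace (2 / (1 + Im z / (Cmod z + Re z) * (Im z / (Cmod z + Re z))))
     with (2 * (Cmod z + Re z) * (Cmod z + Re z) /
           ((Cmod z + Re z) * (Cmod z + Re z) + Im z * Im z)).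
    2:{ field. split; [lra|]. nra. }
    replace ((Cmod z + Re z) * (Cmod z + Re z) + Im z * Im z)
      with (2 * Cmod z * (Cmod z + Re z)) by nra.
    field. split; lra. }
  unfold Carg. rewrite <- Hc. fold u; fold th.
  destruct (Rle_dec 0 (Im z)) as [Hi|Hi].
  - assert (0 <= th).
    { unfold th. rewrite <- atan_0. destruct (Req_dec u 0) as [->|Hu]; [lra|].
      left; apply atan_increasing.
      assert (0 <= u) by (unfold u; apply Rmult_le_pos; auto; left; apply Rinv_0_lt_compat; auto). lra. }
    apply acos_cos. lra.
  - assert (th < 0).
    { unfold th. rewrite <- atan_0. apply atan_increasing.
      unfold u. apply Rmult_lt_reg_r with (Cmod z + Re z); auto.
      unfold Rdiv. rewrite Rmult_assoc, Rinv_l; lra. }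
    replace (2 * th) with (- (2 * - th)) by ring. rewrite cos_neg, acos_cos; lra.
Qed.

Lemma Carg_bound z : slit_plane z -> - PI < Carg z < PI.
Proof.
  intros H; rewrite Carg_atan by auto.
  generalize (atan_bound (Im z / (Cmod z + Re z))); lra.
Qed.

Lemma Cexp_Clog z : slit_plane z -> Cexp (Clog z) = z.
Proof.
  intros H. assert (Hm := slit_plane_Cmod z H).
  assert (E := Cmod_sqr z).
  assert (Hq : Rabs (Re z / Cmod z) <= 1).
  { unfold Rdiv. rewrite Rabs_mult, Rabs_inv, (Rabs_pos_eq (Cmod z)) by lra.
    apply Rmult_le_reg_r with (Cmod z); auto. rewrite Rmult_assoc, Rinv_l by lra.
    generalize (re_le_Cmod z); lra. }
  apply Rabs_le_between in Hq.
  assert (Hs : sqrt (1 - (Re z / Cmod z)²) * Cmod z = Rabs (Im z)).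
  { rewrite <- (sqrt_Rsqr (Cmod z)) at 2 by lra. rewrite <- sqrt_mult_alt.
    2:{ unfold Rsqr. nra. }
    rewrite <- sqrt_Rsqr_abs. f_equal. unfold Rsqr. field_simplify; [|lra]. nra. }
  apply Ceq; unfold Cexp, Clog; simpl; rewrite exp_ln by auto; unfold Carg;
    destruct (Rle_dec 0 (Im z)).
  - rewrite cos_acos by lra. field; lra.
  - rewrite cos_neg, cos_acos by lra. field; lra.
  - rewrite sin_acos by lra. rewrite Rmult_comm, Hs, Rabs_pos_eq; auto.
  - rewrite sin_neg, sin_acos by lra. rewrite Rmult_comm, Ropp_mult_distr_l_reverse, Hs.
    rewrite Rabs_left; lra.
Qed.

Lemma Carg_pos x : 0 < x -> Carg (RtoC x) = 0.
Proof.
  intros H. rewrite Carg_atan by (apply slit_plane_RtoC; auto). simpl.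
  unfold Rdiv; rewrite Rmult_0_l, atan_0; ring.
Qed.

Lemma Clog_pos x : 0 < x -> Clog (RtoC x) = RtoC (ln x).
Proof.
  intros H. unfold Clog. rewrite Carg_pos, Cmod_RtoC_pos by lra. reflexivity.
Qed.

Lemma atan_tan_2 th : - PI < th < PI -> 2 * atan (sin th / (1 + cos th)) = th.
Proof.
  intros H. assert (Hc : 0 < cos (th / 2)) by (apply cos_gt_0; lra).
  replace (sin th / (1 + cos th)) with (tan (th / 2)).
  - rewrite atan_tan; lra.
  - replace th with (2 * (th / 2)) at 2 3 by field.
    rewrite sin_2a, cos_2a_cos. unfold tan. field.
    split; [|lra]. nra.
Qed.

Lemma Clog_Cexp z : - PI < Im z < PI -> Clog (Cexp z) = z.
Proof.
  intros H.
  assert (Hs : slit_plane (Cexp z)).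
  { intros [H1 H2]. unfold Cexp in *; simpl in *. assert (He := exp_pos (Re z)).
    assert (Hs : sin (Im z) = 0) by (apply Rmult_integral in H1; destruct H1; lra).
    assert (Hc : 0 < cos (Im z / 2)) by (apply cos_gt_0; lra).
    replace (Im z) with (2 * (Im z / 2)) in Hs, H2 by field.
    rewrite sin_2a in Hs. rewrite cos_2a_cos in H2.
    assert (Hs0 : sin (Im z / 2) = 0).
    { apply Rmult_eq_reg_r with (2 * cos (Im z / 2)); lra. }
    assert (HH := sin2_cos2 (Im z / 2)). unfold Rsqr in HH. rewrite Hs0 in HH.
    assert (HHH : cos (Im z / 2) * cos (Im z / 2) = 1) by lra.
    rewrite Rmult_assoc, HHH in H2. nra. }
  apply Ceq; unfold Clog; simpl.
  - rewrite Cmod_Cexp, ln_exp; auto.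
  - rewrite Carg_atan by auto. rewrite Cmod_Cexp. unfold Cexp; simpl.
    rewrite <- (atan_tan_2 (Im z)) at 3 by auto. f_equal. f_equal.
    assert (He := exp_pos (Re z)).
    assert (Hc : 0 < cos (Im z / 2)) by (apply cos_gt_0; lra).
    assert (Hc2 : 0 < 1 + cos (Im z)).
    { replace (Im z) with (2 * (Im z / 2)) by field. rewrite cos_2a_cos. nra. }
    unfold Re, Im in *. field. split; nra.
Qed.

Lemma Clog_scal x z : 0 < x -> slit_plane z -> Clog (x * z)%C = (RtoC (ln x) + Clog z)%C.
Proof.
  intros Hx Hz. rewrite <- (Cexp_Clog z) at 1 by auto.
  rewrite <- (exp_ln x) at 1 by auto. rewrite <- Cexp_RtoC, <- Cexp_plus.
  apply Clog_Cexp. simpl. generalize (Carg_bound z Hz); lra.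
Qed.

Lemma slit_plane_plus_R z x : slit_plane z -> 0 <= x -> slit_plane (z + x)%C.
Proof.
  intros Hz Hx [H1 H2]; apply Hz.
  rewrite Im_plus, im_RtoC in H1. rewrite Re_plus, re_RtoC in H2. lra.
Qed.

Lemma slit_plane_1_plus u : Cmod u < 1 -> slit_plane (1 + u)%C.
Proof.
  intros H [_ H2]; simpl in H2. generalize (re_le_Cmod u).
  generalize (Rabs_maj2 (Re u)). unfold Re; lra.
Qed.

Lemma dC_Clog_line (z v : C) (t : R) : slit_plane (z + t * v)%C ->
  dC (fun s => Clog (z + RtoC s * v)%C) t (v / (z + t * v))%C.
Proof.
  intros H. assert (Hd := slit_plane_den _ H). assert (Hm := slit_plane_Cmod _ H).
  assert (E := Cmod_sqr (z + t * v)%C).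
  destruct z as [x y], v as [a b].
  set (w := ((x, y) + t * (a, b))%C) in *.
  assert (Ew : forall s, ((x, y) + RtoC s * (a, b))%C = (x + s * a, y + s * b)).
  { intros s. apply Ceq; simpl; ring. }
  assert (Er : Re w = x + t * a) by (unfold w; rewrite Ew; reflexivity).
  assert (Ei : Im w = y + t * b) by (unfold w; rewrite Ew; reflexivity).
  assert (Em : forall s, Cmod ((x, y) + RtoC s * (a, b))%C
     = sqrt ((x + s * a) * (x + s * a) + (y + s * b) * (y + s * b))).
  { intros s. rewrite Ew. unfold Cmod. simpl. f_equal; ring. }
  assert (Emw : Cmod w = sqrt ((x + t * a) * (x + t * a) + (y + t * b) * (y + t * b)))
    by apply Em.
  set (r := Cmod w) in *. rewrite Er, Ei in *.
  set (X := x + t * a) in *. set (Y := y + t * b) in *.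
  assert (Hr2 : 0 < X * X + Y * Y) by nra.
  assert (Einv : ((a, b) / w)%C = ((a * X + b * Y) / (r * r), (b * X - a * Y) / (r * r))).
  { unfold w. rewrite Ew. fold X Y. rewrite E.
    apply Ceq; unfold Cdiv, Cmult, Cinv; simpl; field; lra. }
  rewrite Einv. split; simpl.
  - apply is_derive_ext with (fun s => ln (sqrt ((x + s * a) * (x + s * a) + (y + s * b) * (y + s * b)))).
    { intros s; rewrite <- Em; reflexivity. }
    auto_derive.
    + fold X Y. repeat split; auto. apply sqrt_lt_R0; auto.
    + fold X Y. rewrite <- Emw. field. lra.
  (* The half-angle formula holds near t only, where its denominator stays positive by
     continuity. *)
  - apply is_derive_ext_loc with
      (fun s => 2 * atan ((y + s * b) / (sqrt ((x + s * a) * (x + s * a) + (y + s * b) * (y + s * b)) + (x + s * a)))).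
    { assert (Hcont : continuous (fun s => sqrt ((x + s * a) * (x + s * a) + (y + s * b) * (y + s * b)) + (x + s * a)) t).
      { apply (ex_derive_continuous (V := R_NormedModule)). auto_derive. fold X Y. auto. }
      assert (Hpos : locally t (fun s => 0 < sqrt ((x + s * a) * (x + s * a) + (y + s * b) * (y + s * b)) + (x + s * a))).
      { apply (Hcont (fun u => 0 < u)). apply (open_gt 0). fold X Y. rewrite <- Emw. auto. }
      eapply filter_imp; [|exact Hpos]. intros s Hs. simpl.
      symmetry. rewrite Carg_atan.
      - rewrite Em, Ew. simpl. reflexivity.
      - intros [H1 H2]. rewrite Ew in H1, H2. simpl in H1, H2. cbv beta in Hs. rewrite H1 in Hs.
        rewrite Rmult_0_l, Rplus_0_r in Hs.
        replace ((x + s * a) * (x + s * a)) with ((x + s * a)²) in Hs by reflexivity.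
        rewrite sqrt_Rsqr_abs, Rabs_left1 in Hs; lra. }
    auto_derive.
    + fold X Y. rewrite <- Emw. repeat split; auto. lra.
    + fold X Y. rewrite <- Emw. unfold Rsqr.
      replace (Y * Y) with (r * r - X * X) by lra.
      field_simplify_eq.
      * assert (HY : Y ^ 2 = r ^ 2 - X ^ 2) by (simpl; lra).
        replace (Y ^ 3) with (Y * Y ^ 2) by ring. rewrite HY. ring.
      * repeat split; try lra; nra.
Qed.

(** * Bernoulli numbers *)

(** Coefficients of x/(e^x - 1). The factorial turns the binomial recursion for the Bernoulli
    numbers into a convolution with the coefficients of (e^x - 1)/x. *)
Definition beta (n : nat) : R := Bernoulli n / INR (fact n).

Lemma Bernoulli_upto_eq p : forall j, (j <= p)%nat -> Bernoulli_upto p j = Bernoulli j.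
Proof.
  induction p; intros j Hj.
  - replace j with 0%nat by lia. reflexivity.
  - destruct (Nat.eq_dec j (S p)) as [->|Hne]; [reflexivity|].
    simpl. destruct (Nat.eqb_spec j (S p)); [contradiction|]. apply IHp; lia.
Qed.

Lemma beta_rec n : (1 <= n)%nat -> Rsum (fun j => beta j / INR (fact (S n - j))) (S n) = 0.
Proof.
  destruct n as [|p]; [lia|intros _].
  assert (H : Bernoulli (S p) = - / INR (S (S p)) * Rsum (fun j => Binomial.C (S (S p)) j * Bernoulli j) (S p)).
  { unfold Bernoulli at 1. cbn -[INR Binomial.C Nat.eqb sum_n]. rewrite Nat.eqb_refl, sum_n_Rsum.
    apply f_equal. transitivity (Rsum (fun j => Binomial.C (S (S p)) j * Bernoulli j) (S p)); [|reflexivity].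
    apply Rsum_ext. intros k Hk. rewrite Bernoulli_upto_eq by lia. reflexivity. }
  rewrite Rsum_S. replace (S (S p) - S p)%nat with 1%nat by lia.
  assert (Hf := INR_fact_neq_0).
  assert (E : Rsum (fun j => Binomial.C (S (S p)) j * Bernoulli j) (S p) =
     INR (fact (S (S p))) * Rsum (fun j => beta j / INR (fact (S (S p) - j))) (S p)).
  { rewrite <- Rsum_scal. apply Rsum_ext. intros k Hk. unfold Binomial.C, beta. field; auto. }
  rewrite E in H.
  unfold beta at 2. rewrite H. rewrite (fact_simpl (S p)), mult_INR. simpl (fact 1). simpl (INR 1).
  field. split; auto. apply not_0_INR; lia.
Qed.

Lemma fact_ge_pow2 n : 2 ^ n <= INR (fact (S n)).
Proof.
  induction n; [simpl; lra|]. rewrite fact_simpl, mult_INR, <- tech_pow_Rmult.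
  apply Rmult_le_compat; try lra; auto. apply pow_le; lra.
  replace 2 with (INR 2) by reflexivity. apply le_INR; lia.
Qed.

Lemma sum_inv_fact n : Rsum (fun i => / INR (fact (S (S i)))) n <= 1 - / 2 ^ n.
Proof.
  induction n; [simpl; lra|]. rewrite Rsum_S.
  assert (H := fact_ge_pow2 (S n)). assert (0 < 2 ^ S n) by (apply pow_lt; lra).
  assert (/ INR (fact (S (S n))) <= / 2 ^ S n) by (apply Rinv_le_contravar; auto).
  assert (0 < 2 ^ n) by (apply pow_lt; lra).
  replace (/ 2 ^ n) with (2 * / 2 ^ S n) in IHn; [cbv beta; lra|].
  rewrite <- tech_pow_Rmult. field; lra.
Qed.

Lemma Rsum_rev f n : Rsum f n = Rsum (fun k => f (n - 1 - k)%nat) n.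
Proof.
  induction n; [reflexivity|]. change (Rsum f (S n)) with (Rsum f n + f n).
  rewrite IHn, (Rsum_shift (fun k => _)), Rplus_comm. f_equal. f_equal; lia.
  apply Rsum_ext; intros k Hk; f_equal; lia.
Qed.

(** By induction: the recursion bounds the next coefficient by a partial sum of 1/2! + 1/3! + ...,
    which is below 1. This gives the generating series radius of convergence at least 1. *)
Lemma beta_bound n : Rabs (beta n) <= 1.
Proof.
  induction n as [n IH] using Wf_nat.lt_wf_ind. destruct n as [|n].
  - unfold beta, Bernoulli; simpl. rewrite Rabs_pos_eq; lra.
  - assert (H := beta_rec (S n) ltac:(lia)). simpl Rsum in H.
    fold (Rsum (fun j => beta j / INR (fact (S (S n) - j))) (S n)) in H.
    replace (Rsum _ n + _) with (Rsum (fun j => beta j / INR (fact (S (S n) - j))) (S n)) in H by reflexivity.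
    replace (match n with 0%nat => S n | S l => (n - l)%nat end) with 1%nat in H by (destruct n; lia).
    simpl (fact 1) in H. simpl (INR 1) in H.
    replace (beta (S n)) with (- Rsum (fun j => beta j / INR (fact (S (S n) - j))) (S n)) by lra.
    rewrite Rabs_Ropp.
    apply Rle_trans with (Rsum (fun j => / INR (fact (S (S n) - j))) (S n)).
    + rewrite <- Cmod_R, <- Csum_RtoC. apply Csum_Cmod. intros k Hk. rewrite Cmod_R.
      unfold Rdiv. rewrite Rabs_mult, (Rabs_pos_eq (/ _)).
      * rewrite <- (Rmult_1_l (/ _)) at 2. apply Rmult_le_compat_r; [|apply IH; lia].
        left; apply Rinv_0_lt_compat, INR_fact_lt_0.
      * left; apply Rinv_0_lt_compat, INR_fact_lt_0.
    + rewrite Rsum_rev.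
      rewrite (Rsum_ext _ (fun i => / INR (fact (S (S i))))).
      * eapply Rle_trans; [apply sum_inv_fact|].
        assert (0 < / 2 ^ S n) by (apply Rinv_0_lt_compat, pow_lt; lra). lra.
      * intros k Hk. do 3 f_equal. lia.
Qed.

(** * The Euler-Maclaurin formula on a unit interval *)

(** The j-th derivative is expanded to order p + 1 - j; its Taylor remainder contributes the j-th
    summand. *)
Definition EM_const (p : nat) : R := Rsum (fun j => Rabs (beta j) / INR (fact (S p - j))) (S p).

Lemma EM_const_pos p : 0 <= EM_const p.
Proof.
  apply Rsum_pos. intros k _. apply Rmult_le_pos; [apply Rabs_pos|].
  left; apply Rinv_0_lt_compat, INR_fact_lt_0.
Qed.

(** After collecting by m = j + i + 1, the coefficient of [x m] for m >= 2 is the sum that vanishes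
    by [beta_rec]. Raising p by one adds exactly one such coefficient. *)
Lemma EM_double_sum (x : nat -> C) p :
  Csum (fun j => RtoC (beta j) * Csum (fun i => x (j + S i)%nat * RtoC (/ INR (fact (S i)))) (S p - j))%C (S (S p))
  = x 1%nat.
Proof.
  induction p.
  - simpl. unfold beta; simpl. unfold Bernoulli; simpl.
    rewrite Rinv_1. replace (1 / 1) with 1 by field. ring.
  - set (u := fun p j => (RtoC (beta j) * Csum (fun i => x (j + S i)%nat * RtoC (/ INR (fact (S i)))) (S p - j))%C) in *.
    fold (u p) in IHp. fold (u (S p)).
    change (Csum (u (S p)) (S (S p)) + u (S p) (S (S p)) = x 1%nat)%C.
    assert (E0 : u (S p) (S (S p)) = 0%C).
    { unfold u. rewrite Nat.sub_diag. simpl. ring. }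
    rewrite E0.
    assert (E : Csum (u (S p)) (S (S p)) =
      (Csum (u p) (S (S p)) + x (S (S p)) * RtoC (Rsum (fun j => beta j / INR (fact (S (S p) - j)))%R (S (S p))))%C).
    { rewrite <- Csum_RtoC, <- Csum_scal, <- Csum_plus. apply Csum_ext. intros k Hk.
      unfold u. replace (S (S p) - k)%nat with (S (S p - k)) by lia. rewrite Csum_S.
      replace (k + S (S p - k))%nat with (S (S p)) by lia.
      unfold Rdiv. rewrite RtoC_mult. ring. }
    rewrite E, IHp, beta_rec by lia. ring.
Qed.

(* The recursion for the Bernoulli numbers says that sum_j beta_j D^(j-1) inverts e^D - 1;
   here e^D is replaced by Taylor polynomials. *)
Lemma Euler_Maclaurin (p : nat) (g : nat -> R -> C) (M : R) :
  (1 <= p)%nat ->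
  (forall j t, 0 <= t <= 1 -> dC (g j) t (g (S j) t)) ->
  (forall t, 0 <= t <= 1 -> Cmod (g (S p) t) <= M) ->
  Cmod (Csum (fun j => RtoC (beta j) * (g j 1 - g j 0)) (S p) - g 1%nat 0)%C <= EM_const p * M.
Proof.
  destruct p as [|p]; [lia|intros _]. intros Hg HM.
  rewrite <- (EM_double_sum (fun m => g m 0) p), <- Csum_minus.
  unfold EM_const. rewrite Rmult_comm, <- Rsum_scal. apply Csum_Cmod. intros j Hj.
  assert (H := Taylor_chain (S (S p) - j) (fun i => g (j + i)%nat) M).
  cbv beta in H. specialize (H ltac:(intros; rewrite Nat.add_succ_r; auto)).
  replace (j + (S (S p) - j))%nat with (S (S p)) in H by lia.
  specialize (H HM 1 ltac:(lra)). rewrite Nat.add_0_r in H.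
  (* The zeroth Taylor term is split off: it is the [g j 0] of the difference on the left. *)
  replace (S (S p) - j)%nat with (S (S p - j)) in H at 1 by lia.
  rewrite Csum_shift in H. rewrite Nat.add_0_r in H. simpl (1 ^ 0 / INR (fact 0)) in H.
  replace (1 / 1) with 1 in H by field. rewrite pow1 in H.
  match goal with |- Cmod ?e <= _ =>
    replace e with (RtoC (beta j) * (g j 1 - (g j 0 * 1 + Csum (fun k => g (j + S k)%nat 0 * RtoC (1 ^ S k / INR (fact (S k)))) (S p - j))))%C end.
  - rewrite Cmod_mult, Cmod_R. unfold Rdiv in *. rewrite Rmult_1_l in H.
    replace (M * (Rabs (beta j) * / INR (fact (S (S p) - j)))) with (Rabs (beta j) * (M * / INR (fact (S (S p) - j)))) by ring.
    apply Rmult_le_compat_l; [apply Rabs_pos|exact H].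
  - rewrite (Csum_ext (fun k => g (j + S k)%nat 0 * RtoC (1 ^ S k / INR (fact (S k))))%C
      (fun i => g (j + S i)%nat 0 * RtoC (/ INR (fact (S i))))%C).
    ring.
    intros k _. rewrite pow1. unfold Rdiv; rewrite Rmult_1_l; reflexivity.
Qed.

(** * The generating function of the Bernoulli numbers *)

Lemma CV_radius_ge_1 (a : nat -> R) (M : R) :
  (forall n, Rabs (a n) <= M) -> forall x, Rabs x < 1 -> Rbar_lt (Rabs x) (CV_radius a).
Proof.
  intros H x Hx. apply Rbar_lt_le_trans with 1; [exact Hx|].
  apply CV_radius_bounded. exists M. intros n. rewrite pow1, Rmult_1_r; auto.
Qed.

Lemma ex_pseries_bounded (a : nat -> R) (M x : R) :
  (forall n, Rabs (a n) <= M) -> Rabs x < 1 -> ex_pseries a x.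
Proof. intros H Hx. apply CV_radius_inside, CV_radius_ge_1 with M; auto. Qed.

Lemma CV_radius_pos (a : nat -> R) x : x <> 0 -> ex_pseries a x -> Rbar_lt 0 (CV_radius a).
Proof.
  intros Hx H. apply Rbar_not_le_lt. intros Hle.
  apply (CV_disk_outside a x).
  - apply Rbar_le_lt_trans with 0; auto. simpl. apply Rabs_pos_lt; auto.
  - apply ex_series_lim_0. apply ex_pseries_R. exact H.
Qed.

(** The coefficients are derivatives at 0 divided by factorials, and these depend only on the
    function near 0. *)
Lemma PSeries_coef_unique (a b : nat -> R) :
  (forall x, Rabs x < 1 -> ex_pseries a x) -> (forall x, Rabs x < 1 -> ex_pseries b x) ->
  (forall x, Rabs x < 1 -> PSeries a x = PSeries b x) -> forall n, a n = b n.
Proof.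
  intros Ha Hb H n.
  apply (CV_radius_pos a (1 / 2)) in Ha; try lra.
  apply (CV_radius_pos b (1 / 2)) in Hb; try lra.
  2,3: rewrite Rabs_pos_eq; lra.
  assert (E : Derive_n (PSeries a) n 0 = Derive_n (PSeries b) n 0).
  { apply Derive_n_ext_loc. exists (mkposreal 1 Rlt_0_1). intros y Hy. apply H.
    unfold ball in Hy; simpl in Hy. unfold AbsRing_ball in Hy.
    unfold abs, minus, plus, opp in Hy; simpl in Hy. rewrite Ropp_0, Rplus_0_r in Hy. exact Hy. }
  rewrite !Derive_n_coef in E by auto.
  apply Rmult_eq_reg_r with (INR (fact n)); auto. apply INR_fact_neq_0.
Qed.

(** Coefficients of x/(e^x - 1) + x/2 = (x/2) coth(x/2): dropping the linear term of [beta] makes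
    the function even. *)
Definition hcoef (n : nat) : R := match n with 1%nat => 0 | _ => beta n end.

Lemma beta_0 : beta 0 = 1.
Proof. unfold beta, Bernoulli; simpl; field. Qed.

Lemma beta_1 : beta 1 = - (1 / 2).
Proof. assert (H := beta_rec 1 ltac:(lia)). simpl in H. rewrite beta_0 in H. lra. Qed.

Lemma beta_2 : beta 2 = 1 / 12.
Proof. assert (H := beta_rec 2 ltac:(lia)). simpl in H. rewrite beta_0, beta_1 in H. lra. Qed.

Lemma hcoef_bound n : Rabs (hcoef n) <= 1.
Proof.
  destruct n as [|[|n]]; simpl; try apply beta_bound. rewrite Rabs_R0; lra.
Qed.

Definition invfact1 (n : nat) : R := / INR (fact (S n)).

Lemma invfact1_bound n : Rabs (invfact1 n) <= 1.
Proof.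
  unfold invfact1. rewrite Rabs_pos_eq.
  - rewrite <- Rinv_1. apply Rinv_le_contravar; [lra|].
    replace 1 with (INR 1) by reflexivity. apply le_INR. apply lt_O_fact.
  - left; apply Rinv_0_lt_compat, INR_fact_lt_0.
Qed.

Lemma PSeries_delta k c x : PSeries (fun n => if Nat.eqb n k then c else 0) x = c * x ^ k.
Proof.
  apply is_pseries_unique. apply is_pseries_R.
  apply (proj2 (is_lim_seq_incr_n (sum_n (fun n => (if Nat.eqb n k then c else 0) * x ^ n)) k (c * x ^ k))).
  apply is_lim_seq_ext with (fun _ => c * x ^ k); [|apply is_lim_seq_const].
  intros n. rewrite sum_n_Rsum.
  replace (S (n + k)) with (k + S n)%nat by lia. rewrite Rsum_split, Rsum_shift.
  rewrite Nat.add_0_r, Nat.eqb_refl.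
  assert (Hz : forall f m, (forall i, (i < m)%nat -> f i = 0) -> Rsum f m = 0).
  { intros f m; induction m; simpl; intros Hi; [auto|]. rewrite IHm, Hi; auto; ring. }
  rewrite !Hz; [ring| |].
  - intros i Hi. destruct (Nat.eqb_spec (k + S i) k); [lia|ring].
  - intros i Hi. destruct (Nat.eqb_spec i k); [lia|ring].
Qed.

Lemma PSeries_invfact1 x : x * PSeries invfact1 x = exp x - 1.
Proof.
  assert (H := is_exp_Reals x).
  assert (Hx : ex_pseries (fun n => / INR (fact n)) x) by (eexists; exact H).
  apply is_pseries_unique in H. rewrite PSeries_decr_1 in H by auto.
  simpl (/ INR (fact 0)) in H. rewrite Rinv_1 in H. unfold PS_decr_1 in H.
  unfold invfact1. lra.
Qed.

Lemma PSeries_beta x : Rabs x < 1 -> PSeries beta x * PSeries invfact1 x = 1.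
Proof.
  intros Hx. rewrite <- PSeries_mult.
  - rewrite (PSeries_ext _ (fun n => if Nat.eqb n 0 then 1 else 0)).
    + rewrite PSeries_delta. simpl; ring.
    + intros n. unfold PS_mult. rewrite <- sum_n_Reals, sum_n_Rsum.
      destruct n as [|n].
      * simpl. rewrite beta_0. unfold invfact1; simpl. field.
      * simpl Nat.eqb. cbv iota. rewrite <- (beta_rec (S n)) by lia. apply Rsum_ext. intros k Hk.
        unfold invfact1, Rdiv. do 3 f_equal. f_equal. lia.
  - apply CV_radius_ge_1 with 1; auto. apply beta_bound.
  - apply CV_radius_ge_1 with 1; auto. apply invfact1_bound.
Qed.

Lemma exp_neq_1 x : x <> 0 -> exp x - 1 <> 0.
Proof.
  intros Hx H. apply Hx. apply exp_inv. rewrite exp_0. lra.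
Qed.

Lemma PSeries_hcoef x : Rabs x < 1 -> x <> 0 -> PSeries hcoef x = x / (exp x - 1) + x / 2.
Proof.
  intros Hx Hx0.
  assert (E : PSeries hcoef x = PSeries beta x + x / 2).
  { replace (x / 2) with (PSeries (fun n => if Nat.eqb n 1 then / 2 else 0) x)
      by (rewrite PSeries_delta; field).
    rewrite <- PSeries_plus.
    - apply PSeries_ext. intros [|[|n]]; unfold PS_plus, plus; simpl; try ring.
      rewrite beta_1. field.
    - apply ex_pseries_bounded with 1; auto. apply beta_bound.
    - apply ex_pseries_bounded with 1; auto.
      intros [|[|n]]; simpl; rewrite Rabs_pos_eq; lra. }
  rewrite E. f_equal.
  assert (H1 := PSeries_beta x Hx). assert (H2 := PSeries_invfact1 x). rewrite <- H2 in *.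
  assert (PSeries invfact1 x <> 0) by (intros H; rewrite H in H1; lra).
  apply Rmult_eq_reg_r with (PSeries invfact1 x); auto. rewrite H1. field. auto.
Qed.

Lemma hcoef_0 : hcoef 0 = 1.
Proof. apply beta_0. Qed.

(** Evenness of (x/2) coth(x/2), read off from uniqueness of the coefficients. *)
Lemma hcoef_odd n : hcoef (2 * n + 1) = 0.
Proof.
  assert (H : forall n, hcoef n = (-1) ^ n * hcoef n).
  { apply PSeries_coef_unique.
    - intros x. apply ex_pseries_bounded with 1, hcoef_bound.
    - intros x. apply ex_pseries_bounded with 1.
      intros k. rewrite Rabs_mult, pow_1_abs, Rmult_1_l. apply hcoef_bound.
    - intros x Hx.
      assert (E : PSeries (fun n => (-1) ^ n * hcoef n) x = PSeries hcoef (- x)).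
      { unfold PSeries. apply Series_ext. intros k.
        replace (- x) with (-1 * x) by ring. rewrite Rpow_mult_distr. ring. }
      rewrite E. destruct (Req_dec x 0) as [->|Hx0]; [f_equal; ring|].
      rewrite !PSeries_hcoef; auto; try lra.
      2: rewrite Rabs_Ropp; auto.
      assert (H3 := exp_neq_1 x Hx0). rewrite exp_Ropp. assert (He := exp_pos x).
      field. split; [|split]; auto; lra. }
  specialize (H (2 * n + 1)%nat). rewrite pow_add, pow_1_even in H. lra.
Qed.

(** Coefficients of the Riccati equation h^2 = h - x h' + x^2/4 satisfied by h = (x/2) coth(x/2);
    the exceptional value at n = 2 is the term x^2/4. This is the source of the quadratic
    recursion. *)
Lemma hcoef_ode n : Rsum (fun k => hcoef k * hcoef (n - k)) (S n) =
   hcoef n - INR n * hcoef n + (if Nat.eqb n 2 then 1 / 4 else 0).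
Proof.
  assert (Hr : forall x, Rabs x < 1 -> Rbar_lt (Rabs x) (CV_radius hcoef)).
  { apply CV_radius_ge_1 with 1. apply hcoef_bound. }
  set (d := PS_incr_1 (PS_derive hcoef)).
  assert (Hd : forall n, d n = INR n * hcoef n).
  { intros [|k]; unfold d; simpl PS_incr_1. simpl; unfold zero; simpl; ring. reflexivity. }
  assert (Hdr : forall x, Rabs x < 1 -> Rbar_lt (Rabs x) (CV_radius d)).
  { intros x Hx. unfold d. rewrite CV_radius_incr_1, CV_radius_derive. auto. }
  set (q := fun n => if Nat.eqb n 2 then 1 / 4 else 0).
  assert (Hq : forall x, Rabs x < 1 -> Rbar_lt (Rabs x) (CV_radius q)).
  { apply CV_radius_ge_1 with 1. intros k; unfold q. destruct (Nat.eqb k 2); rewrite Rabs_pos_eq; lra. }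
  set (rhs := PS_plus (PS_minus hcoef d) q).
  assert (H : forall n, PS_mult hcoef hcoef n = rhs n).
  { apply PSeries_coef_unique.
    - intros x Hx. apply ex_pseries_mult; auto.
    - intros z Hz. apply ex_pseries_plus; [apply ex_pseries_minus|]; apply CV_radius_inside; auto.
    - intros x Hx. rewrite PSeries_mult by auto. unfold rhs.
      rewrite PSeries_plus, PSeries_minus.
      2-3: apply CV_radius_inside; auto.
      2: apply ex_pseries_minus; apply CV_radius_inside; auto.
      2: apply CV_radius_inside; auto.
      unfold q. rewrite PSeries_delta. unfold d. rewrite PSeries_incr_1, <- Derive_PSeries by auto.
      destruct (Req_dec x 0) as [->|Hx0].
      { rewrite PSeries_0, hcoef_0. ring. }
      assert (E : Derive (PSeries hcoef) x = Derive (fun x => x / (exp x - 1) + x / 2) x).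
      { apply Derive_ext_loc.
        (* This radius keeps the neighbourhood of x inside the punctured unit disc, where the closed
           form holds. *)
        assert (Hp : 0 < Rmin (Rabs x) (1 - Rabs x)).
        { apply Rmin_pos; [apply Rabs_pos_lt; auto|lra]. }
        exists (mkposreal _ Hp). intros y Hy.
        unfold ball in Hy; simpl in Hy. unfold AbsRing_ball, abs, minus, plus, opp in Hy; simpl in Hy.
        assert (Hy1 := Rlt_le_trans _ _ _ Hy (Rmin_l _ _)).
        assert (Hy2 := Rlt_le_trans _ _ _ Hy (Rmin_r _ _)).
        apply PSeries_hcoef.
        - replace y with ((y + - x) + x) by ring. eapply Rle_lt_trans; [apply Rabs_triang|lra].
        - intros ->. rewrite Rplus_0_l, Rabs_Ropp in Hy1. lra. }
      rewrite E, PSeries_hcoef by auto. assert (H3 := exp_neq_1 x Hx0).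
      erewrite is_derive_unique.
      2:{ auto_derive; [|reflexivity]. auto. }
      field; auto. }
  specialize (H n). unfold PS_mult in H. rewrite <- sum_n_Reals, sum_n_Rsum in H.
  rewrite H. unfold rhs, PS_plus, PS_minus, PS_opp, plus, opp; simpl. rewrite Hd. reflexivity.
Qed.

(** * Signs and growth of the Bernoulli numbers *)

Lemma beta_odd n : (1 <= n)%nat -> beta (2 * n + 1) = 0.
Proof.
  intros Hn. rewrite <- (hcoef_odd n). destruct n as [|n]; [lia|].
  replace (2 * S n + 1)%nat with (S (S (2 * n + 1))) by lia. reflexivity.
Qed.

Lemma Rsum_even f n : (forall k, f (2 * k + 1)%nat = 0) ->
  Rsum f (S (2 * n)) = Rsum (fun k => f (2 * k)%nat) (S n).
Proof.
  intros H. induction n; [reflexivity|].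
  replace (S (2 * S n)) with (S (S (S (2 * n)))) by lia.
  rewrite Rsum_S, (Rsum_S _ (S (2 * n))), IHn, (Rsum_S _ (S n)).
  replace (S (2 * n)) with (2 * n + 1)%nat at 1 by lia. rewrite H.
  replace (S (S (2 * n))) with (2 * S n)%nat by lia. ring.
Qed.

(* tau n = |B_2n| / (2n)! for n >= 1. *)
Definition tau (n : nat) : R := (-1) ^ (n + 1) * hcoef (2 * n).

Lemma tau_1 : tau 1 = 1 / 12.
Proof. unfold tau. simpl. rewrite beta_2. ring. Qed.

(** In [hcoef_ode] at 2N with N = n + 2, the two end terms are each [hcoef (2 * N)] because
    [hcoef 0] is 1; moved to the other side they give the factor 2N + 1. The alternating sign in
    [tau] makes all remaining products enter positively. *)
Lemma tau_rec n : (INR (2 * S (S n) + 1)) * tau (S (S n)) = Rsum (fun k => tau (S k) * tau (S n - k)) (S n).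
Proof.
  set (N := S (S n)).
  assert (H := hcoef_ode (2 * N)).
  rewrite Rsum_even in H.
  2:{ intros k. rewrite hcoef_odd. ring. }
  replace (Nat.eqb (2 * N) 2) with false in H by (symmetry; apply Nat.eqb_neq; unfold N; lia).
  unfold N in H at 2. rewrite Rsum_S, Rsum_shift in H.
  rewrite Nat.mul_0_r, Nat.sub_0_r in H.
  fold N in H. rewrite Nat.sub_diag, hcoef_0 in H.
  assert (E : Rsum (fun k => tau (S k) * tau (S n - k)) (S n) =
    (-1) ^ N * Rsum (fun k => hcoef (2 * S k) * hcoef (2 * N - 2 * S k)) (S n)).
  { rewrite <- Rsum_scal. apply Rsum_ext. intros k Hk. unfold tau.
    replace (2 * N - 2 * S k)%nat with (2 * (S n - k))%nat by (unfold N; lia).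
    replace N with (k + (S (S n) - k))%nat by (unfold N; lia).
    replace (S k + 1)%nat with (k + 2)%nat by lia.
    replace (S n - k + 1)%nat with (S (S n) - k)%nat by lia.
    rewrite !pow_add. simpl. ring. }
  rewrite E.
  replace (Rsum (fun k => hcoef (2 * S k) * hcoef (2 * N - 2 * S k)) (S n))
    with (- INR (2 * N + 1) * hcoef (2 * N)).
  - unfold tau. replace (N + 1)%nat with (S N) by lia. simpl pow. ring.
  - rewrite plus_INR. simpl (INR 1). lra.
Qed.

Lemma tau_pos n : 0 < tau (S n).
Proof.
  induction n as [n IH] using Wf_nat.lt_wf_ind. destruct n as [|n].
  - rewrite tau_1; lra.
  - assert (H := tau_rec n).
    assert (Hp : 0 < INR (2 * S (S n) + 1)) by (apply lt_0_INR; lia).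
    assert (0 < Rsum (fun k => tau (S k) * tau (S n - k)) (S n)).
    { rewrite Rsum_S. rewrite <- (Rplus_0_l 0). apply Rplus_le_lt_compat.
      - apply Rsum_pos. intros k Hk. replace (S n - k)%nat with (S (n - k)) by lia.
        left. apply Rmult_lt_0_compat; apply IH; lia.
      - replace (S n - n)%nat with 1%nat by lia. apply Rmult_lt_0_compat; apply IH; lia. }
    nra.
Qed.

Lemma Rsum_ge_term f n k : (forall i, (i < n)%nat -> 0 <= f i) -> (k < n)%nat -> f k <= Rsum f n.
Proof.
  induction n; intros H Hk; [lia|]. rewrite Rsum_S.
  destruct (Nat.eq_dec k n) as [->|Hne].
  - assert (0 <= Rsum f n) by (apply Rsum_pos; auto). lra.
  - assert (f k <= Rsum f n) by (apply IHn; auto; lia). specialize (H n ltac:(lia)). lra.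
Qed.

(** One term of the recursion, all of whose terms are positive. *)
Lemma tau_supermult k l : tau (S k) * tau (S l) <= INR (2 * (k + l) + 5) * tau (S (S (k + l))).
Proof.
  assert (H := tau_rec (k + l)). replace (2 * (k + l) + 5)%nat with (2 * S (S (k + l)) + 1)%nat by lia.
  rewrite H. replace (S l) with (S (k + l) - k)%nat by lia.
  apply (Rsum_ge_term (fun k0 => tau (S k0) * tau (S (k + l) - k0)) (S (k + l)) k); [|lia].
  intros i Hi. replace (S (k + l) - i)%nat with (S (k + l - i)) by lia.
  left; apply Rmult_lt_0_compat; apply tau_pos.
Qed.

(** Compare two consecutive instances of the recursion: the later one has termwise smaller products
    and one extra summand, 1/12 of the preceding value, while the factor on its left grows by 2. *)
Lemma tau_decr n : tau (S (S n)) <= tau (S n).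
Proof.
  induction n as [n IH] using Wf_nat.lt_wf_ind. destruct n as [|n].
  - assert (H := tau_rec 0). simpl in H. rewrite tau_1 in *. lra.
  - assert (H := tau_rec (S n)). rewrite Rsum_S in H.
    replace (S (S n) - S n)%nat with 1%nat in H by lia. rewrite tau_1 in H.
    assert (H1 := tau_rec n).
    assert (Rsum (fun k => tau (S k) * tau (S (S n) - k)) (S n) <= Rsum (fun k => tau (S k) * tau (S n - k)) (S n)).
    { apply Rsum_le. intros k Hk. apply Rmult_le_compat_l; [left; apply tau_pos|].
      replace (S (S n) - k)%nat with (S (S (n - k))) by lia.
      replace (S n - k)%nat with (S (n - k)) by lia. apply IH; lia. }
    assert (Hp := tau_pos (S n)). assert (Hp' := tau_pos (S (S n))).
    assert (E : INR (2 * S (S (S n)) + 1) = INR (2 * S (S n) + 1) + 2).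
    { replace (2 * S (S (S n)) + 1)%nat with (2 * S (S n) + 1 + 2)%nat by lia. rewrite plus_INR. reflexivity. }
    rewrite E in H. assert (0 < INR (2 * S (S n) + 1)) by (apply lt_0_INR; lia). nra.
Qed.

Lemma tau_decr_le m n : (m <= n)%nat -> tau (S n) <= tau (S m).
Proof. induction 1; [lra|]. eapply Rle_trans; [apply tau_decr|]; auto. Qed.

(** The denominator cancels the top factors of (2n+4)!. What remains separates the factorial growth
    from the slowly varying [tau]. *)
Lemma Bernoulli_coef_tau n :
  Bernoulli_coef (S n) = (-1) ^ S n * (tau (S (S n)) * INR (fact (2 * n + 1))).
Proof.
  unfold Bernoulli_coef, tau.
  replace (2 * S n + 2)%nat with (S (S (2 * S n))) by lia.
  replace (2 * S (S n))%nat with (S (S (2 * S n))) by lia.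
  change (hcoef (S (S (2 * S n)))) with (beta (S (S (2 * S n)))).
  unfold beta. rewrite (fact_simpl (S (2 * S n))), (fact_simpl (2 * S n)).
  replace (2 * S n)%nat with (S (2 * n + 1)) by lia. rewrite (fact_simpl (2 * n + 1)).
  rewrite !mult_INR. replace (S (2 * n + 1) + 1)%nat with (S (S (2 * n + 1))) by lia.
  replace ((-1) ^ (S (S n) + 1)) with ((-1) ^ S n).
  2:{ replace (S (S n) + 1)%nat with (S n + 2)%nat by lia. rewrite pow_add. simpl; ring. }
  assert (E : ((-1) ^ S n) * ((-1) ^ S n) = 1).
  { rewrite <- Rpow_mult_distr. replace (-1 * -1) with 1 by ring. apply pow1. }
  field_simplify; repeat split; try apply INR_fact_neq_0; try (apply not_0_INR; lia).
  replace (((-1) ^ S n) ^ 2) with (((-1) ^ S n) * ((-1) ^ S n)) by ring.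
  rewrite E. field. repeat split; try apply INR_fact_neq_0; try (apply not_0_INR; lia).
Qed.

Definition alpha (n : nat) : R := Rabs (Bernoulli_coef n).

Lemma alpha_tau n : alpha (S n) = tau (S (S n)) * INR (fact (2 * n + 1)).
Proof.
  unfold alpha. rewrite Bernoulli_coef_tau, Rabs_mult, pow_1_abs, Rmult_1_l, Rabs_pos_eq; auto.
  left. apply Rmult_lt_0_compat; [apply tau_pos|apply INR_fact_lt_0].
Qed.

Lemma alpha_pos n : 0 < alpha (S n).
Proof. rewrite alpha_tau. apply Rmult_lt_0_compat; [apply tau_pos|apply INR_fact_lt_0]. Qed.

(** Passing to the next [tau] costs at most the factor 12(2n+7), by supermultiplicativity against
    [tau 1], whereas the factorial gains (2n+2)(2n+3). The constant 30 makes the resulting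
    comparison true from n = 0 on. *)
Lemma alpha_ratio n : INR (S (S n)) * alpha (S n) <= 30 * alpha (S (S n)).
Proof.
  rewrite !alpha_tau.
  assert (H := tau_supermult 0 (S n)). rewrite tau_1 in H. simpl (0 + S n)%nat in H.
  replace (2 * S n + 1)%nat with (S (S (2 * n + 1))) by lia.
  rewrite (fact_simpl (S (2 * n + 1))), (fact_simpl (2 * n + 1)), !mult_INR.
  assert (Hf := INR_fact_lt_0 (2 * n + 1)). set (F := INR (fact (2 * n + 1))) in *.
  assert (Hp := tau_pos (S (S n))). set (u := tau (S (S (S n)))) in *. set (v := tau (S (S n))) in *.
  replace (INR (S (S n))) with (INR n + 2) by (rewrite !S_INR; ring).
  replace (INR (S (S (2 * n + 1)))) with (2 * INR n + 3) by (rewrite !S_INR, plus_INR, mult_INR; simpl; ring).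
  replace (INR (S (2 * n + 1))) with (2 * INR n + 2) by (rewrite !S_INR, plus_INR, mult_INR; simpl; ring).
  replace (INR (2 * S n + 5)) with (2 * INR n + 7) in H by (rewrite plus_INR, mult_INR, (S_INR n); simpl; ring).
  assert (Hn := pos_INR n). set (x := INR n) in *.
  assert (Hv : v <= 12 * (2 * x + 7) * u) by lra.
  apply Rle_trans with ((x + 2) * (12 * (2 * x + 7) * u * F)).
  - apply Rmult_le_compat_l; [lra|]. apply Rmult_le_compat_r; lra.
  - replace (30 * (u * ((2 * x + 3) * ((2 * x + 2) * F)))) with ((30 * (2 * x + 3) * (2 * x + 2)) * (u * F)) by ring.
    replace ((x + 2) * (12 * (2 * x + 7) * u * F)) with ((12 * (x + 2) * (2 * x + 7)) * (u * F)) by ring.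
    apply Rmult_le_compat_r; [left; apply Rmult_lt_0_compat; auto|]. nra.
Qed.

(** Adding d to the larger argument multiplies by larger factors. In a convolution this pushes a
    product of two factorials to its extreme position. *)
Lemma fact_log_convex a q d : (a <= q)%nat ->
  INR (fact (a + d)) * INR (fact q) <= INR (fact a) * INR (fact (q + d)).
Proof.
  intros H. rewrite <- !mult_INR. apply le_INR.
  induction d. rewrite !Nat.add_0_r; lia.
  rewrite !Nat.add_succ_r. rewrite !fact_simpl.
  assert (S (a + d) <= S (q + d))%nat by lia. nia.
Qed.

(* Supermultiplicativity of tau loses a factor of order n, which the factorials win back
   except in the two extreme terms. *)
Lemma alpha_convolution m : (1 <= m)%nat -> exists C, 0 <= C /\ forall n, (2 * m <= n)%nat ->
  Rsum (fun k => alpha (m + k) * alpha (n - m - k)) (S (n - 2 * m)) <= C * alpha (n - m).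
Proof.
  (* The two end terms of the sum are [alpha m * alpha (n - m)]; the other summand of the constant
     bounds the whole interior. *)
  intros Hm. exists (2 * alpha m + 7 * INR (fact (2 * m + 1))).
  assert (Hpa : forall k, (1 <= k)%nat -> 0 < alpha k).
  { intros [|k] Hk; [lia|apply alpha_pos]. }
  assert (Hf := INR_fact_lt_0 (2 * m + 1)).
  assert (Ham := Hpa m Hm).
  split; [lra|]. intros n Hn.
  assert (Hanm := Hpa (n - m)%nat ltac:(lia)).
  destruct (Nat.eq_dec n (2 * m)) as [->|Hne].
  - rewrite Nat.sub_diag, Rsum_S. simpl Rsum. rewrite Nat.add_0_r, Nat.sub_0_r. nra.
  - destruct (n - 2 * m)%nat as [|d] eqn:E; [lia|].
    assert (En : n = (2 * m + S d)%nat) by lia.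
    rewrite Rsum_S, Rsum_shift.
    rewrite Nat.add_0_r, Nat.sub_0_r. replace (m + S d)%nat with (n - m)%nat by lia.
    replace (n - m - S d)%nat with m by lia.
    assert (Hmid : Rsum (fun k => alpha (m + S k) * alpha (n - m - S k)) d
                   <= 7 * INR (fact (2 * m + 1)) * alpha (n - m)).
    (* Each of the d interior terms is at most a fraction 1/(d+1) of the bound claimed for their
       sum. *)
    { apply Rle_trans with (Rsum (fun _ => / INR (S d) * (7 * INR (fact (2 * m + 1)) * alpha (n - m))) d).
      - apply Rsum_le. intros k Hk.
        set (i := (m + k)%nat).
        replace (m + S k)%nat with (S i) by (unfold i; lia).
        set (j := (n - m - S k - 1)%nat).
        replace (n - m - S k)%nat with (S j) by (unfold j; lia).
        set (l := (n - m - 1)%nat). replace (n - m)%nat with (S l) by (unfold l; lia).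
        rewrite !alpha_tau.
        assert (H1 := tau_supermult (S i) (S j)).
        assert (H2 : tau (S (S (S i + S j))) <= tau (S (S l))) by (apply tau_decr_le; unfold i, j, l; lia).
        (* The smaller index is moved down to m. Stopping at (2l - 1)! leaves the factors 2l and 2l
           + 1 of the (2l + 1)! in [alpha (S l)] to pay for d + 1 and for the loss 2n + 5. *)
        assert (H3 : INR (fact (2 * i + 1)) * INR (fact (2 * j + 1))
                     <= INR (fact (2 * m + 1)) * INR (fact (2 * l - 1))).
        { destruct (Nat.le_ge_cases i j) as [Hij|Hij].
          - replace (2 * i + 1)%nat with (2 * m + 1 + 2 * k)%nat by (unfold i; lia).
            replace (2 * l - 1)%nat with (2 * j + 1 + 2 * k)%nat by (unfold j, l; lia).
            apply fact_log_convex. unfold i, j in *; lia.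
          - set (e := (j - m)%nat).
            replace (2 * j + 1)%nat with (2 * m + 1 + 2 * e)%nat by (unfold e, j in *; lia).
            replace (2 * l - 1)%nat with (2 * i + 1 + 2 * e)%nat by (unfold e, i, j, l in *; lia).
            rewrite Rmult_comm. apply fact_log_convex. unfold i in *; lia. }
        assert (Ht1 := tau_pos (S i)). assert (Ht2 := tau_pos (S j)).
        assert (Ht3 := tau_pos (S l)).
        assert (Hf1 := INR_fact_lt_0 (2 * i + 1)). assert (Hf2 := INR_fact_lt_0 (2 * j + 1)).
        assert (Hf3 := INR_fact_lt_0 (2 * l - 1)).
        assert (Hl : (1 <= l)%nat) by (unfold l; lia).
        replace (2 * l + 1)%nat with (S (S (2 * l - 1))) by lia.
        rewrite (fact_simpl (S _)), (fact_simpl (2 * l - 1)), !mult_INR.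
        set (F := INR (fact (2 * l - 1))) in *.
        set (q := INR (2 * (S i + S j) + 5)) in *.
        assert (Hq : 0 <= q) by apply pos_INR.
        apply Rle_trans with ((q * tau (S (S l))) * (INR (fact (2 * m + 1)) * F)).
        + replace (tau (S (S i)) * INR (fact (2 * i + 1)) * (tau (S (S j)) * INR (fact (2 * j + 1))))
            with ((tau (S (S i)) * tau (S (S j))) * (INR (fact (2 * i + 1)) * INR (fact (2 * j + 1)))) by ring.
          apply Rmult_le_compat; auto.
          * left; apply Rmult_lt_0_compat; auto.
          * left; apply Rmult_lt_0_compat; auto.
          * eapply Rle_trans; [apply H1|]. apply Rmult_le_compat_l; auto.
        + assert (HSd := INR_S_pos d).
          apply Rmult_le_reg_l with (INR (S d)); auto.
          rewrite <- (Rmult_assoc (INR (S d)) (/ INR (S d))), Rinv_r by lra. rewrite Rmult_1_l.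
          replace (INR (S d) * (q * tau (S (S l)) * (INR (fact (2 * m + 1)) * F)))
            with ((INR (S d) * q) * (INR (fact (2 * m + 1)) * tau (S (S l)) * F)) by ring.
          replace (7 * INR (fact (2 * m + 1)) * (tau (S (S l)) * (INR (S (S (2 * l - 1))) * (INR (S (2 * l - 1)) * F))))
            with ((7 * (INR (S (S (2 * l - 1))) * INR (S (2 * l - 1)))) * (INR (fact (2 * m + 1)) * tau (S (S l)) * F)) by ring.
          apply Rmult_le_compat_r.
          { left. apply Rmult_lt_0_compat; [apply Rmult_lt_0_compat|]; auto. }
          unfold q. replace 7 with (INR 7) by (simpl; ring). rewrite <- !mult_INR. apply le_INR.
          apply Nat.le_trans with (n * (2 * n + 5))%nat.
          { apply Nat.mul_le_mono; unfold i, j in *; lia. }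
          apply Nat.le_trans with (7 * (n * n + n))%nat; [nia|].
          apply Nat.mul_le_mono_l.
          apply Nat.le_trans with (S n * n)%nat; [lia|].
          (* An interior index exists only for d >= 1, whence n <= 2l. *)
          apply Nat.mul_le_mono; unfold l; lia.
      - assert (HSd := INR_S_pos d).
        assert (Hc : forall c k, Rsum (fun _ => c) k = INR k * c).
        { intros c k. induction k; [simpl; ring|]. rewrite Rsum_S, IHk, S_INR. ring. }
        rewrite Hc. rewrite <- Rmult_assoc.
        rewrite <- (Rmult_1_l (7 * _ * _)) at 2. apply Rmult_le_compat_r.
        + apply Rmult_le_pos; lra.
        + apply Rmult_le_reg_r with (INR (S d)); auto. rewrite Rmult_assoc, Rinv_l by lra.
          rewrite S_INR; lra. }
    lra.
Qed.

(** * Coefficients of exp (r sum_k a_k x^k) *)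

Lemma Rsum_triangle (f : nat -> nat -> R) m :
  Rsum (fun i => Rsum (fun l => f i l) (m - i)) m = Rsum (fun s => Rsum (fun i => f i (s - i)%nat) (S s)) m.
Proof.
  induction m; [reflexivity|]. rewrite (Rsum_S (fun s => Rsum (fun i => f i (s - i)%nat) (S s)) m), <- IHm.
  rewrite (Rsum_ext _ (fun i => Rsum (fun l => f i l) (m - i) + f i (m - i)%nat)).
  - rewrite Rsum_plus. f_equal. rewrite Rsum_S, Nat.sub_diag. simpl; ring.
  - intros i Hi. replace (S m - i)%nat with (S (m - i)) by lia. reflexivity.
Qed.

(** The recursion expresses B' = r a' B for B = exp(r a). All earlier coefficients are needed, so a
    table is carried along, as for the Bernoulli numbers, and the recursion stays structural. *)
Fixpoint exp_coef_upto (r : R) (a : nat -> R) (n : nat) : nat -> R :=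
  match n with
  | O => fun _ => 1
  | S p => fun k =>
      if Nat.eqb k (S p)
      then r / INR (S p) * Rsum (fun i => INR (S i) * a (S i) * exp_coef_upto r a p (p - i)) (S p)
      else exp_coef_upto r a p k
  end.

Definition exp_coef r a n := exp_coef_upto r a n n.

Lemma exp_coef_upto_eq r a p : forall j, (j <= p)%nat -> exp_coef_upto r a p j = exp_coef r a j.
Proof.
  induction p; intros j Hj.
  - replace j with 0%nat by lia. reflexivity.
  - destruct (Nat.eq_dec j (S p)) as [->|Hne]; [reflexivity|].
    simpl. destruct (Nat.eqb_spec j (S p)); [contradiction|]. apply IHp; lia.
Qed.

Lemma exp_coef_rec r a n :
  INR n * exp_coef r a n = r * Rsum (fun i => INR i * a i * exp_coef r a (n - i)) (S n).
Proof.
  rewrite Rsum_shift. simpl (INR 0). destruct n as [|p]; [simpl; ring|].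
  assert (E : exp_coef r a (S p) = r / INR (S p) *
     Rsum (fun i => INR (S i) * a (S i) * exp_coef r a (p - i)) (S p)).
  { unfold exp_coef at 1. cbn -[INR Rsum Nat.sub Nat.eqb]. rewrite Nat.eqb_refl. f_equal.
    apply Rsum_ext. intros k Hk. rewrite exp_coef_upto_eq by lia. reflexivity. }
  rewrite E. assert (H := INR_S_pos p).
  replace (INR (S p) * (r / INR (S p) * Rsum (fun i => INR (S i) * a (S i) * exp_coef r a (p - i)) (S p)))
    with (r * Rsum (fun i => INR (S i) * a (S i) * exp_coef r a (p - i)) (S p)) by (field; lra).
  rewrite Rmult_0_l, Rmult_0_l, Rplus_0_l. reflexivity.
Qed.

Lemma Rsum_abs f n : Rabs (Rsum f n) <= Rsum (fun k => Rabs (f k)) n.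
Proof.
  induction n; [simpl; rewrite Rabs_R0; lra|].
  rewrite !Rsum_S. eapply Rle_trans; [apply Rabs_triang|lra].
Qed.

(** In the recursion for b_n the linear term is r a_n. The other terms form a convolution bounded by
    a multiple of [alpha (n - 1)], which is [alpha n] divided by a quantity of order n; for large n
    they use up only half of K, and the induction closes. *)
Lemma exp_coef_growth r : exists K, 0 <= K /\
  forall n, (1 <= n)%nat -> Rabs (exp_coef r Bernoulli_coef n) <= K * alpha n.
Proof.
  set (b := exp_coef r Bernoulli_coef).
  destruct (alpha_convolution 1 ltac:(lia)) as [C [HC HCn]].
  (* Twice the 30 of [alpha_ratio]: beyond this index the convolution contributes at most half of K
     times [alpha n]. *)
  destruct (nfloor_ex (60 * Rabs r * C)) as [n1 [_ Hn1]].
  { generalize (Rabs_pos r); nra. }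
  set (K0 := Rsum (fun j => Rabs (b (S j)) / alpha (S j)) (S n1)).
  assert (Hinit : forall j, (j <= n1)%nat -> Rabs (b (S j)) <= K0 * alpha (S j)).
  { intros j Hj. assert (Hp := alpha_pos j).
    apply Rmult_le_reg_r with (/ alpha (S j)); [apply Rinv_0_lt_compat; auto|].
    rewrite Rmult_assoc, Rinv_r, Rmult_1_r by lra.
    apply (Rsum_ge_term (fun j => Rabs (b (S j)) / alpha (S j)) (S n1) j); [|lia].
    intros i _. apply Rmult_le_pos; [apply Rabs_pos|].
    left; apply Rinv_0_lt_compat, alpha_pos. }
  (* K0 covers the finitely many initial indices, and half of 2|r| covers the linear term. *)
  set (K := K0 + 2 * Rabs r).
  assert (HK0 : 0 <= K0).
  { apply Rsum_pos. intros i _. apply Rmult_le_pos; [apply Rabs_pos|].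
    left; apply Rinv_0_lt_compat, alpha_pos. }
  assert (Hr := Rabs_pos r).
  exists K. split; [unfold K; lra|].
  assert (H : forall p, Rabs (b (S p)) <= K * alpha (S p)).
  2:{ intros [|p] Hp; [lia|auto]. }
  induction p as [p IH] using Wf_nat.lt_wf_ind.
  assert (Hp := alpha_pos p).
  destruct (Nat.le_gt_cases p n1) as [Hle|Hgt].
  { eapply Rle_trans; [apply Hinit; auto|]. apply Rmult_le_compat_r; [lra|]. unfold K; lra. }
  assert (Hrec := exp_coef_rec r Bernoulli_coef (S p)). fold b in Hrec.
  destruct p as [|q]; [lia|].
  rewrite Rsum_shift, Rsum_S in Hrec. simpl (INR 0) in Hrec.
  replace (S (S q) - S (S q))%nat with 0%nat in Hrec by lia.
  assert (Hb0 : b 0%nat = 1) by reflexivity. rewrite Hb0 in Hrec.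
  set (s := Rsum (fun k => INR (S k) * Bernoulli_coef (S k) * b (S (S q) - S k)%nat) (S q)) in *.
  assert (HSq := INR_S_pos (S q)).
  assert (Hs : Rabs s <= INR (S (S q)) * (K * (C * alpha (S q)))).
  { eapply Rle_trans; [apply Rsum_abs|].
    apply Rle_trans with (Rsum (fun k => INR (S (S q)) * K * (alpha (1 + k) * alpha (S (S q) - 1 - k))) (S q)).
    - apply Rsum_le. intros k Hk.
      rewrite !Rabs_mult. fold (alpha (S k)). rewrite (Rabs_pos_eq (INR _)) by apply pos_INR.
      replace (S (S q) - 1 - k)%nat with (S (q - k)) by lia.
      replace (S (S q) - S k)%nat with (S (q - k)) by lia.
      assert (H1 := IH (q - k)%nat ltac:(lia)).
      assert (H2 := alpha_pos k).
      assert (H3 : INR (S k) <= INR (S (S q))) by (apply le_INR; lia).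
      replace (1 + k)%nat with (S k) by lia.
      replace (INR (S (S q)) * K * (alpha (S k) * alpha (S (q - k))))
        with (INR (S (S q)) * alpha (S k) * (K * alpha (S (q - k)))) by ring.
      apply Rmult_le_compat; auto.
      + apply Rmult_le_pos; [apply pos_INR|lra].
      + apply Rabs_pos.
      + apply Rmult_le_compat_r; lra.
    - rewrite Rsum_scal, Rmult_assoc. apply Rmult_le_compat_l; [lra|].
      apply Rmult_le_compat_l; [unfold K; lra|].
      assert (H := HCn (S (S q)) ltac:(lia)).
      replace (S (S (S q) - 2 * 1)) with (S q) in H by lia.
      replace (S (S q) - 1)%nat with (S q) in * by lia. exact H. }
  assert (Hbound : Rabs (b (S (S q))) <= Rabs r * (K * (C * alpha (S q)) + alpha (S (S q)))).
  { apply Rmult_le_reg_l with (INR (S (S q))); auto.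
    rewrite <- (Rabs_pos_eq (INR (S (S q)))) at 1 by lra. rewrite <- Rabs_mult, Hrec, Rabs_mult.
    replace (INR (S (S q)) * (Rabs r * (K * (C * alpha (S q)) + alpha (S (S q)))))
      with (Rabs r * (INR (S (S q)) * (K * (C * alpha (S q))) + INR (S (S q)) * alpha (S (S q)))) by ring.
    apply Rmult_le_compat_l; auto.
    rewrite !Rmult_0_l, Rplus_0_l. eapply Rle_trans; [apply Rabs_triang|].
    apply Rplus_le_compat; auto.
    rewrite Rmult_1_r, Rabs_mult, (Rabs_pos_eq (INR _)) by lra. unfold alpha; lra. }
  assert (Hrat := alpha_ratio q).
  assert (Hn : INR n1 + 1 <= INR (S (S q))).
  { rewrite <- S_INR. apply le_INR; lia. }
  assert (Hq := alpha_pos q).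
  assert (Hfin : Rabs r * C * alpha (S q) <= / 2 * alpha (S (S q))).
  { assert (60 * Rabs r * C * alpha (S q) <= INR (S (S q)) * alpha (S q)) by (apply Rmult_le_compat_r; lra). lra. }
  assert (HKp : 0 <= K) by (unfold K; lra).
  assert (Rabs r * (K * (C * alpha (S q))) <= K * (/ 2 * alpha (S (S q)))).
  { replace (Rabs r * (K * (C * alpha (S q)))) with (K * (Rabs r * C * alpha (S q))) by ring.
    apply Rmult_le_compat_l; auto. }
  assert (2 * Rabs r * alpha (S (S q)) <= K * alpha (S (S q))).
  { apply Rmult_le_compat_r; unfold K; lra. }
  lra.
Qed.

(* Split n b_n = r sum_i i a_i b_(n-i) at i < m and n - i < m.  Expanding b_(n-i), i < m, by the
   induction hypothesis, the recursion for b_s, s < m, cancels all terms a_(n-s) of the wrong order. *)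
Lemma exp_coef_asymptotics r m : exists M, 0 <= M /\
  forall m' n, (1 <= m')%nat -> (m' <= m)%nat -> (2 * m' <= n)%nat ->
  Rabs (exp_coef r Bernoulli_coef n - r * Rsum (fun k => exp_coef r Bernoulli_coef k * Bernoulli_coef (n - k)) m')
    <= M * alpha (n - m').
Proof.
  set (b := exp_coef r Bernoulli_coef). set (a := Bernoulli_coef).
  destruct (exp_coef_growth r) as [K [HK HKn]]. fold b in HKn.
  (* All orders m' <= m are bounded with one constant, since the step uses every lower order at
     once. *)
  induction m as [|m [M0 [HM0 IH]]].
  { exists 0. split; [lra|]. intros; lia. }
  destruct (alpha_convolution (S m) ltac:(lia)) as [C [HC HCn]].
  set (A := Rsum (fun i => INR i * alpha i) (S m)).
  assert (HA : 0 <= A).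
  { apply Rsum_pos. intros i _. apply Rmult_le_pos; [apply pos_INR|apply Rabs_pos]. }
  assert (Hr := Rabs_pos r).
  exists (M0 + Rabs r * (A * M0) + Rabs r * (K * C)).
  assert (HA1 : 0 <= Rabs r * (A * M0)) by (repeat apply Rmult_le_pos; auto).
  assert (HA2 : 0 <= Rabs r * (K * C)) by (repeat apply Rmult_le_pos; auto).
  split; [lra|].
  intros m' n Hm' Hle Hn.
  assert (Hal : 0 <= alpha (n - m')) by apply Rabs_pos.
  destruct (Nat.eq_dec m' (S m)) as [->|Hne].
  2:{ eapply Rle_trans; [apply IH; lia|]. apply Rmult_le_compat_r; lra. }
  assert (Hrec := exp_coef_rec r a n). fold b in Hrec.
  replace (S n) with (S m + (S (n - 2 * S m) + S m))%nat in Hrec by lia.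
  rewrite Rsum_split, Rsum_split in Hrec.
  set (s1 := Rsum (fun i => INR i * a i * b (n - i)%nat) (S m)) in *.
  set (s2 := Rsum (fun k => INR (S m + k) * a (S m + k)%nat * b (n - (S m + k))%nat) (S (n - 2 * S m))) in *.
  set (s3 := Rsum _ (S m)) in Hrec at 2.
  assert (E3 : s3 = Rsum (fun j => (INR n - INR j) * a (n - j)%nat * b j) (S m)).
  { unfold s3. rewrite Rsum_rev. apply Rsum_ext. intros k Hk.
    rewrite <- minus_INR by lia.
    replace (S m + (S (n - 2 * S m) + (S m - 1 - k)))%nat with (n - k)%nat by lia.
    replace (n - (n - k))%nat with k by lia. reflexivity. }
  set (e := fun i => b (n - i)%nat - r * Rsum (fun l => b l * a (n - i - l)%nat) (S m - i)).
  assert (E1 : s1 = Rsum (fun i => INR i * a i * e i) (S m) + Rsum (fun s => INR s * b s * a (n - s)%nat) (S m)).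
  (* Summed along the diagonals i + l = s, the main terms of the expansions of b_(n-i) reproduce the
     recursion for s b_s. *)
  { assert (Es : Rsum (fun s => INR s * b s * a (n - s)%nat) (S m) =
      Rsum (fun i => Rsum (fun l => r * (INR i * a i * b l * a (n - i - l)%nat)) (S m - i)) (S m)).
    { rewrite Rsum_triangle. apply Rsum_ext. intros s Hs.
      rewrite (Rmult_comm _ (a _)). unfold b at 1. rewrite exp_coef_rec. fold a; fold b.
      rewrite <- Rsum_scal, <- Rsum_scal. apply Rsum_ext. intros i Hi.
      replace (n - i - (s - i))%nat with (n - s)%nat by lia.
      change (exp_coef r a (s - i)) with (b (s - i)%nat). ring. }
    rewrite Es, <- Rsum_plus. apply Rsum_ext. intros i Hi. unfold e.
    rewrite (Rsum_ext (fun l => r * _) (fun l => (INR i * a i * r) * (b l * a (n - i - l)%nat))).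
    2: intros; ring.
    rewrite Rsum_scal. ring. }
  assert (Hs2 : Rabs s2 <= INR n * (K * (C * alpha (n - S m)))).
  { eapply Rle_trans; [apply Rsum_abs|].
    apply Rle_trans with (Rsum (fun k => INR n * K * (alpha (S m + k) * alpha (n - S m - k))) (S (n - 2 * S m))).
    - apply Rsum_le. intros k Hk.
      rewrite !Rabs_mult. fold (alpha (S m + k)). rewrite (Rabs_pos_eq (INR _)) by apply pos_INR.
      replace (n - (S m + k))%nat with (n - S m - k)%nat by lia.
      assert (H1 := HKn (n - S m - k)%nat ltac:(lia)).
      assert (H3 : INR (S m + k) <= INR n) by (apply le_INR; lia).
      replace (INR n * K * (alpha (S m + k) * alpha (n - S m - k)))
        with (INR n * alpha (S m + k) * (K * alpha (n - S m - k))) by ring.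
      apply Rmult_le_compat; auto.
      + apply Rmult_le_pos; [apply pos_INR|apply Rabs_pos].
      + apply Rabs_pos.
      + apply Rmult_le_compat_r; auto. apply Rabs_pos.
    - rewrite Rsum_scal, Rmult_assoc. apply Rmult_le_compat_l; [apply pos_INR|].
      apply Rmult_le_compat_l; [lra|]. apply HCn; lia. }
  assert (He : Rabs (Rsum (fun i => INR i * a i * e i) (S m)) <= A * M0 * alpha (n - S m)).
  { eapply Rle_trans; [apply Rsum_abs|]. unfold A.
    replace (Rsum (fun i => INR i * alpha i) (S m) * M0 * alpha (n - S m))
      with (M0 * alpha (n - S m) * Rsum (fun i => INR i * alpha i) (S m)) by ring.
    rewrite <- Rsum_scal. apply Rsum_le. intros i Hi.
    rewrite !Rabs_mult, (Rabs_pos_eq (INR _)) by apply pos_INR. fold (alpha i).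
    (* The weight i removes i = 0, the only index at which the order being proved would be
       required. *)
    destruct i as [|i]; [simpl; lra|].
    rewrite Rmult_comm. apply Rmult_le_compat_r; [apply Rmult_le_pos; [apply pos_INR|apply Rabs_pos]|].
    assert (H := IH (S m - S i)%nat (n - S i)%nat ltac:(lia) ltac:(lia) ltac:(lia)).
    replace (n - S i - (S m - S i))%nat with (n - S m)%nat in H by lia. exact H. }
  assert (Hn1 : 1 <= INR n) by (replace 1 with (INR 1) by reflexivity; apply le_INR; lia).
  apply Rmult_le_reg_l with (INR n); [lra|].
  rewrite <- (Rabs_pos_eq (INR n)) at 1 by lra. rewrite <- Rabs_mult.
  replace (INR n * (b n - r * Rsum (fun k => b k * a (n - k)%nat) (S m)))
    with (r * (Rsum (fun i => INR i * a i * e i) (S m) + s2)).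
  (* The weights s from the lower part and n - s from the upper part add up to n, which is the
     weight of the sum being subtracted. *)
  2:{ change (INR n * b n = r * (s1 + (s2 + s3))) in Hrec.
      rewrite Rmult_minus_distr_l, Hrec, E1, E3.
      assert (Ex : Rsum (fun j => (INR n - INR j) * a (n - j)%nat * b j) (S m) =
        INR n * Rsum (fun k => b k * a (n - k)%nat) (S m) - Rsum (fun s => INR s * b s * a (n - s)%nat) (S m)).
      { rewrite <- Rsum_scal.
        replace (Rsum (fun k => INR n * (b k * a (n - k)%nat)) (S m)) with
          (Rsum (fun j => (INR n - INR j) * a (n - j)%nat * b j) (S m) + Rsum (fun s => INR s * b s * a (n - s)%nat) (S m)).
        ring. rewrite <- Rsum_plus. apply Rsum_ext; intros; ring. }
      rewrite Ex. ring. }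
  rewrite Rabs_mult.
  replace (INR n * ((M0 + Rabs r * (A * M0) + Rabs r * (K * C)) * alpha (n - S m))) with
    (INR n * (M0 * alpha (n - S m)) + Rabs r * (INR n * (A * M0 * alpha (n - S m)) + INR n * (K * (C * alpha (n - S m))))) by ring.
  rewrite <- (Rplus_0_l (Rabs r * Rabs _)). apply Rplus_le_compat.
  - repeat apply Rmult_le_pos; auto; lra.
  - apply Rmult_le_compat_l; auto. eapply Rle_trans; [apply Rabs_triang|].
    apply Rplus_le_compat; auto. eapply Rle_trans; [apply He|].
    rewrite <- (Rmult_1_l (A * M0 * _)) at 1. apply Rmult_le_compat_r; auto.
    repeat apply Rmult_le_pos; auto.
Qed.

(** * Taylor and truncation estimates for the exponential *)

Ltac spec H :=
  match type of H with ?A -> _ =>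
    let h := fresh in assert (h : A); [|specialize (H h); clear h] end.

Lemma exp_le_compat x y : x <= y -> exp x <= exp y.
Proof. intros [H| ->]; [left; apply exp_increasing; auto|lra]. Qed.

Lemma exp_Taylor (y : C) m :
  Cmod (Cexp y - Csum (fun i => y ^ i * RtoC (/ INR (fact i))) m)%C <= Cmod y ^ m / INR (fact m) * exp (Cmod y).
Proof.
  assert (H := Taylor_chain m (fun j t => (y ^ j * Cexp (RtoC t * y))%C) (Cmod y ^ m * exp (Cmod y))).
  cbv beta in H. spec H.
  2: spec H.
  - intros j t Ht. eapply dC_eq.
    + apply dC_scal. apply dC_Cexp.
      apply (dC_ext (fun t => y * RtoC t)%C); [intros; ring|].
      apply dC_scal, dC_id.
    + simpl. ring.
  - intros t Ht. rewrite Cmod_mult, Cmod_pow, Cmod_Cexp.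
    apply Rmult_le_compat_l; [apply pow_le, Cmod_ge_0|].
    apply exp_le_compat. eapply Rle_trans; [apply Rle_abs|]. eapply Rle_trans; [apply re_le_Cmod|].
    rewrite Cmod_mult, Cmod_RtoC_pos by lra. generalize (Cmod_ge_0 y); nra.
  - specialize (H 1 ltac:(lra)).
    replace (Cmod y ^ m / INR (fact m) * exp (Cmod y)) with (Cmod y ^ m * exp (Cmod y) * (1 ^ m / INR (fact m)))
      by (rewrite pow1; field; apply INR_fact_neq_0).
    eapply Rle_trans; [|exact H]. right. f_equal. f_equal.
    + replace (RtoC 1 * y)%C with y by ring. simpl; ring.
    + apply Csum_ext. intros k _. rewrite pow1.
      replace (RtoC 0 * y)%C with (RtoC 0) by ring. rewrite Cexp_0.
      unfold Rdiv. rewrite Rmult_1_l. ring.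
Qed.

Lemma Cexp_minus_1 (y : C) : Cmod (Cexp y - 1)%C <= Cmod y * exp (Cmod y).
Proof.
  assert (H := exp_Taylor y 1). simpl in H. rewrite Rinv_1 in H.
  replace (0 + 1 * 1)%C with (RtoC 1) in H by ring.
  replace (Cmod y * 1 / 1) with (Cmod y) in H by field. exact H.
Qed.

(** Let Q be the polynomial in the exponent and P the truncated series. The coefficient recursion
    makes P' - Q' P vanish below degree p, so along the segment from 0 to x the function P e^(-Q)
    has derivative O(|x|^(p+1)); it starts at 1, and multiplying by e^Q compares P with e^Q. *)
Lemma exp_truncation (r : R) (a : nat -> R) (p : nat) : exists M, forall x : C, Cmod x <= 1 ->
  Cmod (Cexp (Csum (fun k => RtoC (r * a (S k)) * x ^ S k) p)
        - Csum (fun n => RtoC (exp_coef r a n) * x ^ n) (S p))%C <= M * Cmod x ^ S p.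
Proof.
  set (b := exp_coef r a).
  set (q := fun k => r * (INR (S k) * a (S k))).
  set (Q := fun x : C => Csum (fun k => RtoC (r * a (S k)) * x ^ S k)%C p).
  set (Q1 := fun x : C => Csum (fun k => RtoC (q k) * x ^ k)%C p).
  set (P := fun x : C => Csum (fun n => RtoC (b n) * x ^ n)%C (S p)).
  set (P1 := fun x : C => Csum (fun n => RtoC (INR (S n) * b (S n)) * x ^ n)%C p).
  set (D := Rsum (fun k => Rabs (q k) * Rsum (fun l => Rabs (b l)) (S p)) p).
  set (B := Rsum (fun k => Rabs (r * a (S k))) p).
  assert (Hpow : forall (x : C) i j, Cmod x <= 1 -> (i <= j)%nat -> Cmod x ^ j <= Cmod x ^ i).
  { intros x i j Hx Hij. replace j with (i + (j - i))%nat by lia. rewrite pow_add.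
    rewrite <- (Rmult_1_r (Cmod x ^ i)) at 2. apply Rmult_le_compat_l.
    apply pow_le, Cmod_ge_0. rewrite <- (pow1 (j - i)). apply pow_incr; split; auto. apply Cmod_ge_0. }
  assert (HQ : forall x, Cmod x <= 1 -> Cmod (Q x) <= B).
  { intros x Hx. apply Csum_Cmod. intros k _. rewrite Cmod_mult, Cmod_R, Cmod_pow.
    rewrite <- (Rmult_1_r (Rabs _)) at 2. apply Rmult_le_compat_l; [apply Rabs_pos|].
    apply (Hpow x 0%nat); auto; lia. }
  assert (Hkey : forall x, Cmod x <= 1 -> Cmod (P1 x - Q1 x * P x)%C <= D * Cmod x ^ p).
  { intros x Hx.
    assert (E : P1 x = Csum (fun k => Csum (fun l => RtoC (q k) * (RtoC (b l) * x ^ (k + l)))%C (p - k)) p).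
    { assert (Htri : forall f : nat -> nat -> C, forall m, Csum (fun i => Csum (fun l => f i l) (m - i)) m = Csum (fun s => Csum (fun i => f i (s - i)%nat) (S s)) m).
      { intros f m. induction m; [reflexivity|].
        rewrite (Csum_S (fun s => Csum (fun i => f i (s - i)%nat) (S s)) m), <- IHm.
        rewrite (Csum_ext _ (fun i => Csum (fun l => f i l) (m - i) + f i (m - i)%nat)%C).
        - rewrite Csum_plus. f_equal. rewrite Csum_S, Nat.sub_diag. simpl; ring.
        - intros i Hi. replace (S m - i)%nat with (S (m - i)) by lia. reflexivity. }
      rewrite (Htri (fun k l => RtoC (q k) * (RtoC (b l) * x ^ (k + l)))%C). apply Csum_ext. intros n Hn.
      unfold b at 1. rewrite exp_coef_rec, Rsum_shift. simpl (INR 0). rewrite !Rmult_0_l, Rplus_0_l.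
      rewrite <- Rsum_scal, <- Csum_RtoC. rewrite Cmult_comm, <- Csum_scal. apply Csum_ext. intros k Hk.
      replace (k + (n - k))%nat with n by lia. replace (S n - S k)%nat with (n - k)%nat by lia.
      unfold q, b. rewrite !RtoC_mult. ring. }
    (* Only the products with k + l >= p survive; [P1] is exactly the part of [Q1 * P] below degree
       p. *)
    assert (E2 : (P1 x - Q1 x * P x)%C =
      Csum (fun k => RtoC (- q k) * Csum (fun l => RtoC (b (p - k + l)%nat) * x ^ (p + l)) (S k))%C p).
    { rewrite E. unfold Q1. rewrite (Cmult_comm _ (P x)), <- Csum_scal, <- Csum_minus. apply Csum_ext.
      intros k Hk. rewrite Csum_scal.
      unfold P. replace (S p) with (p - k + S k)%nat by lia. rewrite Csum_split.
      rewrite (Csum_ext (fun l => RtoC (b l) * x ^ (k + l))%C (fun l => x ^ k * (RtoC (b l) * x ^ l))%C).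
      2:{ intros; rewrite Cpow_add_r; ring. }
      rewrite (Csum_ext (fun l => RtoC (b (p - k + l)%nat) * x ^ (p + l))%C (fun l => x ^ k * (RtoC (b (p - k + l)%nat) * x ^ (p - k + l)))%C).
      2:{ intros l Hl. replace (p + l)%nat with (k + (p - k + l))%nat by lia. rewrite (Cpow_add_r _ k); ring. }
      rewrite !Csum_scal, RtoC_opp. ring. }
    rewrite E2. unfold D. rewrite Rmult_comm, <- Rsum_scal. apply Csum_Cmod. intros k Hk.
    rewrite Cmod_mult, Cmod_R, Rabs_Ropp.
    replace (Cmod x ^ p * (Rabs (q k) * Rsum (fun l => Rabs (b l)) (S p)))
      with (Rabs (q k) * (Cmod x ^ p * Rsum (fun l => Rabs (b l)) (S p))) by ring.
    apply Rmult_le_compat_l; [apply Rabs_pos|].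
    apply Rle_trans with (Rsum (fun l => Cmod x ^ p * Rabs (b (p - k + l)%nat)) (S k)).
    - apply Csum_Cmod. intros l Hl. rewrite Cmod_mult, Cmod_R, Cmod_pow, Rmult_comm.
      apply Rmult_le_compat_r; [apply Rabs_pos|]. apply Hpow; auto; lia.
    - rewrite Rsum_scal. apply Rmult_le_compat_l; [apply pow_le, Cmod_ge_0|].
      replace (S p) with (p - k + S k)%nat by lia. rewrite (Rsum_split (fun l => Rabs (b l))).
      rewrite <- (Rplus_0_l (Rsum _ (S k))) at 1. apply Rplus_le_compat_r.
      apply Rsum_pos. intros; apply Rabs_pos. }
  exists (exp B * (D * exp B)). intros x Hx.
  assert (Hseg : forall t, 0 <= t <= 1 -> Cmod (RtoC t * x)%C <= Cmod x).
  { intros t Ht. rewrite Cmod_mult, Cmod_RtoC_pos by lra. generalize (Cmod_ge_0 x); nra. }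
  assert (HD : 0 <= D).
  { apply Rsum_pos. intros k _. apply Rmult_le_pos; [apply Rabs_pos|]. apply Rsum_pos; intros; apply Rabs_pos. }
  assert (Hlin : forall t, dC (fun t => RtoC t * x)%C t x).
  { intros t. apply (dC_ext (fun t => x * RtoC t)%C); [intros; ring|].
    eapply dC_eq; [apply dC_scal, dC_id|ring]. }
  assert (HdP : forall t, dC (fun t => P (RtoC t * x)%C) t (x * P1 (RtoC t * x))%C).
  { intros t. unfold P. apply (dC_ext (fun t => RtoC (b 0%nat) + Csum (fun n => RtoC (b (S n)) * (RtoC t * x) ^ S n) p)%C).
    { intros s. rewrite (Csum_shift (fun n => RtoC (b n) * (RtoC s * x) ^ n)%C). simpl; ring. }
    eapply dC_eq.
    - apply dC_plus; [apply dC_const|]. apply dC_Csum. intros k _. apply dC_scal. apply dC_pow. apply Hlin.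
    - unfold P1. rewrite <- Csum_scal, Cplus_0_l. apply Csum_ext. intros k _. cbv beta.
      replace (S k - 1)%nat with k by lia. rewrite RtoC_mult. ring. }
  assert (HdQ : forall t, dC (fun t => Q (RtoC t * x)%C) t (x * Q1 (RtoC t * x))%C).
  { intros t. unfold Q. eapply dC_eq.
    - apply dC_Csum. intros k _. apply dC_scal. apply dC_pow. apply Hlin.
    - unfold Q1. rewrite <- Csum_scal. apply Csum_ext. intros k _. cbv beta.
      replace (S k - 1)%nat with k by lia. unfold q. rewrite !RtoC_mult. ring. }
  set (h := fun t => (P (RtoC t * x) * Cexp (- Q (RtoC t * x)))%C).
  assert (Hmv := mean_value_inequality h
     (fun t => (x * (P1 (RtoC t * x) - Q1 (RtoC t * x) * P (RtoC t * x)) * Cexp (- Q (RtoC t * x)))%C)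
     (fun t => D * exp B * Cmod x ^ S p * t) (fun t => D * exp B * Cmod x ^ S p) 1 ltac:(lra)).
  spec Hmv.
  2: spec Hmv.
  3: spec Hmv.
  - intros t _. unfold h. eapply dC_eq.
    + apply dC_mult; [apply HdP|]. apply dC_Cexp, dC_opp, HdQ.
    + cbv beta. ring.
  - intros t _. eapply is_derive_eq.
    + apply is_derive_Rmult; [apply (is_derive_const (V := R_NormedModule))|apply (is_derive_id (K := R_AbsRing))].
    + unfold zero, one; simpl. ring.
  - intros t Ht. rewrite !Cmod_mult.
    assert (H1 := Hkey (RtoC t * x)%C ltac:(specialize (Hseg t Ht); lra)).
    assert (H2 : Cmod (RtoC t * x)%C ^ p <= Cmod x ^ p) by (apply pow_incr; split; [apply Cmod_ge_0|auto]).
    assert (H3 : Cmod (Cexp (- Q (RtoC t * x)%C)) <= exp B).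
    { rewrite Cmod_Cexp. apply exp_le_compat. eapply Rle_trans; [apply Rle_abs|].
      eapply Rle_trans; [apply re_le_Cmod|]. rewrite Cmod_opp. apply HQ.
      specialize (Hseg t Ht); lra. }
    simpl pow. replace (D * exp B * (Cmod x * Cmod x ^ p)) with (Cmod x * (D * Cmod x ^ p) * exp B) by ring.
    apply Rmult_le_compat; auto.
    + apply Rmult_le_pos; apply Cmod_ge_0.
    + apply Cmod_ge_0.
    + apply Rmult_le_compat_l; [apply Cmod_ge_0|]. eapply Rle_trans; [apply H1|].
      apply Rmult_le_compat_l; auto.
  - assert (Eh0 : h 0 = 1%C).
    { unfold h. replace (RtoC 0 * x)%C with (RtoC 0) by ring. unfold P, Q.
      rewrite Csum_shift, !Csum_zero.
      - replace (- 0)%C with (RtoC 0) by ring. rewrite Cexp_0. simpl. unfold b, exp_coef; simpl; ring.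
      - intros k _. simpl; ring.
      - intros k _. simpl; ring. }
    assert (Eh1 : h 1 = (P x * Cexp (- Q x))%C).
    { unfold h. replace (RtoC 1 * x)%C with x by ring. reflexivity. }
    rewrite Eh0, Eh1 in Hmv. rewrite Rmult_0_r, Rmult_1_r, Rminus_0_r in Hmv.
    change (Cmod (Cexp (Q x) - P x)%C <= exp B * (D * exp B) * Cmod x ^ S p).
    replace (Cexp (Q x) - P x)%C with (Cexp (Q x) * (- (P x * Cexp (- Q x) - 1)))%C.
    2:{ rewrite Cexp_opp. field. apply Cexp_nz. }
    rewrite Cmod_mult, Cmod_opp.
    replace (exp B * (D * exp B) * Cmod x ^ S p) with (exp B * (D * exp B * Cmod x ^ S p)) by ring.
    apply Rmult_le_compat; auto; try apply Cmod_ge_0.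
    rewrite Cmod_Cexp. apply exp_le_compat. eapply Rle_trans; [apply Rle_abs|].
    eapply Rle_trans; [apply re_le_Cmod|]. auto.
Qed.

(** * The iterated derivatives of z log z *)

Lemma dC_inv f t a : dC f t a -> f t <> 0%C -> dC (fun t => / f t)%C t (- a / (f t * f t))%C.
Proof.
  intros [H1 H2] Hnz.
  assert (Hp : 0 < Re (f t) * Re (f t) + Im (f t) * Im (f t)).
  { rewrite <- Cmod_sqr. apply Cmod_gt_0 in Hnz. nra. }
  assert (Hden : is_derive (fun t => Re (f t) * Re (f t) + Im (f t) * Im (f t)) t
     (2 * (Re (f t) * Re a + Im (f t) * Im a))).
  { eapply is_derive_eq.
    - apply (is_derive_plus (V := R_NormedModule)); apply is_derive_Rmult; eassumption.
    - unfold plus; simpl; ring. }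
  assert (ER : forall w : C, Re (/ w)%C = Re w / (Re w * Re w + Im w * Im w)).
  { intros w. unfold Cinv, Re, Im; simpl. rewrite !Rmult_1_r. reflexivity. }
  assert (EI : forall w : C, Im (/ w)%C = - Im w / (Re w * Re w + Im w * Im w)).
  { intros w. unfold Cinv, Re, Im; simpl. rewrite !Rmult_1_r. reflexivity. }
  split.
  - apply is_derive_ext with (fun t => Re (f t) / (Re (f t) * Re (f t) + Im (f t) * Im (f t))).
    { intros; rewrite ER; auto. }
    eapply is_derive_eq; [apply is_derive_div; [exact H1|exact Hden|lra]|].
    unfold Cdiv. rewrite Re_mult, ER, EI, !Re_mult, !Im_mult, Re_opp, Im_opp.
    set (x := Re (f t)) in *. set (y := Im (f t)) in *.
    match goal with |- ?a = ?b => change (@eq R a b) end. field. split; nra.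
  - apply is_derive_ext with (fun t => - Im (f t) / (Re (f t) * Re (f t) + Im (f t) * Im (f t))).
    { intros; rewrite EI; auto. }
    eapply is_derive_eq; [apply is_derive_div; [apply (is_derive_opp (V := R_NormedModule)); exact H2|exact Hden|lra]|].
    unfold Cdiv. rewrite Im_mult, ER, EI, !Re_mult, !Im_mult, Re_opp, Im_opp. unfold opp; simpl.
    set (x := Re (f t)) in *. set (y := Im (f t)) in *.
    match goal with |- ?a = ?b => change (@eq R a b) end. field. split; nra.
Qed.

Definition inv_deriv (q : nat) (z : C) : C := (RtoC ((-1) ^ q * INR (fact q)) * (/ z) ^ S q)%C.

(** The chain begins with an antiderivative of z log z. Its members 1, 2 and 3 are the summands
    behind the constants of Glaisher, Stirling and Euler, so one summation formula serves all three;
    from index 3 on the terms decay. *)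
Definition zlogz_deriv (j : nat) (z : C) : C :=
  match j with
  | 0%nat => (z * z / 2 * Clog z - z * z / 4)%C
  | 1%nat => (z * Clog z)%C
  | 2%nat => (Clog z + 1)%C
  | S (S (S q)) => inv_deriv q z
  end.

Lemma dC_line (z v : C) t : dC (fun s => z + RtoC s * v)%C t v.
Proof.
  eapply dC_eq.
  - apply dC_plus; [apply dC_const|].
    apply (dC_ext (fun t => v * RtoC t)%C); [intros; ring|]. apply dC_scal, dC_id.
  - ring.
Qed.

Lemma dC_inv_deriv_line q z v t : (z + RtoC t * v)%C <> 0%C ->
  dC (fun s => inv_deriv q (z + RtoC s * v)) t (v * inv_deriv (S q) (z + RtoC t * v))%C.
Proof.
  intros Hnz. unfold inv_deriv. eapply dC_eq.
  - apply dC_scal. apply dC_pow. apply dC_inv; [apply dC_line|exact Hnz].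
  - cbv beta. set (w := (z + RtoC t * v)%C) in *.
    rewrite fact_simpl, mult_INR. replace (S q - 1)%nat with q by lia.
    simpl ((-1) ^ S q). rewrite !RtoC_mult, !Cpow_S. field. auto.
Qed.

Lemma dC_zlogz_deriv j z t : slit_plane (z + RtoC t)%C ->
  dC (fun s => zlogz_deriv j (z + RtoC s)%C) t (zlogz_deriv (S j) (z + RtoC t)%C).
Proof.
  intros Hs.
  assert (Hl : dC (fun s => Clog (z + RtoC s)%C) t (/ (z + RtoC t))%C).
  { assert (H := dC_Clog_line z 1%C t).
    replace (z + RtoC t * 1)%C with (z + RtoC t)%C in H by ring.
    specialize (H Hs). eapply dC_eq; [eapply dC_ext; [|exact H]|].
    - intros s. simpl. replace (RtoC s * 1)%C with (RtoC s) by ring. reflexivity.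
    - unfold Cdiv; ring. }
  assert (Hz : dC (fun s => z + RtoC s)%C t 1%C).
  { eapply dC_ext; [|exact (dC_line z 1%C t)]. intros; simpl; ring. }
  assert (Hnz := slit_plane_nz _ Hs).
  destruct j as [|[|[|q]]]; simpl zlogz_deriv.
  - eapply dC_eq.
    + apply dC_minus; [apply dC_mult; [|exact Hl]|].
      * unfold Cdiv. apply dC_mult; [apply dC_mult; exact Hz|apply dC_const].
      * unfold Cdiv. apply dC_mult; [apply dC_mult; exact Hz|apply dC_const].
    + cbv beta. field. auto.
  - eapply dC_eq; [apply dC_mult; [exact Hz|exact Hl]|]. cbv beta. field; auto.
  - eapply dC_eq; [apply dC_plus; [exact Hl|apply dC_const]|]. unfold inv_deriv; simpl. rewrite Rmult_1_l. field; auto.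
  - assert (H := dC_inv_deriv_line q z 1%C t).
    replace (z + RtoC t * 1)%C with (z + RtoC t)%C in H by ring.
    specialize (H Hnz). eapply dC_eq; [eapply dC_ext; [|exact H]|].
    + intros s. simpl. replace (RtoC s * 1)%C with (RtoC s) by ring. reflexivity.
    + ring.
Qed.

Lemma Cmod_inv_deriv q (z : C) : z <> 0%C -> Cmod (inv_deriv q z) = INR (fact q) / Cmod z ^ S q.
Proof.
  intros Hz. unfold inv_deriv. rewrite Cmod_mult, Cmod_R, Cmod_pow. rewrite (Cmod_inv z Hz).
  rewrite Rabs_mult, pow_1_abs, Rmult_1_l, Rabs_pos_eq by apply pos_INR.
  rewrite pow_inv. reflexivity.
Qed.

(** * Euler-Maclaurin summation along the chain *)

(** An approximate antidifference of [zlogz_deriv (S d)]. [EM_err] is its defect over one unit step,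
    and the sum of these defects over z + k plays the part of the usual remainder integral. *)
Definition Phi (d p : nat) (z : C) : C := Csum (fun j => RtoC (beta j) * zlogz_deriv (d + j) z)%C (S p).

Definition EM_err (d p : nat) (z : C) : C := (zlogz_deriv (S d) z - (Phi d p (z + 1) - Phi d p z))%C.

Lemma EM_sum d p z n :
  Csum (fun k => zlogz_deriv (S d) (z + RtoC (INR k))%C) n =
  (Phi d p (z + RtoC (INR n)) - Phi d p z + Csum (fun k => EM_err d p (z + RtoC (INR k))) n)%C.
Proof.
  induction n.
  - simpl. replace (z + 0)%C with z by ring. ring.
  - rewrite !Csum_S, IHn. unfold EM_err. rewrite S_INR, RtoC_plus.
    replace (z + (RtoC (INR n) + 1))%C with (z + RtoC (INR n) + 1)%C by ring. ring.
Qed.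

(** The relation d + p = q + 2 places the derivative in the remainder at index q + 3 of the chain,
    which is [inv_deriv q]. *)
Lemma EM_err_bound d p q z (m : R) : (1 <= p)%nat -> (d + p = q + 2)%nat -> slit_plane z -> 0 < m ->
  (forall t, 0 <= t <= 1 -> m <= Cmod (z + RtoC t)%C) ->
  Cmod (EM_err d p z) <= EM_const p * (INR (fact q) / m ^ S q).
Proof.
  intros Hp Hq Hz Hm Hle.
  assert (H := Euler_Maclaurin p (fun j t => zlogz_deriv (d + j) (z + RtoC t)%C) (INR (fact q) / m ^ S q) Hp).
  cbv beta in H.
  assert (Hs : forall t, 0 <= t <= 1 -> slit_plane (z + RtoC t)%C).
  { intros t Ht. apply slit_plane_plus_R; auto; lra. }
  specialize (H ltac:(intros j t Ht; rewrite Nat.add_succ_r; apply dC_zlogz_deriv; auto)).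
  spec H.
  - intros t Ht. replace (d + S p)%nat with (S (S (S q))) by lia. change (zlogz_deriv (S (S (S q)))) with (inv_deriv q).
    rewrite Cmod_inv_deriv by (apply slit_plane_nz; auto).
    apply Rmult_le_compat_l; [apply pos_INR|].
    apply Rinv_le_contravar; [apply pow_lt; auto|]. apply pow_incr. split; [lra|auto].
  - replace (EM_err d p z) with (- (Csum (fun j => RtoC (beta j) * (zlogz_deriv (d + j) (z + RtoC 1) - zlogz_deriv (d + j) (z + RtoC 0))) (S p) - zlogz_deriv (d + 1) (z + RtoC 0)))%C.
    + rewrite Cmod_opp. exact H.
    + unfold EM_err, Phi. replace (z + RtoC 0)%C with z by ring.
      rewrite (Csum_ext _ (fun j => RtoC (beta j) * zlogz_deriv (d + j) (z + 1) - RtoC (beta j) * zlogz_deriv (d + j) z)%C)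
        by (intros; ring).
      rewrite Csum_minus. replace (d + 1)%nat with (S d) by lia. ring.
Qed.

(** A majorant of the form c n - c (n+1) yields convergence together with the explicit tail c n. *)
Lemma Csum_cvg_telescope (u : nat -> C) (c : nat -> R) :
  (forall n, Cmod (u n) <= c n - c (S n)) -> is_lim_seq c 0 ->
  exists l, Clim (Csum u) l /\ forall n, Cmod (l - Csum u n)%C <= c n.
Proof.
  intros H Hc.
  assert (Hdec : forall n m, c (n + m)%nat <= c n).
  { intros n m. induction m; [rewrite Nat.add_0_r; lra|]. rewrite Nat.add_succ_r.
    specialize (H (n + m)%nat). generalize (Cmod_ge_0 (u (n + m)%nat)). lra. }
  assert (Hpos : forall n, 0 <= c n).
  { intros n. apply (is_lim_seq_le_loc c (fun _ => c n) 0 (c n)); auto.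
    - exists n. intros m Hm. replace m with (n + (m - n))%nat by lia. auto.
    - apply is_lim_seq_const. }
  destruct (Clim_cvg_of_summable u (fun n => c n - c (S n)) H) as [l Hl].
  { exists (c 0%nat).
    change (is_lim_seq (sum_n (fun n => c n - c (S n))) (c 0%nat)).
    apply is_lim_seq_ext with (fun n => c 0%nat - c (S n)).
    - intros n. rewrite sum_n_Rsum. induction n; [simpl; ring|]. rewrite Rsum_S, <- IHn. ring.
    - replace (c 0%nat) with (c 0%nat - 0) by ring. apply is_lim_seq_minus'.
      + replace (c 0%nat - 0) with (c 0%nat) by ring. apply is_lim_seq_const.
      + apply -> is_lim_seq_incr_1. exact Hc. }
  exists l. split; auto. intros n.
  apply (Clim_Cmod_le (fun m => Csum u m - Csum u n)%C _ (c n) n).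
  - apply Clim_minus; auto. apply Clim_const.
  - intros m Hm. replace m with (n + (m - n))%nat by lia. rewrite Csum_split.
    replace (Csum u n + Csum (fun k => u (n + k)%nat) (m - n) - Csum u n)%C
      with (Csum (fun k => u (n + k)%nat) (m - n)) by ring.
    apply Rle_trans with (c n - c (n + (m - n))%nat).
    + generalize (m - n)%nat. intros i. induction i.
      * rewrite Nat.add_0_r. simpl. rewrite Cmod_0; lra.
      * rewrite Csum_S. eapply Rle_trans; [apply Cmod_triangle|].
        rewrite Nat.add_succ_r. specialize (H (n + i)%nat). lra.
    + generalize (Hpos (n + (m - n))%nat). lra.
Qed.

(** The factor 2 pays for x + 1 <= 2 x. *)
Lemma inv_sqr_telescope x : 1 <= x -> / (x * x) <= 2 / x - 2 / (x + 1).
Proof.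
  intros Hx. replace (2 / x - 2 / (x + 1)) with (/ (x * x) * (2 * x / (x + 1))).
  - rewrite <- (Rmult_1_r (/ (x * x))) at 1. apply Rmult_le_compat_l.
    + left; apply Rinv_0_lt_compat; nra.
    + apply Rmult_le_reg_r with (x + 1); [lra|]. unfold Rdiv. rewrite Rmult_assoc, Rinv_l; lra.
  - field. lra.
Qed.

Lemma is_lim_seq_inv_INR a : is_lim_seq (fun n => / (a + INR n)) 0.
Proof.
  replace (Finite 0) with (Rbar_inv p_infty) by reflexivity.
  apply is_lim_seq_inv; [|discriminate].
  replace p_infty with (Rbar_plus a p_infty) by reflexivity.
  apply is_lim_seq_plus with a p_infty; [apply is_lim_seq_const|apply is_lim_seq_INR|reflexivity].
Qed.

(** By the lower bound on |z + x|, the k-th defect is at most a constant times (|z|+k)^(-q-1). Of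
    these powers, q - 1 are estimated by |z| and the remaining square telescopes. The constant
    depends on z only through c, which is what makes the expansion uniform in a sector. *)
Lemma EM_remainder d p q (z : C) (c : R) :
  (1 <= p)%nat -> (d + p = q + 2)%nat -> (1 <= q)%nat -> slit_plane z -> 1 <= Cmod z -> 0 < c ->
  (forall x, 0 <= x -> c * (Cmod z + x) <= Cmod (z + RtoC x)%C) ->
  exists l, Clim (Csum (fun k => EM_err d p (z + RtoC (INR k))%C)) l /\
    Cmod l <= 2 * (EM_const p * INR (fact q) / c ^ S q) / Cmod z ^ q.
Proof.
  intros Hp Hq Hq1 Hz Hz1 Hc Hgeo.
  set (A := EM_const p * INR (fact q) / c ^ S q).
  assert (HA : 0 <= A).
  { unfold A. apply Rmult_le_pos; [apply Rmult_le_pos; [apply EM_const_pos|apply pos_INR]|].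
    left; apply Rinv_0_lt_compat, pow_lt; auto. }
  set (cn := fun n => A / Cmod z ^ (q - 1) * (2 * / (Cmod z + INR n))).
  destruct (Csum_cvg_telescope (fun k => EM_err d p (z + RtoC (INR k))%C) cn) as [l [Hl Hb]].
  - intros n. set (x := Cmod z + INR n).
    assert (Hx : 1 <= x) by (unfold x; generalize (pos_INR n); lra).
    assert (Hxz : Cmod z <= x) by (unfold x; generalize (pos_INR n); lra).
    eapply Rle_trans.
    + apply (EM_err_bound d p q _ (c * x)); auto.
      * apply slit_plane_plus_R; auto. apply pos_INR.
      * apply Rmult_lt_0_compat; lra.
      * intros t Ht. replace (z + RtoC (INR n) + RtoC t)%C with (z + RtoC (INR n + t))%C by (rewrite RtoC_plus; ring).
        eapply Rle_trans; [|apply Hgeo; generalize (pos_INR n); lra].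
        apply Rmult_le_compat_l; unfold x; lra.
    + unfold cn. fold x. replace (Cmod z + INR (S n)) with (x + 1) by (unfold x; rewrite S_INR; ring).
      replace (A / Cmod z ^ (q - 1) * (2 * / x) - A / Cmod z ^ (q - 1) * (2 * / (x + 1)))
        with (A * (/ Cmod z ^ (q - 1) * (2 / x - 2 / (x + 1)))) by (unfold Rdiv; ring).
      replace (EM_const p * (INR (fact q) / (c * x) ^ S q)) with (A * / x ^ S q).
      2:{ unfold A. rewrite Rpow_mult_distr. field. split; apply pow_nonzero; lra. }
      apply Rmult_le_compat_l; auto.
      replace (S q) with ((q - 1) + 2)%nat by lia. rewrite pow_add, Rinv_mult.
      apply Rmult_le_compat.
      * left; apply Rinv_0_lt_compat, pow_lt; lra.
      * left; apply Rinv_0_lt_compat, pow_lt; lra.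
      * apply Rinv_le_contravar; [apply pow_lt; lra|]. apply pow_incr; lra.
      * replace (x ^ 2) with (x * x) by ring. apply inv_sqr_telescope; auto.
  - unfold cn. replace (Finite 0) with (Finite (A / Cmod z ^ (q - 1) * (2 * 0))) by (f_equal; ring).
    apply is_lim_seq_mult'; [apply is_lim_seq_const|]. apply is_lim_seq_mult'; [apply is_lim_seq_const|].
    apply is_lim_seq_inv_INR.
  - exists l. split; auto. specialize (Hb 0%nat). simpl in Hb.
    replace (l - 0)%C with l in Hb by ring. eapply Rle_trans; [exact Hb|].
    unfold cn. simpl (INR 0). rewrite Rplus_0_r. right.
    replace (Cmod z ^ q) with (Cmod z ^ (q - 1) * Cmod z).
    + field. split; [lra|apply pow_nonzero; lra].
    + replace q with (S (q - 1)) at 2 by lia. simpl; ring.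
Qed.

(** For k = cos delta the constant is sin(delta/2). With a = |z|, the difference of the squares is
    at least (1+k)/2 (a-x)^2. *)
Lemma sector_lower_bound (z : C) (k x : R) :
  -1 <= k < 1 -> - k * Cmod z <= Re z -> 0 <= x ->
  sqrt ((1 - k) / 2) * (Cmod z + x) <= Cmod (z + RtoC x)%C.
Proof.
  intros Hk Hz Hx. assert (H1 := Cmod_ge_0 (z + RtoC x)%C).
  assert (E := Cmod_sqr z). assert (E2 := Cmod_sqr (z + RtoC x)%C).
  rewrite Re_plus, Im_plus, re_RtoC, im_RtoC in E2.
  assert (Hs : sqrt ((1 - k) / 2) * sqrt ((1 - k) / 2) = (1 - k) / 2) by (apply sqrt_sqrt; lra).
  set (s := sqrt ((1 - k) / 2)) in *. set (a := Cmod z) in *. set (b := Cmod (z + RtoC x)%C) in *.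
  apply Rsqr_incr_0_var; auto. unfold Rsqr.
  replace (s * (a + x) * (s * (a + x))) with ((s * s) * ((a + x) * (a + x))) by ring. rewrite Hs.
  assert (E3 : b * b = a * a + 2 * x * Re z + x * x) by nra.
  assert (x * (- k * a) <= x * Re z) by (apply Rmult_le_compat_l; auto).
  assert (0 <= (1 + k) * ((a - x) * (a - x))) by (apply Rmult_le_pos; [lra|apply Rle_0_sqr]). nra.
Qed.

Lemma slit_plane_1 : slit_plane 1%C.
Proof. apply slit_plane_RtoC; lra. Qed.

Lemma EM_constant d p : (1 <= p)%nat -> (d + p = 3)%nat -> exists k,
  Clim (fun n => Csum (fun k => zlogz_deriv (S d) (1 + RtoC (INR k))%C) n - Phi d p (1 + RtoC (INR n)))%C k.
Proof.
  intros Hp Hd.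
  destruct (EM_remainder d p 1 1%C 1 Hp ltac:(lia) ltac:(lia) slit_plane_1) as [l [Hl _]].
  - rewrite Cmod_1; lra.
  - lra.
  - intros x Hx. rewrite <- RtoC_plus, Cmod_1, Cmod_RtoC_pos; lra.
  - exists (- Phi d p 1 + l)%C.
    apply Clim_ext with (fun n => - Phi d p 1 + Csum (fun k => EM_err d p (1 + RtoC (INR k))) n)%C.
    + intros n. rewrite EM_sum with (p := p). ring.
    + apply Clim_plus; auto. apply Clim_const.
Qed.

(** * Wallis and Stirling *)

Definition Wallis (n : nat) : R := RInt (fun x => sin x ^ n) 0 (PI / 2).

Lemma ex_Wallis n : ex_RInt (fun x => sin x ^ n) 0 (PI / 2).
Proof.
  apply (ex_RInt_continuous (V := R_CompleteNormedModule)). intros x _.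
  apply (ex_derive_continuous (V := R_NormedModule)). auto_derive; auto.
Qed.

Lemma Wallis_rec n : (INR n + 2) * Wallis (S (S n)) = (INR n + 1) * Wallis n.
Proof.
  assert (H : is_RInt (fun x => (INR n + 1) * sin x ^ n - (INR n + 2) * sin x ^ S (S n)) 0 (PI / 2)
     (minus (cos (PI / 2) * sin (PI / 2) ^ S n) (cos 0 * sin 0 ^ S n))).
  { apply (is_RInt_derive (V := R_CompleteNormedModule) (fun x => cos x * sin x ^ S n)).
    - intros x _. auto_derive; auto.
      replace (match n with O => 1 | S _ => INR n + 1 end) with (INR n + 1) by (destruct n; simpl; ring).
      assert (E := sin2_cos2 x). unfold Rsqr in E.
      replace (cos x * (1 * cos x * ((INR n + 1) * sin x ^ n))) with ((cos x * cos x) * ((INR n + 1) * sin x ^ n)) by ring.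
      replace (cos x * cos x) with (1 - sin x * sin x) by lra. simpl; ring.
    - intros x _. apply (ex_derive_continuous (V := R_NormedModule)). auto_derive; auto. }
  assert (H2 : is_RInt (fun x => (INR n + 1) * sin x ^ n - (INR n + 2) * sin x ^ S (S n)) 0 (PI / 2)
     (minus (scal (INR n + 1) (Wallis n)) (scal (INR n + 2) (Wallis (S (S n)))))).
  { apply (is_RInt_minus (V := R_NormedModule)); apply (is_RInt_scal (V := R_NormedModule));
    apply (RInt_correct (V := R_CompleteNormedModule)), ex_Wallis. }
  assert (E := is_RInt_unique (V := R_CompleteNormedModule) _ _ _ _ H).
  rewrite (is_RInt_unique (V := R_CompleteNormedModule) _ _ _ _ H2) in E.
  unfold minus, plus, opp, scal in E; simpl in E. unfold mult in E; simpl in E.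
  rewrite cos_PI2, sin_0 in E. lra.
Qed.

Lemma Wallis_0 : Wallis 0 = PI / 2.
Proof.
  unfold Wallis. simpl. rewrite (RInt_const (V := R_CompleteNormedModule)).
  unfold scal; simpl; unfold mult; simpl. ring.
Qed.

Lemma Wallis_1 : Wallis 1 = 1.
Proof.
  unfold Wallis.
  assert (H : is_RInt (fun x => sin x ^ 1) 0 (PI / 2) (minus (- cos (PI / 2)) (- cos 0))).
  { apply (is_RInt_derive (V := R_CompleteNormedModule) (fun x => - cos x)).
    - intros x _. auto_derive; auto. ring.
    - intros x _. apply (ex_derive_continuous (V := R_NormedModule)). auto_derive; auto. }
  rewrite (is_RInt_unique (V := R_CompleteNormedModule) _ _ _ _ H).
  unfold minus, plus, opp; simpl. rewrite cos_PI2, cos_0. ring.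
Qed.

Lemma Wallis_decr n : Wallis (S n) <= Wallis n.
Proof.
  assert (HPI := PI_RGT_0).
  apply RInt_le; try apply ex_Wallis; [lra|].
  intros x Hx. assert (0 <= sin x) by (apply sin_ge_0; lra). assert (H1 := SIN_bound x).
  simpl. rewrite <- (Rmult_1_l (sin x ^ n)) at 2. apply Rmult_le_compat_r; [apply pow_le; auto|lra].
Qed.

Lemma Wallis_prod n : (INR n + 1) * (Wallis (S n) * Wallis n) = PI / 2.
Proof.
  induction n.
  - rewrite Wallis_0, Wallis_1. simpl. ring.
  - rewrite <- IHn, S_INR. assert (H := Wallis_rec n).
    replace (INR n + 1 + 1) with (INR n + 2) by ring.
    rewrite <- (Rmult_assoc (INR n + 2)), H. ring.
Qed.

Lemma Wallis_even n : Wallis (2 * n) = INR (fact (2 * n)) / (4 ^ n * (INR (fact n) * INR (fact n))) * (PI / 2).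
Proof.
  induction n.
  - simpl Nat.mul. rewrite Wallis_0. simpl. field.
  - replace (2 * S n)%nat with (S (S (2 * n))) by lia.
    assert (H := Wallis_rec (2 * n)). rewrite IHn in H.
    assert (Hn := pos_INR n). assert (Hf := INR_fact_neq_0).
    assert (E2 : INR (2 * n) = 2 * INR n) by (rewrite mult_INR; reflexivity).
    rewrite E2 in H.
    apply Rmult_eq_reg_l with (2 * INR n + 2); [|lra]. rewrite H.
    rewrite (fact_simpl (S (2 * n))), (fact_simpl (2 * n)), (fact_simpl n), !mult_INR, !S_INR, E2.
    rewrite <- (tech_pow_Rmult 4 n). field.
    repeat split; auto; try lra. apply pow_nonzero; lra.
Qed.

Lemma Wallis_even_pos n : 0 < Wallis (2 * n).
Proof.
  rewrite Wallis_even. assert (HPI := PI_RGT_0). assert (Hf := INR_fact_lt_0).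
  apply Rmult_lt_0_compat; [|lra]. apply Rdiv_lt_0_compat; auto.
  apply Rmult_lt_0_compat; [apply pow_lt; lra|]. apply Rmult_lt_0_compat; auto.
Qed.

Lemma is_lim_seq_subseq_ge (u : nat -> R) (l : Rbar) (phi : nat -> nat) :
  (forall n, (n <= phi n)%nat) -> is_lim_seq u l -> is_lim_seq (fun n => u (phi n)) l.
Proof.
  intros Hphi Hu. apply is_lim_seq_subseq with (2 := Hu). intros P [N HN]. exists N.
  intros n Hn. apply HN. specialize (Hphi n); lia.
Qed.

(** By [Wallis_prod] the products of an integral with either neighbour are known exactly;
    monotonicity squeezes its square between them. *)
Lemma Wallis_limit : is_lim_seq (fun n => 2 * ln (Wallis (2 * S n)) + ln (INR (2 * S n))) (ln (PI / 2)).
Proof.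
  assert (HPI := PI_RGT_0).
  apply is_lim_seq_ext with (fun n => ln (INR (2 * S n) * (Wallis (2 * S n) * Wallis (2 * S n)))).
  { intros n. assert (H := Wallis_even_pos (S n)).
    rewrite ln_mult, ln_mult; try ring; auto.
    - apply lt_0_INR; lia.
    - apply Rmult_lt_0_compat; auto. }
  assert (H : is_lim_seq (fun n => INR (2 * S n) * (Wallis (2 * S n) * Wallis (2 * S n))) (PI / 2)).
  { apply is_lim_seq_le_le with (fun n => PI / 2 - PI / 2 * / (1 + INR n)) (fun _ => PI / 2).
    - intros n. assert (H := Wallis_even_pos (S n)).
      assert (H1 := Wallis_prod (2 * S n)). assert (H2 := Wallis_decr (2 * S n)).
      assert (H3 := Wallis_prod (2 * n + 1)). assert (H4 := Wallis_decr (2 * n + 1)).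
      replace (S (2 * n + 1)) with (2 * S n)%nat in H3, H4 by lia.
      replace (INR (2 * n + 1) + 1) with (INR (2 * S n)) in H3.
      2:{ rewrite <- S_INR. f_equal. lia. }
      set (w := Wallis (2 * S n)) in *.
      assert (E : INR (2 * S n) = 2 * INR n + 2) by (rewrite mult_INR, (S_INR n); simpl; ring).
      rewrite E in *. assert (Hn := pos_INR n). split.
      + assert (H5 : PI / 2 <= (2 * INR n + 3) * (w * w)).
        { rewrite <- H1. replace (2 * INR n + 2 + 1) with (2 * INR n + 3) by ring.
          apply Rmult_le_compat_l; [lra|]. apply Rmult_le_compat_r; lra. }
        assert (H6 : (2 * INR n + 2) * (w * w) <= PI / 2).
        { rewrite <- H3. apply Rmult_le_compat_l; [lra|]. apply Rmult_le_compat_l; lra. }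
        assert (H7 : w * w <= PI / 2 * / (1 + INR n)).
        { apply Rmult_le_reg_l with (1 + INR n); [lra|].
          replace ((1 + INR n) * (PI / 2 * / (1 + INR n))) with (PI / 2) by (field; lra).
          assert (0 <= w * w) by nra. nra. }
        lra.
      + rewrite <- H3. apply Rmult_le_compat_l; [lra|]. apply Rmult_le_compat_l; lra.
    - replace (Finite (PI / 2)) with (Finite (PI / 2 - PI / 2 * 0)) by (f_equal; ring).
      apply is_lim_seq_minus'; [apply is_lim_seq_const|].
      apply is_lim_seq_mult'; [apply is_lim_seq_const|apply is_lim_seq_inv_INR].
    - apply is_lim_seq_const. }
  apply (is_lim_seq_continuous ln _ _); auto.
  apply continuity_pt_filterlim, (ex_derive_continuous (V := R_NormedModule)).
  eexists; apply is_derive_ln; lra.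
Qed.

Lemma ln_fact_sum n : Rsum (fun k => ln (1 + INR k)) n = ln (INR (fact n)).
Proof.
  induction n; [simpl; rewrite ln_1; reflexivity|].
  rewrite Rsum_S, IHn, fact_simpl, mult_INR, ln_mult.
  - rewrite S_INR, (Rplus_comm (INR n)). ring.
  - apply INR_S_pos.
  - apply INR_fact_lt_0.
Qed.

Lemma RtoC_1_plus n : (1 + RtoC (INR n))%C = RtoC (INR (S n)).
Proof. rewrite S_INR, RtoC_plus. ring. Qed.

Lemma Clog_INR_S n : Clog (RtoC (INR (S n))) = RtoC (ln (INR (S n))).
Proof. apply Clog_pos, INR_S_pos. Qed.

Lemma Clim_inv_INR_S : Clim (fun n => / RtoC (INR (S n)))%C 0%C.
Proof.
  apply Clim_ext with (fun n => RtoC (/ (1 + INR n))).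
  - intros n. rewrite RtoC_inv by (generalize (pos_INR n); lra). rewrite S_INR, Rplus_comm. reflexivity.
  - apply Clim_RtoC, is_lim_seq_inv_INR.
Qed.

Lemma Clim_Re u (l : C) : Clim (fun n => RtoC (u n)) l -> is_lim_seq u (Re l).
Proof. intros [H _]. exact H. Qed.

Lemma inv_deriv_0 w : inv_deriv 0 w = (/ w)%C.
Proof. unfold inv_deriv. simpl. rewrite Rmult_1_l. ring. Qed.

Lemma RtoC_half : RtoC (/ 2) = (/ 2)%C.
Proof. rewrite RtoC_inv by lra. reflexivity. Qed.

Lemma Phi_2_1 w : Phi 2 1 w = (Clog w + 1 - RtoC (/ 2) * / w)%C.
Proof.
  unfold Phi. simpl. rewrite inv_deriv_0, beta_0, beta_1.
  replace (- (1 / 2)) with (- / 2) by field. rewrite RtoC_opp. ring.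
Qed.

Lemma Phi_1_2 w : Phi 1 2 w = (w * Clog w - RtoC (/ 2) * (Clog w + 1) + RtoC (1 / 12) * / w)%C.
Proof.
  unfold Phi. cbn [Csum zlogz_deriv Nat.add]. rewrite inv_deriv_0, beta_0, beta_1, beta_2.
  replace (- (1 / 2)) with (- / 2) by field. rewrite RtoC_opp. ring.
Qed.

Lemma Phi_0_3 w : Phi 0 3 w = (zlogz_deriv 0 w - RtoC (/ 2) * zlogz_deriv 1 w + RtoC (1 / 12) * zlogz_deriv 2 w)%C.
Proof.
  unfold Phi. change (0 + 0)%nat with 0%nat. cbn [Csum zlogz_deriv Nat.add].
  assert (E : beta 3 = 0) by apply (beta_odd 1 (Nat.le_refl 1)). rewrite E, beta_0, beta_1, beta_2.
  replace (- (1 / 2)) with (- / 2) by field. rewrite RtoC_opp. ring.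
Qed.

(** Euler-Maclaurin gives the existence of a limit s. Its value follows from Wallis: the logarithm
    of the square of the integral of index 2n + 2 is, up to elementary terms, 2 d(2n+1) - 4 d(n),
    with limit -2s. The formula is written at n + 1, where the boundary terms for a sum over 1, ...,
    n are taken. *)
Lemma Stirling : is_lim_seq (fun n => ln (INR (fact n)) - ((INR n + / 2) * ln (INR (S n)) - INR (S n)))
  (/ 2 * ln (2 * PI)).
Proof.
  set (d := fun n => ln (INR (fact n)) - ((INR n + / 2) * ln (INR (S n)) - INR (S n))).
  assert (Hd : exists s : R, is_lim_seq d s).
  { destruct (EM_constant 1 2 ltac:(lia) ltac:(lia)) as [k Hk].
    exists (Re (k + RtoC (1 / 2) + RtoC (beta 2) * 0)%C).
    apply Clim_Re.
    apply Clim_ext with (fun n => Csum (fun k => zlogz_deriv 2 (1 + RtoC (INR k))%C) n - Phi 1 2 (1 + RtoC (INR n))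
      + RtoC (1 / 2) + RtoC (beta 2) * / RtoC (INR (S n)))%C.
    - intros n. rewrite (Csum_ext _ (fun k => RtoC (ln (1 + INR k) + 1)%R)).
      2:{ intros j _. simpl zlogz_deriv. rewrite RtoC_1_plus, Clog_INR_S, S_INR, <- RtoC_plus. do 3 f_equal. ring. }
      rewrite Csum_RtoC, Rsum_plus, ln_fact_sum.
      assert (Ec : Rsum (fun _ => 1) n = INR n).
      { induction n; [reflexivity|]. rewrite Rsum_S, IHn, S_INR; reflexivity. }
      rewrite Ec, RtoC_1_plus, Phi_1_2, Clog_INR_S, beta_2.
      unfold d. replace (1 / 2) with (/ 2) by field.
      rewrite !RtoC_minus, RtoC_mult, !RtoC_plus, S_INR, !RtoC_plus, RtoC_half. field.
      change (RtoC (INR n) + RtoC 1 <> 0)%C.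
      rewrite <- RtoC_plus. intros H; apply RtoC_inj in H. generalize (pos_INR n); lra.
    - apply Clim_plus; [apply Clim_plus; [exact Hk|apply Clim_const]|].
      apply Clim_mult; [apply Clim_const|apply Clim_inv_INR_S]. }
  destruct Hd as [s Hs].
  assert (HPI := PI_RGT_0).
  assert (H : is_lim_seq (fun n => 2 * ln (Wallis (2 * S n)) + ln (INR (2 * S n)))
    (2 * s - 4 * s + (2 * ln 2 + 2 * ln (PI / 2)))).
  { apply is_lim_seq_ext with (fun n => 2 * d (2 * n + 1)%nat - 4 * d n + (2 * ln 2 + 2 * ln (PI / 2))).
    - intros n. rewrite Wallis_even. assert (Hf := INR_fact_lt_0).
      assert (Hn := INR_S_pos n).
      unfold d. replace (S (2 * n + 1)) with (2 * S n)%nat by lia.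
      replace (fact (2 * S n)) with ((2 * S n) * fact (2 * n + 1))%nat.
      2:{ replace (2 * S n)%nat with (S (2 * n + 1)) by lia. reflexivity. }
      rewrite (fact_simpl n), !mult_INR.
      assert (Hf1 := Hf n). assert (Hf2 := Hf (2 * n + 1)%nat).
      set (f := INR (fact n)) in *. set (f2 := INR (fact (2 * n + 1))) in *.
      set (m := INR (S n)) in *.
      assert (H4 : 0 < 4 ^ S n) by (apply pow_lt; lra).
      assert (H2 : 0 < INR 2) by (simpl; lra).
      assert (H2m : 0 < INR 2 * m) by (apply Rmult_lt_0_compat; auto).
      assert (Hmf : 0 < m * f) by (apply Rmult_lt_0_compat; auto).
      assert (Hmf2 : 0 < m * f * (m * f)) by (apply Rmult_lt_0_compat; auto).
      assert (Hnum : 0 < INR 2 * m * f2) by (apply Rmult_lt_0_compat; auto).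
      assert (Hden : 0 < 4 ^ S n * (m * f * (m * f))) by (apply Rmult_lt_0_compat; auto).
      rewrite (ln_mult (INR 2 * m * f2 / (4 ^ S n * (m * f * (m * f)))) (PI / 2)) by
        (try apply Rdiv_lt_0_compat; auto; lra).
      rewrite (ln_div (INR 2 * m * f2)) by auto.
      rewrite (ln_mult (4 ^ S n)), (ln_mult (m * f)), (ln_mult m f), (ln_mult (INR 2 * m) f2), (ln_mult (INR 2) m) by auto.
      rewrite ln_pow by lra.
      replace (ln 4) with (2 * ln 2).
      2:{ replace 4 with (2 * 2) by ring. rewrite ln_mult by lra. ring. }
      replace (INR (2 * n + 1)) with (2 * INR (S n) - 1).
      2:{ rewrite plus_INR, mult_INR, S_INR. simpl. ring. }
      replace (INR n) with (INR (S n) - 1) by (rewrite S_INR; ring).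
      replace (INR 2) with 2 by (simpl; ring). field.
    - apply is_lim_seq_plus'; [|apply is_lim_seq_const].
      apply is_lim_seq_minus'; apply is_lim_seq_mult'; auto; try apply is_lim_seq_const.
      apply (is_lim_seq_subseq_ge d s (fun n => 2 * n + 1)%nat); auto. intros; lia. }
  assert (E := is_lim_seq_unique _ _ H). rewrite (is_lim_seq_unique _ _ Wallis_limit) in E.
  injection E as E. replace (/ 2 * ln (2 * PI)) with s; auto.
  replace (2 * PI) with (2 * 2 * (PI / 2)) by field. rewrite !ln_mult by lra. lra.
Qed.

(** Convergence comes from [EM_constant]; [Euler_gamma] is then the value of a true limit. *)
Lemma Euler_gamma_limit : is_lim_seq (fun n => Rsum (fun k => / INR (S k)) n - ln (INR (S n))) Euler_gamma.
Proof.
  assert (Hex : exists s : R, is_lim_seq (fun n => Rsum (fun k => / INR (S k)) n - ln (INR (S n))) s).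
  { destruct (EM_constant 2 1 ltac:(lia) ltac:(lia)) as [k Hk].
    exists (Re (k + 1 + RtoC (beta 1) * 0)%C).
    apply Clim_Re.
    apply Clim_ext with (fun n => Csum (fun k => zlogz_deriv 3 (1 + RtoC (INR k))%C) n - Phi 2 1 (1 + RtoC (INR n))
      + 1 + RtoC (beta 1) * / RtoC (INR (S n)))%C.
    - intros n. rewrite (Csum_ext _ (fun k => RtoC (/ INR (S k))%R)).
      2:{ intros j _. simpl zlogz_deriv. unfold inv_deriv. rewrite RtoC_1_plus.
          rewrite RtoC_inv by (apply not_0_INR; lia). simpl. rewrite Rmult_1_l. ring. }
      rewrite Csum_RtoC.
      rewrite RtoC_1_plus, Phi_2_1, Clog_INR_S, beta_1.
      replace (- (1 / 2)) with (- / 2) by field. rewrite RtoC_minus, RtoC_opp. ring.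
    - apply Clim_plus; [apply Clim_plus; [exact Hk|apply Clim_const]|].
      apply Clim_mult; [apply Clim_const|apply Clim_inv_INR_S]. }
  destruct Hex as [s Hs].
  assert (E : Euler_gamma = s).
  { unfold Euler_gamma.
    assert (H : is_lim_seq (fun n => sum_n (fun k => / INR (S k)) n - ln (INR (S n))) s).
    (* The defining sequence contains one more harmonic term, 1/(n+1), which tends to 0. *)
    { apply is_lim_seq_ext with (fun n => (Rsum (fun k => / INR (S k)) n - ln (INR (S n))) + / (1 + INR n)).
      - intros n. rewrite sum_n_Rsum, Rsum_S, S_INR, (Rplus_comm 1). ring.
      - replace (Finite s) with (Finite (s + 0)) by (f_equal; ring).
        apply is_lim_seq_plus'; auto. apply is_lim_seq_inv_INR. }
    rewrite (is_lim_seq_unique _ _ H). reflexivity. }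
  rewrite E. exact Hs.
Qed.

(** * Limit of the logarithms of the partial products *)

Lemma Clog_1 : Clog 1%C = 0%C.
Proof. rewrite (Clog_pos 1) by lra. rewrite ln_1. reflexivity. Qed.

(** On the segment from 1 to 1 + u the modulus is at least 1/2, which accounts for the powers of
    2. *)
Lemma Clog_Taylor (L : nat) (u : C) : Cmod u <= / 2 ->
  Cmod (Clog (1 + u) - Csum (fun i => u ^ S i * inv_deriv i 1 * RtoC (/ INR (fact (S i)))) L)%C
   <= (2 * Cmod u) ^ S L.
Proof.
  intros Hu.
  set (G := fun j t => match j with
      | O => Clog (1 + RtoC t * u)
      | S i => u ^ S i * inv_deriv i (1 + RtoC t * u) end%C).
  assert (Hm : forall t, 0 <= t <= 1 -> Cmod (RtoC t * u)%C <= / 2).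
  { intros t Ht. rewrite Cmod_mult, Cmod_RtoC_pos by lra. generalize (Cmod_ge_0 u); nra. }
  assert (Hs : forall t, 0 <= t <= 1 -> slit_plane (1 + RtoC t * u)%C).
  { intros t Ht. apply slit_plane_1_plus. specialize (Hm t Ht). lra. }
  assert (H := Taylor_chain (S L) G (Cmod u ^ S L * (INR (fact L) * 2 ^ S L))).
  spec H. 2: spec H.
  - intros [|j] t Ht; unfold G.
    + eapply dC_eq; [apply dC_Clog_line; auto|]. rewrite inv_deriv_0. simpl.
      field. apply slit_plane_nz; auto.
    + eapply dC_eq; [apply dC_scal, dC_inv_deriv_line, slit_plane_nz; auto|].
      rewrite (Cpow_S u (S j)). ring.
  - intros t Ht. unfold G. assert (Hnz := slit_plane_nz _ (Hs t Ht)).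
    rewrite Cmod_mult, Cmod_pow, Cmod_inv_deriv by exact Hnz.
    apply Rmult_le_compat_l; [apply pow_le, Cmod_ge_0|].
    apply Rmult_le_compat_l; [apply pos_INR|].
    rewrite <- pow_inv. apply pow_incr. split.
    + left; apply Rinv_0_lt_compat, Cmod_gt_0, Hnz.
    + replace 2 with (/ / 2) by field. apply Rinv_le_contravar; [lra|].
      generalize (Cmod_triangle_rev 1 (RtoC t * u)%C). rewrite Cmod_1. specialize (Hm t Ht). lra.
  - specialize (H 1 ltac:(lra)). rewrite Csum_shift in H. unfold G in H at 1 2.
    replace (1 + RtoC 0 * u)%C with (RtoC 1) in H by ring.
    replace (1 + RtoC 1 * u)%C with (1 + u)%C in H by ring.
    rewrite Clog_1 in H.
    match type of H with Cmod ?a <= _ => match goal with |- Cmod ?b <= _ => replace b with a end end.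
    + eapply Rle_trans; [exact H|]. rewrite pow1, fact_simpl, mult_INR, Rpow_mult_distr.
      assert (Hf := INR_fact_lt_0 L). assert (HL := INR_S_pos L).
      replace (Cmod u ^ S L * (INR (fact L) * 2 ^ S L) * (1 / (INR (S L) * INR (fact L))))
        with (2 ^ S L * Cmod u ^ S L * / INR (S L)) by (field; lra).
      rewrite <- (Rmult_1_r (2 ^ S L * Cmod u ^ S L)) at 2.
      apply Rmult_le_compat_l.
      * apply Rmult_le_pos; apply pow_le; [lra|apply Cmod_ge_0].
      * rewrite <- Rinv_1. apply Rinv_le_contravar; [lra|]. rewrite S_INR. generalize (pos_INR L); lra.
    + rewrite (Csum_ext (fun i => u ^ S i * inv_deriv i 1 * RtoC (/ INR (fact (S i))))%C
        (fun k => G (S k) 0 * RtoC (1 ^ S k / INR (fact (S k))))%C).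
      * ring.
      * intros k _. rewrite pow1. unfold G, Rdiv. rewrite Rmult_1_l.
        replace (1 + RtoC 0 * u)%C with (RtoC 1) by ring. reflexivity.
Qed.

Lemma Clog_Taylor_3 u : Cmod u <= / 2 -> Cmod (Clog (1 + u) - (u - u * u / 2))%C <= (2 * Cmod u) ^ 3.
Proof.
  intros H. eapply Rle_trans; [|apply (Clog_Taylor 2 u H)]. right. f_equal. f_equal. f_equal.
  simpl. unfold inv_deriv; simpl. rewrite Rinv_1, !Rmult_1_r.
  replace (/ (1 + 1)) with (/ 2) by (f_equal; ring). rewrite RtoC_half.
  replace (/ 1)%C with (RtoC 1) by field. replace (RtoC (-1)) with (- (1))%C by (rewrite <- RtoC_opp; reflexivity).
  field.
Qed.

Lemma Clog_Taylor_2 u : Cmod u <= / 2 -> Cmod (Clog (1 + u) - u)%C <= (2 * Cmod u) ^ 2.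
Proof.
  intros H. eapply Rle_trans; [|apply (Clog_Taylor 1 u H)]. right. f_equal. f_equal. f_equal.
  simpl. unfold inv_deriv; simpl. rewrite Rinv_1, !Rmult_1_r.
  replace (/ 1)%C with (RtoC 1) by field. field.
Qed.

Lemma RtoC_INR_S_nz n : RtoC (INR (S n)) <> 0%C.
Proof. intros H. apply RtoC_inj in H. generalize (INR_S_pos n); lra. Qed.

Lemma Clog_shift (z : C) n : 2 * Cmod z <= INR (S n) ->
  Clog (z + RtoC (INR (S n)))%C = (RtoC (ln (INR (S n))) + Clog (1 + z / RtoC (INR (S n))))%C
  /\ Cmod (z / RtoC (INR (S n)))%C = Cmod z / INR (S n) /\ Cmod (z / RtoC (INR (S n)))%C <= / 2.
Proof.
  intros H. assert (Hn := INR_S_pos n).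
  assert (Hm : Cmod (z / RtoC (INR (S n)))%C = Cmod z / INR (S n)).
  { rewrite Cmod_div, Cmod_RtoC_pos by (try apply RtoC_INR_S_nz; lra). reflexivity. }
  assert (Hm2 : Cmod (z / RtoC (INR (S n)))%C <= / 2).
  { rewrite Hm. apply Rmult_le_reg_r with (INR (S n)); auto.
    unfold Rdiv. rewrite Rmult_assoc, Rinv_l; lra. }
  split; [|split]; auto.
  rewrite <- Clog_scal; auto.
  - f_equal. field. apply RtoC_INR_S_nz.
  - apply slit_plane_1_plus. lra.
Qed.

(** For large n this is log(1 + z/(n+1)). Written as a difference of logarithms, it enters algebraic
    identities valid for every n, with no question of branches. *)
Definition lam (z : C) (n : nat) : C := (Clog (z + RtoC (INR (S n))) - RtoC (ln (INR (S n))))%C.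

(** The second order is required because the boundary terms of [Phi 0] multiply the logarithm by
    (z+n+1)^2. The limits of lower order follow on dividing by n + 1. *)
Lemma lam_limit_2 (z : C) :
  Clim (fun n => RtoC (INR (S n)) * RtoC (INR (S n)) * lam z n - RtoC (INR (S n)) * z + z * z / 2)%C 0%C.
Proof.
  destruct (nfloor_ex (2 * Cmod z)) as [N [_ HN]]; [generalize (Cmod_ge_0 z); lra|].
  apply (Clim_squeeze _ _ (fun n => 8 * Cmod z ^ 3 * / (1 + INR n)) N).
  - intros n Hn.
    destruct (Clog_shift z n) as [E [Hm Hm2]].
    { rewrite S_INR. apply le_INR in Hn. lra. }
    assert (Hnz := RtoC_INR_S_nz n). assert (Hp := INR_S_pos n).
    assert (HT := Clog_Taylor_3 _ Hm2). rewrite Hm in HT.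
    unfold lam. rewrite E. set (v := Clog (1 + z / RtoC (INR (S n)))%C) in *.
    replace (RtoC (INR (S n)) * RtoC (INR (S n)) * (RtoC (ln (INR (S n))) + v - RtoC (ln (INR (S n)))) - RtoC (INR (S n)) * z + z * z / 2 - 0)%C
      with (RtoC (INR (S n)) * RtoC (INR (S n)) * (v - (z / RtoC (INR (S n)) - z / RtoC (INR (S n)) * (z / RtoC (INR (S n))) / 2)))%C
      by (field; auto).
    rewrite !Cmod_mult, Cmod_RtoC_pos by lra.
    eapply Rle_trans; [apply Rmult_le_compat_l; [|exact HT]|].
    + apply Rmult_le_pos; lra.
    + right. rewrite (Rplus_comm 1), <- S_INR. field. lra.
  - replace (Finite 0) with (Finite (8 * Cmod z ^ 3 * 0)) by (f_equal; ring).
    apply is_lim_seq_mult'; [apply is_lim_seq_const|apply is_lim_seq_inv_INR].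
Qed.

Lemma lam_limit_1 (z : C) : Clim (fun n => RtoC (INR (S n)) * lam z n - z)%C 0%C.
Proof.
  replace (RtoC 0) with ((0 - z * z / 2) * 0)%C by ring.
  eapply Clim_ext; [|apply Clim_mult; [apply Clim_minus; [apply (lam_limit_2 z)|apply (Clim_const (z * z / 2)%C)]|apply Clim_inv_INR_S]].
  intros n. cbv beta. field. apply RtoC_INR_S_nz.
Qed.

Lemma lam_limit (z : C) : Clim (lam z) 0%C.
Proof.
  replace (RtoC 0) with ((0 + z) * 0)%C by ring.
  eapply Clim_ext; [|apply Clim_mult; [apply Clim_plus; [apply (lam_limit_1 z)|apply (Clim_const z)]|apply Clim_inv_INR_S]].
  intros n. cbv beta. field. apply RtoC_INR_S_nz.
Qed.

Lemma Clim_Csum (f : nat -> nat -> C) (a : nat -> C) m :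
  (forall k, (k < m)%nat -> Clim (f k) (a k)) -> Clim (fun n => Csum (fun k => f k n) m) (Csum a m).
Proof.
  induction m; intros H; simpl; [apply Clim_const|]. apply Clim_plus; auto.
Qed.

Lemma Clim_pow u (l : C) m : Clim u l -> Clim (fun n => u n ^ m)%C (l ^ m)%C.
Proof.
  intros H. induction m; [apply Clim_const|].
  eapply Clim_ext; [intros; symmetry; apply Cpow_S|]. rewrite Cpow_S. apply Clim_mult; auto.
Qed.

(** A single z off the cut lies in some closed sector; here k = - cos(arg z). *)
Lemma slit_plane_sector (z : C) : slit_plane z -> exists c, 0 < c /\
  forall x, 0 <= x -> c * (Cmod z + x) <= Cmod (z + RtoC x)%C.
Proof.
  intros Hz. assert (Hm := slit_plane_Cmod z Hz). assert (Hd := slit_plane_den z Hz).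
  set (k := - Re z / Cmod z).
  assert (Hk : -1 <= k < 1).
  { unfold k. assert (H := re_le_Cmod z). apply Rabs_le_between in H. split.
    - apply Rmult_le_reg_r with (Cmod z); auto. unfold Rdiv. rewrite Rmult_assoc, Rinv_l; lra.
    - apply Rmult_lt_reg_r with (Cmod z); auto. unfold Rdiv. rewrite Rmult_assoc, Rinv_l; lra. }
  exists (sqrt ((1 - k) / 2)). split; [apply sqrt_lt_R0; lra|].
  intros x Hx. apply sector_lower_bound; auto. unfold k. right. field. lra.
Qed.

Lemma Clim_inv_shift (z : C) : slit_plane z -> Clim (fun n => / (z + RtoC (INR n)))%C 0%C.
Proof.
  intros Hz. destruct (slit_plane_sector z Hz) as [c [Hc Hgeo]].
  apply (Clim_squeeze _ _ (fun n => / c * / (Cmod z + INR n)) 0).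
  - intros n _. replace (/ (z + RtoC (INR n)) - 0)%C with (/ (z + RtoC (INR n)))%C by ring.
    assert (Hm := slit_plane_Cmod z Hz). assert (Hn := pos_INR n).
    rewrite Cmod_inv.
    + rewrite <- Rinv_mult. apply Rinv_le_contravar; auto. apply Rmult_lt_0_compat; lra.
    + apply slit_plane_nz, slit_plane_plus_R; auto.
  - replace (Finite 0) with (Finite (/ c * 0)) by (f_equal; ring).
    apply is_lim_seq_mult'; [apply is_lim_seq_const|apply is_lim_seq_inv_INR].
Qed.

(** Logarithm of Euler's product for Gamma(z+1), with the power of n + 1 and one factor
    (z+n+1)/(n+1) removed. The logarithms that remain are those of [log_G_seq], so the two sums
    combine term by term. *)
Definition log_Gamma_seq (n : nat) (z : C) : C :=
  (z * RtoC (ln (INR (S n))) + RtoC (ln (INR (fact n))) - Csum (fun k => Clog (z + 1 + RtoC (INR k))) n)%C.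

Definition log_G_seq (n : nat) (z : C) : C :=
  (z / 2 * RtoC (ln (2 * PI)) - (z + z * z * (1 + RtoC Euler_gamma)) / 2
   + Csum (fun j => RtoC (INR (S j)) * (Clog (z + 1 + RtoC (INR j)) - RtoC (ln (INR (S j))))
                    + (z * z / (2 * RtoC (INR (S j))) - z)) n)%C.

(** The terms of [Phi 0 p] that vanish at infinity; with the opposite sign they become the
    asymptotic series. *)
Definition Phi_tail (p : nat) (z : C) : C := Csum (fun j => RtoC (beta (3 + j)) * inv_deriv j z)%C (p - 2).

Lemma Phi_split p z : (2 <= p)%nat ->
  Phi 0 p z = (zlogz_deriv 0 z - RtoC (/ 2) * zlogz_deriv 1 z + RtoC (1 / 12) * zlogz_deriv 2 z + Phi_tail p z)%C.
Proof.
  intros Hp. unfold Phi, Phi_tail. replace (S p) with (3 + (p - 2))%nat by lia. rewrite Csum_split.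
  f_equal. change (0 + 0)%nat with 0%nat. cbn [Csum zlogz_deriv Nat.add]. rewrite beta_0, beta_1, beta_2.
  replace (- (1 / 2)) with (- / 2) by field. rewrite RtoC_opp. ring.
Qed.

Lemma Phi_tail_limit p z : slit_plane z -> Clim (fun n => Phi_tail p (z + RtoC (INR n))) 0%C.
Proof.
  intros Hz. unfold Phi_tail.
  replace (RtoC 0) with (Csum (fun j => RtoC (beta (3 + j)) * (RtoC ((-1) ^ j * INR (fact j)) * 0 ^ S j)) (p - 2))%C.
  - apply Clim_Csum. intros k _. apply Clim_mult; [apply Clim_const|].
    apply Clim_mult; [apply Clim_const|]. apply Clim_pow. apply Clim_inv_shift; auto.
  - apply Csum_zero. intros k _. simpl. ring.
Qed.

(** The weights k of log G and z of z log Gamma combine to (z+k) log(z+k), the summand for d = 0.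
    The boundary terms at z give the elementary functions of the limit; those at z + n + 1 are
    matched by the sums of 1/k, log k and k log k. *)
Lemma log_quotient_limit (p : nat) (z rem kappa : C) :
  (2 <= p)%nat -> slit_plane z ->
  Clim (Csum (fun k => EM_err 0 p (z + RtoC (INR k))%C)) rem ->
  Clim (fun n => Csum (fun k => zlogz_deriv 1 (1 + RtoC (INR k))%C) n - Phi 0 3 (1 + RtoC (INR n)))%C kappa ->
  Clim (fun n => log_G_seq n z - z * log_Gamma_seq n z)%C
       (- zlogz_deriv 0 z - RtoC (/ 2) * zlogz_deriv 1 z - RtoC (1 / 12) * zlogz_deriv 2 z - Phi_tail p z + rem - kappa)%C.
Proof.
  intros Hp Hz Hrem Hkappa.
  set (sg := RtoC (/ 2 * ln (2 * PI))).
  set (g := RtoC Euler_gamma).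
  set (hn := fun n => RtoC (Rsum (fun k => / INR (S k)) n - ln (INR (S n)))).
  set (sn := fun n => RtoC (ln (INR (fact n)) - ((INR n + / 2) * ln (INR (S n)) - INR (S n)))).
  set (N := fun n => RtoC (INR (S n))).
  set (K := fun n => (Csum (fun k => zlogz_deriv 1 (1 + RtoC (INR k))%C) n - Phi 0 3 (1 + RtoC (INR n)))%C).
  (* An exact identity for every n. Apart from the boundary terms at z, the defects and [K n], each
     bracket tends to 0: the tail at infinity, the errors in Euler's and Stirling's limits, and the
     expansions of [lam] to orders 2, 1 and 0. *)
  apply Clim_ext with (fun n =>
    ((- zlogz_deriv 0 z - RtoC (/ 2) * zlogz_deriv 1 z - RtoC (1 / 12) * zlogz_deriv 2 z - Phi_tail p z)
     + Csum (fun k => EM_err 0 p (z + RtoC (INR k))%C) (S n)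
     - K n
     + Phi_tail p (z + N n)
     + z * z / 2 * (hn n - g) - z * (sn n - sg)
     + / 2 * (N n * N n * lam z n - N n * z + z * z / 2)
     + z * (N n * lam z n - z) + z * z / 2 * lam z n
     - / 2 * (N n * lam z n - z) - z / 2 * lam z n + / 12 * lam z n)%C).
  - intros n.
    (* The sum begins with z log z itself, which occurs in neither product; removing it turns the
       coefficient 1/2 of [zlogz_deriv 1 z] into - 1/2. *)
    assert (HE := EM_sum 0 p z (S n)). rewrite Csum_shift in HE. simpl (INR 0) in HE.
    replace (z + RtoC 0)%C with z in HE by ring.
    rewrite (Phi_split p z Hp), (Phi_split p (z + RtoC (INR (S n))) Hp) in HE.
    fold (N n) in HE.
    rewrite (Csum_ext (fun k => zlogz_deriv 1 (z + RtoC (INR (S k)))%C)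
      (fun j => (z * Clog (z + 1 + RtoC (INR j)) + RtoC (INR (S j)) * Clog (z + 1 + RtoC (INR j)))%C)) in HE.
    2:{ intros k _. replace (z + RtoC (INR (S k)))%C with (z + 1 + RtoC (INR k))%C
          by (rewrite S_INR, RtoC_plus; ring). simpl zlogz_deriv.
        rewrite S_INR, RtoC_plus. ring. }
    rewrite Csum_plus, Csum_scal in HE.
    unfold log_G_seq, log_Gamma_seq, K, hn, sn.
    rewrite (Csum_ext (fun j => RtoC (INR (S j)) * (Clog (z + 1 + RtoC (INR j)) - RtoC (ln (INR (S j))))
                    + (z * z / (2 * RtoC (INR (S j))) - z))%C
      (fun j => RtoC (INR (S j)) * Clog (z + 1 + RtoC (INR j)) - zlogz_deriv 1 (1 + RtoC (INR j)) + ((z * z / 2) * RtoC (/ INR (S j)) - z))%C).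
    2:{ intros k _. simpl zlogz_deriv. rewrite RtoC_1_plus, Clog_INR_S, RtoC_inv by (generalize (INR_S_pos k); lra).
        field. apply RtoC_INR_S_nz. }
    rewrite Csum_plus, Csum_minus, Csum_minus, Csum_scal, Csum_RtoC.
    replace (Csum (fun _ => z) n) with (RtoC (INR n) * z)%C.
    2:{ clear. induction n; [simpl; ring|]. rewrite Csum_S, <- IHn, S_INR, RtoC_plus. ring. }
    set (S1 := Csum (fun k => RtoC (INR (S k)) * Clog (z + 1 + RtoC (INR k)))%C n) in *.
    set (S2 := Csum (fun k => Clog (z + 1 + RtoC (INR k)))%C n) in *.
    set (S3 := Csum (fun k => zlogz_deriv 1 (1 + RtoC (INR k)))%C n) in *.
    set (E := Csum (fun k => EM_err 0 p (z + RtoC (INR k))%C) (S n)) in *.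
    assert (HS1 : S1 = (zlogz_deriv 0 (z + N n) - RtoC (/ 2) * zlogz_deriv 1 (z + N n) + RtoC (1 / 12) * zlogz_deriv 2 (z + N n) + Phi_tail p (z + N n)
      - (zlogz_deriv 0 z - RtoC (/ 2) * zlogz_deriv 1 z + RtoC (1 / 12) * zlogz_deriv 2 z + Phi_tail p z) + E - zlogz_deriv 1 z - z * S2)%C).
    { rewrite <- HE. ring. }
    rewrite HS1, Phi_0_3, RtoC_1_plus. cbn [zlogz_deriv]. fold (N n).
    unfold lam. fold (N n). set (L2 := Clog (z + N n)).
    assert (HL : Clog (N n) = RtoC (ln (INR (S n)))) by apply Clog_INR_S.
    rewrite HL.
    assert (EN : N n = (RtoC (INR n) + 1)%C) by (unfold N; rewrite S_INR, RtoC_plus; reflexivity).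
    unfold sg, g.
    rewrite !RtoC_minus, !RtoC_mult, RtoC_plus.
    fold (N n).
    replace (RtoC (1 / 12)) with (/ 12)%C by (unfold Rdiv; rewrite Rmult_1_l, RtoC_inv by lra; reflexivity).
    rewrite RtoC_half. rewrite EN.
    field.
  - replace (- zlogz_deriv 0 z - RtoC (/ 2) * zlogz_deriv 1 z - RtoC (1 / 12) * zlogz_deriv 2 z - Phi_tail p z + rem - kappa)%C
      with ((- zlogz_deriv 0 z - RtoC (/ 2) * zlogz_deriv 1 z - RtoC (1 / 12) * zlogz_deriv 2 z - Phi_tail p z) + rem - kappa
        + 0 + z * z / 2 * (g - g) - z * (sg - sg) + / 2 * 0 + z * 0 + z * z / 2 * 0 - / 2 * 0 - z / 2 * 0 + / 12 * 0)%C by ring.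
    apply Clim_plus; [apply Clim_minus; [apply Clim_minus; [apply Clim_plus; [apply Clim_plus; [apply Clim_plus;
      [apply Clim_minus; [apply Clim_plus; [apply Clim_plus; [apply Clim_minus; [apply Clim_plus;
      [apply Clim_const|apply (Clim_incr_1 (Csum (fun k => EM_err 0 p (z + RtoC (INR k))%C))); exact Hrem]|exact Hkappa]|]|]|]|]|]|]|]|]|].
    + apply (Clim_incr_1 (fun n => Phi_tail p (z + RtoC (INR n)))). apply Phi_tail_limit; auto.
    + apply Clim_mult; [apply Clim_const|]. apply Clim_minus; [|apply Clim_const].
      apply Clim_RtoC, Euler_gamma_limit.
    + apply Clim_mult; [apply Clim_const|]. apply Clim_minus; [|apply Clim_const].
      apply Clim_RtoC, Stirling.
    + apply Clim_mult; [apply Clim_const|]. apply lam_limit_2.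
    + apply Clim_mult; [apply Clim_const|]. apply lam_limit_1.
    + apply Clim_mult; [apply Clim_const|]. apply lam_limit.
    + apply Clim_mult; [apply Clim_const|]. apply lam_limit_1.
    + apply Clim_mult; [apply Clim_const|]. apply lam_limit.
    + apply Clim_mult; [apply Clim_const|]. apply lam_limit.
Qed.

(** * The logarithm of the Gamma function *)

(** The power of n + 1 replaces that of n, so that the logarithm is meaningful from n = 0 and
    increments are simple. *)
Definition log_Gamma_euler (n : nat) (w : C) : C :=
  (w * RtoC (ln (INR (S n))) + RtoC (ln (INR (fact n))) - Csum (fun k => Clog (w + RtoC (INR k))) (S n))%C.

Lemma log_Gamma_euler_shift n z : log_Gamma_euler n (z + 1) = (log_Gamma_seq n z - lam z n)%C.
Proof.
  unfold log_Gamma_euler, log_Gamma_seq, lam. rewrite Csum_S.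
  replace (z + RtoC (INR (S n)))%C with (z + 1 + RtoC (INR n))%C by (rewrite (S_INR n), RtoC_plus; ring).
  ring.
Qed.

Lemma lam_bound (w : C) n : 2 * Cmod w <= INR (S n) ->
  Cmod (lam w n - w / RtoC (INR (S n)))%C <= 4 * (Cmod w * Cmod w) * / (INR (S n) * INR (S n)).
Proof.
  intros H. destruct (Clog_shift w n H) as [E [Hm Hm2]].
  assert (HT := Clog_Taylor_2 _ Hm2). rewrite Hm in HT. unfold lam. rewrite E.
  match goal with |- Cmod ?a <= _ => replace a with (Clog (1 + w / RtoC (INR (S n))) - w / RtoC (INR (S n)))%C by ring end.
  eapply Rle_trans; [exact HT|]. right. field. generalize (INR_S_pos n); lra.
Qed.

(** The threshold and the rate depend only on the bound for |w|: this uniformity is what makes the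
    limit continuous. *)
Lemma log_Gamma_euler_cvg (Rd : R) : 0 <= Rd -> exists (n0 : nat) (D : R), 0 <= D /\
  forall w, slit_plane w -> Cmod w <= Rd ->
  exists l, Clim (fun n => log_Gamma_euler n w) l /\
    forall n, (n0 <= n)%nat -> Cmod (l - log_Gamma_euler n w)%C <= D * / INR (S n).
Proof.
  intros HR. destruct (nfloor_ex (2 * Rd + 2)) as [n0 [_ Hn0]]; [lra|].
  exists n0, (2 * (4 * (Rd * Rd) + 4 * Rd)).
  assert (HD : 0 <= 4 * (Rd * Rd) + 4 * Rd) by nra.
  split; [lra|].
  intros w Hw Hwr.
  set (D := 4 * (Rd * Rd) + 4 * Rd) in *.
  assert (Hinc : forall n, (n0 <= n)%nat ->
    Cmod (log_Gamma_euler (S n) w - log_Gamma_euler n w)%C <= D * (2 / INR (S n) - 2 / (INR (S n) + 1))).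
  { intros n Hn. assert (HnR : 2 * Rd + 2 <= INR (S n)) by (rewrite S_INR; apply le_INR in Hn; lra).
    assert (Hp := INR_S_pos n).
    (* The first-order terms w/(n+1) cancel, leaving second-order errors of two logarithms. *)
    assert (E : (log_Gamma_euler (S n) w - log_Gamma_euler n w)%C =
       (w * (lam 1 n - 1 / RtoC (INR (S n))) - (lam w n - w / RtoC (INR (S n))))%C).
    { unfold log_Gamma_euler, lam. rewrite (Csum_S _ (S n)).
      rewrite (fact_simpl n), mult_INR, ln_mult by (auto; apply INR_fact_lt_0).
      replace (1 + RtoC (INR (S n)))%C with (RtoC (INR (S (S n)))) by (rewrite (S_INR (S n)), RtoC_plus; ring).
      rewrite Clog_INR_S, RtoC_plus. field. apply RtoC_INR_S_nz. }
    rewrite E. eapply Rle_trans; [apply Cmod_minus_triangle|]. rewrite Cmod_mult.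
    assert (H1 := lam_bound 1 n). rewrite Cmod_1 in H1. specialize (H1 ltac:(lra)).
    assert (H2 := lam_bound w n ltac:(lra)).
    set (x := INR (S n)) in *. assert (Hi := inv_sqr_telescope x ltac:(lra)).
    assert (Hi0 : 0 <= / (x * x)) by (left; apply Rinv_0_lt_compat; nra).
    assert (Hw0 := Cmod_ge_0 w).
    apply Rle_trans with (D * / (x * x)); [|apply Rmult_le_compat_l; auto].
    unfold D. rewrite Rmult_plus_distr_r, Rplus_comm. apply Rplus_le_compat.
    - eapply Rle_trans; [exact H2|]. apply Rmult_le_compat_r; auto. nra.
    - replace (4 * Rd * / (x * x)) with (Rd * (4 * (1 * 1) * / (x * x))) by ring.
      apply Rmult_le_compat; auto. apply Cmod_ge_0. }
  destruct (Csum_cvg_telescope (fun k => log_Gamma_euler (S (n0 + k)) w - log_Gamma_euler (n0 + k) w)%C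
     (fun k => D * (2 * / (INR (S n0) + INR k)))) as [l [Hl Hb]].
  - intros n. eapply Rle_trans; [apply Hinc; lia|]. right.
    replace (INR (S (n0 + n))) with (INR (S n0) + INR n) by (rewrite <- plus_INR; f_equal; lia).
    rewrite (S_INR n), <- Rplus_assoc. unfold Rdiv; ring.
  - replace (Finite 0) with (Finite (D * (2 * 0))) by (f_equal; ring).
    apply is_lim_seq_mult'; [apply is_lim_seq_const|]. apply is_lim_seq_mult'; [apply is_lim_seq_const|].
    apply is_lim_seq_inv_INR.
  - assert (Etel : forall k, Csum (fun k => log_Gamma_euler (S (n0 + k)) w - log_Gamma_euler (n0 + k) w)%C k
        = (log_Gamma_euler (n0 + k) w - log_Gamma_euler n0 w)%C).
    { intros k. induction k.
      - rewrite Nat.add_0_r. simpl Csum. ring.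
      - rewrite Csum_S, IHk, Nat.add_succ_r. ring. }
    exists (l + log_Gamma_euler n0 w)%C. split.
    + assert (H : Clim (fun n => log_Gamma_euler (n0 + n) w) (l + log_Gamma_euler n0 w)%C).
      { eapply Clim_ext; [|apply Clim_plus; [exact Hl|apply (Clim_const (log_Gamma_euler n0 w))]].
        intros n. cbv beta. rewrite Etel. ring. }
      destruct H as [Ha Hbb]. split.
      * apply (is_lim_seq_incr_n (fun n => Re (log_Gamma_euler n w)) n0).
        eapply is_lim_seq_ext; [|exact Ha]. intros n. cbv beta. rewrite Nat.add_comm. reflexivity.
      * apply (is_lim_seq_incr_n (fun n => Im (log_Gamma_euler n w)) n0).
        eapply is_lim_seq_ext; [|exact Hbb]. intros n. cbv beta. rewrite Nat.add_comm. reflexivity.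
    + intros n Hn. specialize (Hb (n - n0)%nat). rewrite Etel in Hb.
      replace (n0 + (n - n0))%nat with n in Hb by lia.
      replace (INR (S n0) + INR (n - n0)) with (INR (S n)) in Hb by (rewrite <- plus_INR; f_equal; lia).
      replace (l + log_Gamma_euler n0 w - log_Gamma_euler n w)%C with (l - (log_Gamma_euler n w - log_Gamma_euler n0 w))%C by ring.
      eapply Rle_trans; [exact Hb|]. right; ring.
Qed.

Definition log_Gamma_lim (w : C) : C := Clim_seq (fun n => log_Gamma_euler n w).

Lemma log_Gamma_lim_correct w : slit_plane w -> Clim (fun n => log_Gamma_euler n w) (log_Gamma_lim w).
Proof.
  intros Hw. destruct (log_Gamma_euler_cvg (Cmod w) (Cmod_ge_0 w)) as [n0 [D [_ H]]].
  destruct (H w Hw (Rle_refl _)) as [l [Hl _]]. unfold log_Gamma_lim. rewrite (Clim_seq_eq _ _ Hl). exact Hl.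
Qed.

Lemma Cprod_Cexp (w : C) n : slit_plane w ->
  Cprod (fun k => w + RtoC (INR k))%C n = Cexp (Csum (fun k => Clog (w + RtoC (INR k))) n)%C.
Proof.
  intros Hw. induction n; [simpl; rewrite Cexp_0; reflexivity|].
  rewrite Csum_S, Cexp_plus, <- IHn, Cexp_Clog; [reflexivity|].
  apply slit_plane_plus_R; auto. apply pos_INR.
Qed.

(** The sequence defining [Gamma] has n^w in place of (n+1)^w; the quotient of these powers tends to
    1. *)
Lemma Cexp_log_Gamma_lim w : slit_plane w -> Cexp (log_Gamma_lim w) = Gamma w.
Proof.
  intros Hw. symmetry. apply Clim_seq_eq.
  assert (H := log_Gamma_lim_correct w Hw).
  apply (Clim_ext_loc (fun n => Cexp (log_Gamma_euler n w + w * RtoC (ln (INR n) - ln (INR (S n))))) _ _ 1).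
  - intros n Hn. destruct n as [|n]; [lia|].
    unfold log_Gamma_euler. rewrite Cprod_Cexp by auto. unfold Cpower.
    rewrite (Clog_INR_S n).
    rewrite <- (exp_ln (INR (fact (S n)))) at 2 by apply INR_fact_lt_0.
    rewrite <- Cexp_RtoC, <- Cexp_plus, <- Cexp_minus. f_equal.
    rewrite RtoC_minus. ring.
  - apply Clim_Cexp.
    replace (log_Gamma_lim w) with (log_Gamma_lim w + w * RtoC 0)%C by ring.
    apply Clim_plus; auto. apply Clim_mult; [apply Clim_const|]. apply Clim_RtoC.
    apply is_lim_seq_incr_1.
    assert (H1 := lam_limit 1%C).
    replace (Finite 0) with (Finite (- Re 0)) by (simpl; f_equal; ring).
    apply is_lim_seq_ext with (fun n => - Re (lam 1 n)).
    + intros n. unfold lam. replace (1 + RtoC (INR (S n)))%C with (RtoC (INR (S (S n)))) by (rewrite (S_INR (S n)), RtoC_plus; ring).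
      rewrite Clog_INR_S, <- RtoC_minus, re_RtoC. ring.
    + apply -> (is_lim_seq_opp (fun n => Re (lam 1 n)) (Re 0)). apply H1.
Qed.

Lemma log_Gamma_lim_real x : 0 < x -> Im (log_Gamma_lim (RtoC x)) = 0.
Proof.
  intros Hx. destruct (log_Gamma_lim_correct (RtoC x) (slit_plane_RtoC x Hx)) as [_ H].
  assert (E : is_lim_seq (fun n => Im (log_Gamma_euler n (RtoC x))) 0).
  { eapply is_lim_seq_ext; [|apply is_lim_seq_const]. intros n. symmetry.
    unfold log_Gamma_euler.
    rewrite (Csum_ext _ (fun k => RtoC (ln (x + INR k)))).
    - rewrite Csum_RtoC, <- RtoC_mult, <- RtoC_plus, <- RtoC_minus. reflexivity.
    - intros k _. rewrite <- RtoC_plus, Clog_pos; auto. generalize (pos_INR k); lra. }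
  apply is_lim_seq_unique in H. rewrite (is_lim_seq_unique _ _ E) in H. injection H; auto.
Qed.

(** * Continuity and uniqueness of log Gamma *)

Lemma slit_plane_iff z : slit_plane z <-> 0 < Cmod z + Re z.
Proof.
  split; [apply slit_plane_den|]. intros H [H1 H2].
  assert (E := Cmod_sqr z). rewrite H1 in E. generalize (Cmod_ge_0 z). nra.
Qed.

Lemma Re_line (z v : C) s : Re (z + RtoC s * v)%C = Re z + s * Re v.
Proof. rewrite Re_plus, Re_mult, re_RtoC, im_RtoC. ring. Qed.

Lemma Im_line (z v : C) s : Im (z + RtoC s * v)%C = Im z + s * Im v.
Proof. rewrite Im_plus, Im_mult, re_RtoC, im_RtoC. ring. Qed.

Lemma slit_plane_open_line (z v : C) t : slit_plane (z + RtoC t * v)%C ->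
  locally t (fun s => slit_plane (z + RtoC s * v)%C).
Proof.
  intros H. assert (Hp := slit_plane_den _ H). assert (Hm := slit_plane_Cmod _ H).
  assert (Em : forall s, Cmod (z + RtoC s * v)%C = sqrt ((Re z + s * Re v) * (Re z + s * Re v) + (Im z + s * Im v) * (Im z + s * Im v))).
  { intros s. rewrite <- Re_line, <- Im_line. rewrite <- Cmod_sqr. symmetry. apply sqrt_square, Cmod_ge_0. }
  assert (Hc : continuous (fun s => Cmod (z + RtoC s * v)%C + Re (z + RtoC s * v)%C) t).
  { apply continuous_ext with (fun s => sqrt ((Re z + s * Re v) * (Re z + s * Re v) + (Im z + s * Im v) * (Im z + s * Im v)) + (Re z + s * Re v)).
    - intros s. rewrite Em, Re_line. reflexivity.
    - apply (ex_derive_continuous (V := R_NormedModule)). auto_derive.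
      rewrite <- Re_line, <- Im_line, <- Cmod_sqr. nra. }
  assert (Hl : locally t (fun s => 0 < Cmod (z + RtoC s * v)%C + Re (z + RtoC s * v)%C)).
  { apply (Hc (fun u => 0 < u)). apply (open_gt 0). exact Hp. }
  eapply filter_imp; [|exact Hl]. intros s. apply slit_plane_iff.
Qed.

Lemma uniform_limit_continuous (f : nat -> R -> R) (g : R -> R) t :
  (forall n, continuous (f n) t) ->
  (forall eps : posreal, exists n, locally t (fun s => Rabs (f n s - g s) < eps)) ->
  continuous g t.
Proof.
  intros Hf Hu. apply filterlim_locally. intros eps.
  assert (He : 0 < eps / 3) by (generalize (cond_pos eps); lra).
  destruct (Hu (mkposreal _ He)) as [n Hn]. simpl in Hn.
  assert (Hc := proj1 (filterlim_locally _ _) (Hf n) (mkposreal _ He)).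
  assert (Ht := locally_singleton _ _ Hn). cbv beta in Ht.
  eapply filter_imp; [|exact (filter_and _ _ Hn Hc)]. intros s [H1 H2].
  unfold ball in *; simpl in *. unfold AbsRing_ball, abs, minus, plus, opp in *; simpl in *.
  apply Rabs_lt_between in Ht. apply Rabs_lt_between in H1. apply Rabs_lt_between in H2.
  apply Rabs_lt_between. lra.
Qed.

Lemma continuous_line (z v : C) t : continuous (fun s => z + RtoC s * v)%C t.
Proof.
  apply continuous_ext with (fun s => (Re z + s * Re v, Im z + s * Im v)).
  { intros s. apply Ceq; [rewrite Re_line|rewrite Im_line]; reflexivity. }
  apply (continuous_comp_2 (fun s => Re z + s * Re v) (fun s => Im z + s * Im v) (fun a b => (a, b))).
  - apply (ex_derive_continuous (V := R_NormedModule)). auto_derive. auto.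
  - apply (ex_derive_continuous (V := R_NormedModule)). auto_derive. auto.
  - apply continuous_ext with (fun x : R * R => x).
    + intros [a b]; reflexivity.
    + apply continuous_id.
Qed.

(** Locally uniform limit of continuous functions. Continuity of the imaginary part along lines is
    all that the uniqueness argument on a segment uses. *)
Lemma log_Gamma_lim_continuous_line (z v : C) t : slit_plane (z + RtoC t * v)%C ->
  continuous (fun s => Im (log_Gamma_lim (z + RtoC s * v)%C)) t.
Proof.
  intros Ht.
  apply (uniform_limit_continuous (fun n s => Im (log_Gamma_euler n (z + RtoC s * v)%C))).
  - intros n.
    assert (Hd : exists l, dC (fun s => log_Gamma_euler n (z + RtoC s * v)%C) t l).
    { eexists. unfold log_Gamma_euler. apply dC_minus.
      - apply dC_plus; [|apply dC_const]. apply dC_mult; [apply dC_line|apply dC_const].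
      - apply dC_Csum with (a := fun k => (v / (z + RtoC (INR k) + RtoC t * v))%C). intros k _.
        eapply dC_ext; [|apply (dC_Clog_line (z + RtoC (INR k)) v t)].
        + intros s. cbv beta. f_equal. ring.
        + replace (z + RtoC (INR k) + RtoC t * v)%C with (z + RtoC t * v + RtoC (INR k))%C by ring.
          apply slit_plane_plus_R; auto. apply pos_INR. }
    destruct Hd as [l Hd]. apply (dC_continuous_Im _ _ _ Hd).
  - intros eps.
    set (Rd := Cmod z + (Rabs t + 1) * Cmod v).
    assert (HR : 0 <= Rd).
    { unfold Rd. generalize (Cmod_ge_0 z) (Cmod_ge_0 v) (Rabs_pos t). nra. }
    destruct (log_Gamma_euler_cvg Rd HR) as [n0 [D [HD H]]].
    destruct (nfloor_ex (D / eps)) as [n1 [_ Hn1]].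
    { apply Rmult_le_pos; auto. left; apply Rinv_0_lt_compat, cond_pos. }
    exists (n0 + n1)%nat.
    assert (Hball : locally t (fun s => Rabs (s - t) < 1)).
    { exists (mkposreal 1 Rlt_0_1). intros y Hy. exact Hy. }
    eapply filter_imp; [|exact (filter_and _ _ (slit_plane_open_line z v t Ht) Hball)].
    intros s [Hs Hst].
    destruct (H (z + RtoC s * v)%C Hs) as [l [Hl Hb]].
    { eapply Rle_trans; [apply Cmod_triangle|]. unfold Rd. apply Rplus_le_compat_l.
      rewrite Cmod_mult, Cmod_R. apply Rmult_le_compat_r; [apply Cmod_ge_0|].
      replace s with (t + (s - t)) by ring. eapply Rle_trans; [apply Rabs_triang|lra]. }
    rewrite (Clim_unique _ _ _ (log_Gamma_lim_correct _ Hs) Hl).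
    specialize (Hb (n0 + n1)%nat ltac:(lia)).
    rewrite <- Im_minus. eapply Rle_lt_trans; [apply im_le_Cmod|].
    rewrite Cmod_minus_sym. eapply Rle_lt_trans; [exact Hb|].
    assert (Hp := INR_S_pos (n0 + n1)).
    apply Rmult_lt_reg_r with (INR (S (n0 + n1))); auto. rewrite Rmult_assoc, Rinv_l, Rmult_1_r by lra.
    apply Rmult_lt_reg_r with (/ eps); [apply Rinv_0_lt_compat, cond_pos|].
    replace (eps * INR (S (n0 + n1)) * / eps) with (INR (S (n0 + n1))).
    2:{ field. generalize (cond_pos eps); lra. }
    eapply Rlt_le_trans; [exact Hn1|]. rewrite <- S_INR. apply le_INR. lia.
Qed.

Lemma cos_eq_1_small y : cos y = 1 -> -1 <= y <= 1 -> y = 0.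
Proof.
  intros H Hy. assert (HPI := PI2_1).
  assert (Hs : sin (y / 2) = 0).
  { replace y with (2 * (y / 2)) in H by field. rewrite cos_2a_sin in H. nra. }
  destruct (Rtotal_order y 0) as [Hl|[He|Hg]]; auto.
  - assert (0 < sin (- (y / 2))) by (apply sin_gt_0; lra). rewrite sin_neg in H0. lra.
  - assert (0 < sin (y / 2)) by (apply sin_gt_0; lra). lra.
Qed.

Lemma Cexp_eq a b : Cexp a = Cexp b -> Re a = Re b /\ cos (Im a - Im b) = 1.
Proof.
  intros H. assert (E : Cexp (a - b)%C = 1%C).
  { rewrite Cexp_minus, H. field. apply Cexp_nz. }
  assert (Em : exp (Re (a - b)%C) = 1) by (rewrite <- Cmod_Cexp, E, Cmod_1; reflexivity).
  assert (Er : Re (Cexp (a - b)%C) = 1) by (rewrite E; reflexivity).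
  unfold Cexp in Er. simpl in Er. fold (Re a) (Re b) (Im a) (Im b) in Er.
  change (exp (Re (a - b)%C) * cos (Im a - Im b) = 1) in Er.
  rewrite Em in Er. split; [|lra].
  assert (Re (a - b)%C = 0) by (apply exp_inv; rewrite exp_0; auto).
  rewrite Re_minus in H0. lra.
Qed.

(* On the segment from 1 to z the imaginary parts differ by a continuous function with
   values in 2 pi Z that vanishes at 1. *)
Lemma log_Gamma_unique (L : C -> C) : is_log_Gamma L -> forall z, slit_plane z -> L z = log_Gamma_lim z.
Proof.
  intros [Hc [He Hr]] z Hz.
  set (v := (z - 1)%C).
  set (g := fun t => (1 + RtoC t * v)%C).
  (* The slit plane is star-shaped about 1. *)
  assert (Hg : forall t, 0 <= t <= 1 -> slit_plane (g t)).
  { intros t Ht [H1 H2]. unfold g in *. rewrite Im_line in H1. rewrite Re_line in H2.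
    unfold v in *. rewrite Im_minus in H1. rewrite Re_minus in H2. simpl in H1, H2.
    apply Hz. destruct (Req_dec t 0) as [->|Hnz]; [unfold Re in *; lra|].
    assert (H3 : Im z = 0). { apply Rmult_eq_reg_l with t; auto. unfold Im in *; lra. }
    split; auto. unfold Re in *. nra. }
  assert (Hcos : forall t, 0 <= t <= 1 -> cos (Im (L (g t)) - Im (log_Gamma_lim (g t))) = 1).
  { intros t Ht. apply Cexp_eq. rewrite He, Cexp_log_Gamma_lim; auto. }
  set (phi := fun t => Im (L (g t)) - Im (log_Gamma_lim (g t))).
  assert (Hphi : forall t, 0 <= t <= 1 -> continuity_pt phi t).
  { intros t Ht. apply continuity_pt_filterlim.
    apply (continuous_minus (V := R_NormedModule)).
    - apply (continuous_comp (fun s => L (g s)) snd).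
      + apply (continuous_comp g L); [apply continuous_line|apply Hc, Hg; auto].
      + destruct (L (g t)). apply continuous_snd.
    - apply log_Gamma_lim_continuous_line. apply Hg; auto. }
  assert (H0 : phi 0 = 0).
  { unfold phi, g. replace (1 + RtoC 0 * v)%C with (RtoC 1) by ring.
    rewrite Hr, log_Gamma_lim_real by lra. ring. }
  assert (E1 : g 1 = z) by (unfold g, v; ring).
  assert (Hfin : phi 1 = 0).
  (* To leave [-1, 1] the function would have to take the value 1 or -1, where the cosine is not 1;
     inside, 0 is the only value with cosine 1. *)
  { destruct (Rle_dec (-1) (phi 1)) as [Ha|Ha]; [destruct (Rle_dec (phi 1) 1) as [Hb|Hb]|].
    - apply cos_eq_1_small; [|lra]. apply Hcos; lra.
    - exfalso. destruct (Ranalysis5.IVT_interv (fun t => phi t - 1) 0 1) as [x [Hx Hx1]]; try lra.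
      + intros a Hai. apply continuity_pt_minus; auto. apply continuity_pt_const. intros ? ?; reflexivity.
      + assert (1 = 0); [|lra]. apply cos_eq_1_small; [|lra].
        replace 1 with (phi x) at 1 by lra. apply Hcos; auto.
    - exfalso. destruct (Ranalysis5.IVT_interv (fun t => - 1 - phi t) 0 1) as [x [Hx Hx1]]; try lra.
      + intros a Hai. apply continuity_pt_minus; auto. apply continuity_pt_const. intros ? ?; reflexivity.
      + assert (- (1) = 0); [|lra]. apply cos_eq_1_small; [|lra].
        replace (- (1)) with (phi x) at 1 by lra. apply Hcos; auto. }
  unfold phi in Hfin. rewrite E1 in Hfin.
  assert (Hre : Re (L z) = Re (log_Gamma_lim z)).
  { apply Cexp_eq. rewrite He, Cexp_log_Gamma_lim; auto. }
  apply Ceq; auto. lra.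
Qed.

(** * Continuation of the zeta function *)

Definition exp_rem (m : nat) (y : C) : C := (Cexp y - Csum (fun i => y ^ i * RtoC (/ INR (fact i))) m)%C.

(** Differentiation lowers the order by one, and at order 0 the remainder is the exponential itself,
    so [pred 0 = 0] is the right value. *)
Lemma dC_exp_rem m f t a : dC f t a -> dC (fun t => exp_rem m (f t)) t (exp_rem (pred m) (f t) * a)%C.
Proof.
  intros H. unfold exp_rem. destruct m as [|m].
  - simpl. eapply dC_ext; [|eapply dC_eq; [apply dC_Cexp; exact H|]].
    + intros; cbv beta; ring.
    + ring.
  - simpl pred.
    apply (dC_ext (fun s => Cexp (f s) - (f s ^ 0 * RtoC (/ INR (fact 0))
             + Csum (fun k => f s ^ S k * RtoC (/ INR (fact (S k)))) m))%C).
    { intros s. rewrite (Csum_shift (fun i => f s ^ i * RtoC (/ INR (fact i)))%C). reflexivity. }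
    eapply dC_eq.
    + apply dC_minus; [apply dC_Cexp; exact H|]. apply dC_plus.
      * simpl. apply (dC_const (1 * RtoC (/ 1))%C).
      * apply dC_Csum. intros k _. eapply dC_ext; [intros s; apply Cmult_comm|].
        apply dC_scal. apply dC_pow. exact H.
    + cbv beta. rewrite Cmult_comm. rewrite Cplus_0_l.
      replace ((Cexp (f t) - Csum (fun i => f t ^ i * RtoC (/ INR (fact i))) m) * a)%C with
        (a * Cexp (f t) - a * Csum (fun i => f t ^ i * RtoC (/ INR (fact i))) m)%C by ring.
      rewrite <- Csum_scal. f_equal. apply Csum_ext. intros k _.
      replace (S k - 1)%nat with k by lia. rewrite fact_simpl, mult_INR, Rinv_mult, RtoC_mult.
      rewrite (RtoC_inv (INR (S k))) by (generalize (INR_S_pos k); lra). field. apply RtoC_INR_S_nz.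
Qed.

Lemma exp_rem_step m y : (exp_rem m y - exp_rem (S m) y)%C = (y ^ m * RtoC (/ INR (fact m)))%C.
Proof. unfold exp_rem. rewrite Csum_S. ring. Qed.

Lemma pow_fact_le_exp y m : 0 <= y -> y ^ m / INR (fact m) <= exp y.
Proof.
  intros Hy. eapply Rle_trans; [|apply (exp_ge_taylor y m Hy)].
  rewrite <- sum_n_Reals, sum_n_Rsum, Rsum_S.
  assert (H := Rsum_pos (fun k => y ^ k / INR (fact k)) m).
  spec H; [|lra]. intros k _. apply Rmult_le_pos; [apply pow_le; auto|].
  left; apply Rinv_0_lt_compat, INR_fact_lt_0.
Qed.

(* The chain x^(1-s), (1-s) x^(-s), (1-s)(-s) x^(-s-1), ... at s = s0 + h, minus the Taylor
   polynomials in h of degree < m of its terms.  Here 0 - 1 = 0 in [pred m] is intended. *)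
Fixpoint power_rem (s0 h : C) (j m : nat) (x : R) : C :=
  match j with
  | O => (Cexp ((1 - s0) * RtoC (ln x)) * exp_rem m (- h * RtoC (ln x)))%C
  | S i => (((1 - RtoC (INR i) - s0) * power_rem s0 h i m x - h * power_rem s0 h i (pred m) x) * RtoC (/ x))%C
  end.

(** The coefficient of h^k in [power_chain (s0 + h) j x], as the difference of two successive
    remainders shows. *)
Fixpoint power_coef (s0 : C) (j k : nat) (x : R) : C :=
  match j with
  | O => (Cexp ((1 - s0) * RtoC (ln x)) * ((- RtoC (ln x)) ^ k * RtoC (/ INR (fact k))))%C
  | S i => (((1 - RtoC (INR i) - s0) * power_coef s0 i k x
             - match k with O => 0 | S l => power_coef s0 i l x end) * RtoC (/ x))%C
  end.

(** Starting from x^(1-s), without division by 1 - s, makes the summand (1-s) x^(-s); the pole of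
    zeta at 1 therefore never appears. *)
Fixpoint power_chain (s : C) (j : nat) (x : R) : C :=
  match j with
  | O => Cexp ((1 - s) * RtoC (ln x))%C
  | S i => ((1 - RtoC (INR i) - s) * power_chain s i x * RtoC (/ x))%C
  end.

Lemma power_rem_0 s0 h j x : power_rem s0 h j 0 x = power_chain (s0 + h) j x.
Proof.
  induction j; simpl.
  - unfold exp_rem. simpl. replace (Cexp (- h * RtoC (ln x)) - 0)%C with (Cexp (- h * RtoC (ln x))) by ring.
    rewrite <- Cexp_plus. f_equal. ring.
  - rewrite IHj. ring.
Qed.

Lemma power_rem_step s0 h j : forall m x,
  (power_rem s0 h j m x - power_rem s0 h j (S m) x)%C = (power_coef s0 j m x * h ^ m)%C.
Proof.
  induction j; intros m x; simpl.
  - replace (Cexp ((1 - s0) * RtoC (ln x)) * exp_rem m (- h * RtoC (ln x)) - Cexp ((1 - s0) * RtoC (ln x)) * exp_rem (S m) (- h * RtoC (ln x)))%C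
      with (Cexp ((1 - s0) * RtoC (ln x)) * (exp_rem m (- h * RtoC (ln x)) - exp_rem (S m) (- h * RtoC (ln x))))%C by ring.
    rewrite exp_rem_step. replace (- h * RtoC (ln x))%C with (- RtoC (ln x) * h)%C by ring.
    rewrite Cpow_mult_l. ring.
  - destruct m as [|m].
    + simpl pred.
      transitivity ((1 - RtoC (INR j) - s0) * (power_rem s0 h j 0 x - power_rem s0 h j 1 x) * RtoC (/ x))%C; [ring|].
      rewrite IHj. simpl. ring.
    + simpl pred.
      transitivity (((1 - RtoC (INR j) - s0) * (power_rem s0 h j (S m) x - power_rem s0 h j (S (S m)) x)
         - h * (power_rem s0 h j m x - power_rem s0 h j (S m) x)) * RtoC (/ x))%C; [ring|].
      rewrite !IHj. rewrite (Cpow_S h m). ring.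
Qed.

Lemma dC_power_rem s0 h j : forall m x0 t, 0 < x0 + t ->
  dC (fun t => power_rem s0 h j m (x0 + t)%R) t (power_rem s0 h (S j) m (x0 + t)%R).
Proof.
  induction j; intros m x0 t Hx.
  - assert (Hl : dC (fun t => RtoC (ln (x0 + t))) t (RtoC (/ (x0 + t)))).
    { apply dC_RtoC. auto_derive; auto. field. lra. }
    simpl power_rem. eapply dC_eq.
    + apply dC_mult.
      * apply dC_Cexp. apply dC_scal. exact Hl.
      * apply dC_exp_rem. apply dC_scal. exact Hl.
    + cbv beta. simpl (INR 0). ring.
  - assert (Hi : dC (fun t => RtoC (/ (x0 + t))) t (RtoC (- (/ (x0 + t) * / (x0 + t))))).
    { apply dC_RtoC. auto_derive; [lra|]. field. lra. }
    change (fun t => power_rem s0 h (S j) m (x0 + t)%R) with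
      (fun t => (((1 - RtoC (INR j) - s0) * power_rem s0 h j m (x0 + t)%R - h * power_rem s0 h j (pred m) (x0 + t)%R) * RtoC (/ (x0 + t)))%C).
    eapply dC_eq.
    + apply dC_mult; [|exact Hi]. apply dC_minus; apply dC_scal; apply IHj; auto.
    + cbv beta.
      change (power_rem s0 h (S (S j)) m (x0 + t)) with
       (((1 - RtoC (INR (S j)) - s0) * power_rem s0 h (S j) m (x0 + t)%R - h * power_rem s0 h (S j) (pred m) (x0 + t)%R) * RtoC (/ (x0 + t)))%C.
      rewrite S_INR, RtoC_plus, RtoC_opp, RtoC_mult.

      set (Y := power_rem s0 h (S j) (pred m) (x0 + t)%R).
      assert (E : power_rem s0 h (S j) m (x0 + t)%R =
       (((1 - RtoC (INR j) - s0) * power_rem s0 h j m (x0 + t)%R - h * power_rem s0 h j (pred m) (x0 + t)%R) * RtoC (/ (x0 + t)))%C) by reflexivity.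
      set (X := power_rem s0 h (S j) m (x0 + t)%R) in *.
      transitivity (((1 - RtoC (INR j) - s0) * X - h * Y) * RtoC (/ (x0 + t)) -
        (((1 - RtoC (INR j) - s0) * power_rem s0 h j m (x0 + t)%R - h * power_rem s0 h j (pred m) (x0 + t)%R) * RtoC (/ (x0 + t))) * RtoC (/ (x0 + t)))%C; [ring|].
      rewrite <- E. ring.
Qed.

Fixpoint power_const (s0 : C) (rho : R) (j : nat) : R :=
  match j with O => 1 | S i => (Cmod (1 - RtoC (INR i) - s0)%C + rho) * power_const s0 rho i end.

Lemma power_const_pos s0 rho j : 0 <= rho -> 0 <= power_const s0 rho j.
Proof.
  intros Hr. induction j; simpl; [lra|]. apply Rmult_le_pos; auto.
  generalize (Cmod_ge_0 (1 - RtoC (INR j) - s0)%C); lra.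
Qed.

(** The factor (|h| ln x)^m / m! equals (|h|/rho)^m (rho ln x)^m / m!, and the last quotient is at
    most x^rho. Thus the bound is geometric in m at the price of a power x^(2 rho), half of it
    coming from the exponential in the remainder. *)
Lemma power_rem_bound (s0 h : C) (rho : R) j : 0 < rho -> Cmod h <= rho -> forall m x, 1 <= x ->
  Cmod (power_rem s0 h j m x) <=
    power_const s0 rho j * (Cmod h / rho) ^ m * exp ((1 - Re s0 - INR j + 2 * rho) * ln x).
Proof.
  intros Hr Hh. assert (Hh0 := Cmod_ge_0 h).
  assert (Hq : 0 <= Cmod h / rho) by (apply Rmult_le_pos; auto; left; apply Rinv_0_lt_compat; auto).
  induction j; intros m x Hx.
  - assert (Hl : 0 <= ln x) by (rewrite <- ln_1; destruct Hx as [Hx|<-]; [left; apply ln_increasing; lra|lra]).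
    simpl power_rem. rewrite Cmod_mult, Cmod_Cexp. simpl power_const. rewrite Rmult_1_l.
    assert (E : Re ((1 - s0) * RtoC (ln x))%C = (1 - Re s0) * ln x).
    { rewrite Re_mult, re_RtoC, im_RtoC, Re_minus. simpl (Re 1). ring. }
    rewrite E. simpl (INR 0).
    replace ((1 - Re s0 - 0 + 2 * rho) * ln x) with ((1 - Re s0) * ln x + (rho * ln x + rho * ln x)) by ring.
    rewrite !exp_plus.
    replace ((Cmod h / rho) ^ m * (exp ((1 - Re s0) * ln x) * (exp (rho * ln x) * exp (rho * ln x))))
      with (exp ((1 - Re s0) * ln x) * ((Cmod h / rho) ^ m * exp (rho * ln x) * exp (rho * ln x))) by ring.
    apply Rmult_le_compat_l; [left; apply exp_pos|].
    eapply Rle_trans; [apply exp_Taylor|].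
    rewrite Cmod_mult, Cmod_opp, Cmod_RtoC_pos by auto.
    apply Rmult_le_compat; [| left; apply exp_pos | | apply exp_le_compat, Rmult_le_compat_r; auto].
    + apply Rmult_le_pos; [apply pow_le, Rmult_le_pos; auto|left; apply Rinv_0_lt_compat, INR_fact_lt_0].
    + replace (Cmod h * ln x) with (Cmod h / rho * (rho * ln x)) by (field; lra).
      rewrite Rpow_mult_distr. unfold Rdiv at 1. rewrite Rmult_assoc.
      apply Rmult_le_compat_l; [apply pow_le; auto|]. apply pow_fact_le_exp. apply Rmult_le_pos; lra.
  - simpl power_rem. rewrite Cmod_mult, Cmod_RtoC_pos by (left; apply Rinv_0_lt_compat; lra). assert (H2 := IHj (pred m) x Hx).
    set (e := exp ((1 - Re s0 - INR j + 2 * rho) * ln x)) in *.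
    assert (He : exp ((1 - Re s0 - INR (S j) + 2 * rho) * ln x) = e * / x).
    { rewrite S_INR. replace ((1 - Re s0 - (INR j + 1) + 2 * rho) * ln x) with ((1 - Re s0 - INR j + 2 * rho) * ln x + - ln x) by ring.
      rewrite exp_plus, exp_Ropp, exp_ln by lra. reflexivity. }
    rewrite He. rewrite <- Rmult_assoc. apply Rmult_le_compat_r; [left; apply Rinv_0_lt_compat; lra|].
    eapply Rle_trans; [apply Cmod_minus_triangle|]. rewrite !Cmod_mult. simpl power_const.
    set (a := Cmod (1 - RtoC (INR j) - s0)%C). assert (Ha : 0 <= a) by apply Cmod_ge_0.
    assert (Hc := power_const_pos s0 rho j (Rlt_le _ _ Hr)). assert (He0 := exp_pos ((1 - Re s0 - INR j + 2 * rho) * ln x)). fold e in He0.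
    assert (H3 : Cmod h * Cmod (power_rem s0 h j (pred m) x) <= rho * (power_const s0 rho j * (Cmod h / rho) ^ m * e)).
    { eapply Rle_trans; [apply Rmult_le_compat_l; [auto|exact H2]|].
      destruct m as [|m]; simpl pred.
      - apply Rmult_le_compat_r; auto. simpl. rewrite Rmult_1_r. apply Rmult_le_pos; lra.
      - right. simpl. field. lra. }
    assert (H4 : a * Cmod (power_rem s0 h j m x) <= a * (power_const s0 rho j * (Cmod h / rho) ^ m * e))
      by (apply Rmult_le_compat_l; auto).
    replace ((a + rho) * power_const s0 rho j * (Cmod h / rho) ^ m * e) with
      (a * (power_const s0 rho j * (Cmod h / rho) ^ m * e) + rho * (power_const s0 rho j * (Cmod h / rho) ^ m * e)) by ring.
    lra.
Qed.

(** Sum of the summand [f 1] minus the boundary terms at the upper end only, so that the limit is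
    the constant of the summation formula. The five terms j <= 4 give convergence for Re s >= -1. *)
Definition EM_partial (f : nat -> R -> C) (n : nat) : C :=
  (Csum (fun k => f 1%nat (1 + INR k)%R) n - Csum (fun j => RtoC (beta j) * f j (1 + INR n)%R) 5)%C.

Lemma EM_partial_minus f g n : EM_partial (fun j x => f j x - g j x)%C n = (EM_partial f n - EM_partial g n)%C.
Proof.
  unfold EM_partial. rewrite Csum_minus.
  rewrite (Csum_ext (fun j => RtoC (beta j) * (f j (1 + INR n)%R - g j (1 + INR n)%R))%C
    (fun j => RtoC (beta j) * f j (1 + INR n)%R - RtoC (beta j) * g j (1 + INR n)%R)%C) by (intros; ring).
  rewrite Csum_minus. ring.
Qed.

Lemma EM_partial_scal c f n : EM_partial (fun j x => c * f j x)%C n = (c * EM_partial f n)%C.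
Proof.
  unfold EM_partial. rewrite Csum_scal.
  rewrite (Csum_ext (fun j => RtoC (beta j) * (c * f j (1 + INR n)%R))%C
    (fun j => c * (RtoC (beta j) * f j (1 + INR n)%R))%C) by (intros; ring).
  rewrite Csum_scal. ring.
Qed.

Lemma EM_partial_ext f g n : (forall j x, f j x = g j x) -> EM_partial f n = EM_partial g n.
Proof.
  intros H. unfold EM_partial.
  rewrite (Csum_ext (fun k => f 1%nat (1 + INR k)%R) (fun k => g 1%nat (1 + INR k)%R)) by auto.
  rewrite (Csum_ext (fun j => RtoC (beta j) * f j (1 + INR n)%R)%C (fun j => RtoC (beta j) * g j (1 + INR n)%R)%C);
    [reflexivity|]. intros; rewrite H; reflexivity.
Qed.

(** The geometric bound on the terms passes to the limit with a constant independent of m. Its two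
    parts come from the summed one-step errors and from the initial value at x = 1. *)
Lemma EM_partial_cvg (s0 h : C) (rho : R) m : 0 < rho <= 1 / 4 -> Cmod h <= rho -> -1 <= Re s0 ->
  exists l, Clim (EM_partial (fun j => power_rem s0 h j m)) l /\
   Cmod l <= (2 * EM_const 4 * power_const s0 rho 5 + Rsum (fun j => Rabs (beta j) * power_const s0 rho j) 5) * (Cmod h / rho) ^ m.
Proof.
  intros Hr Hh Hs.
  set (q := (Cmod h / rho) ^ m).
  assert (Hq : 0 <= q).
  { apply pow_le, Rmult_le_pos; [apply Cmod_ge_0|left; apply Rinv_0_lt_compat; lra]. }
  set (f := fun j => power_rem s0 h j m).
  set (A := EM_const 4 * (power_const s0 rho 5 * q)).
  assert (HA : 0 <= A).
  { apply Rmult_le_pos; [apply EM_const_pos|apply Rmult_le_pos; [apply (power_const_pos s0 rho 5); lra|exact Hq]]. }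
  set (e := fun n => (EM_partial f (S n) - EM_partial f n)%C).
  assert (He : forall n, Cmod (e n) <= A * (2 * / (1 + INR n)) - A * (2 * / (1 + INR (S n)))).
  { intros n. set (x := 1 + INR n). assert (Hx : 1 <= x) by (unfold x; generalize (pos_INR n); lra).
    assert (H := Euler_Maclaurin 4 (fun j t => f j (x + t)) (power_const s0 rho 5 * q * / (x * x)) ltac:(lia)).
    spec H. 2: spec H.
    - intros j t Ht. apply dC_power_rem. lra.
    - intros t Ht. eapply Rle_trans; [apply power_rem_bound with (rho := rho); lra|].
      fold q. apply Rmult_le_compat_l; [apply Rmult_le_pos; auto; apply (power_const_pos s0 rho 5); lra|].
      assert (Hl : 0 <= ln x) by (rewrite <- ln_1; destruct Hx as [Hx|<-]; [left; apply ln_increasing; lra|lra]).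
      assert (Hl2 : ln x <= ln (x + t)) by (destruct (proj1 Ht) as [Ht0|<-]; [left; apply ln_increasing; lra|rewrite Rplus_0_r; lra]).
      apply Rle_trans with (exp (- (ln x + ln x))).
      + apply exp_le_compat. simpl INR. nra.
      + rewrite exp_Ropp, exp_plus, exp_ln by lra. lra.
    - replace (e n) with (- (Csum (fun j => RtoC (beta j) * (f j (x + 1)%R - f j (x + 0)%R)) 5 - f 1%nat (x + 0)%R))%C.
      + rewrite Cmod_opp. eapply Rle_trans; [exact H|].
        replace (1 + INR (S n)) with (x + 1) by (unfold x; rewrite S_INR; ring). fold x.
        replace (EM_const 4 * (power_const s0 rho 5 * q * / (x * x))) with (A * / (x * x)) by (unfold A; ring).
        replace (A * (2 * / x) - A * (2 * / (x + 1))) with (A * (2 / x - 2 / (x + 1))) by (unfold Rdiv; ring).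
        apply Rmult_le_compat_l; auto. apply inv_sqr_telescope; auto.
      + unfold e, EM_partial. rewrite (Csum_S _ n).
        rewrite (Csum_ext (fun j => RtoC (beta j) * (f j (x + 1)%R - f j (x + 0)%R))%C
          (fun j => RtoC (beta j) * f j (1 + INR (S n))%R - RtoC (beta j) * f j (1 + INR n)%R)%C).
        * rewrite Csum_minus. fold x. rewrite Rplus_0_r. ring.
        * intros k _. fold x. replace (x + 1) with (1 + INR (S n)) by (unfold x; rewrite S_INR; ring).
          rewrite Rplus_0_r. ring. }
  destruct (Csum_cvg_telescope e (fun n => A * (2 * / (1 + INR n))) He) as [l [Hl Hb]].
  { replace (Finite 0) with (Finite (A * (2 * 0))) by (f_equal; ring).
    apply is_lim_seq_mult'; [apply is_lim_seq_const|]. apply is_lim_seq_mult'; [apply is_lim_seq_const|].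
    apply is_lim_seq_inv_INR. }
  exists (l + EM_partial f 0)%C. split.
  - eapply Clim_ext; [|apply Clim_plus; [exact Hl|apply (Clim_const (EM_partial f 0))]].
    intros n. cbv beta. unfold e. rewrite Csum_telescope. ring.
  - specialize (Hb 0%nat). simpl Csum in Hb. replace (l - 0)%C with l in Hb by ring.
    eapply Rle_trans; [apply Cmod_triangle|]. rewrite Rmult_plus_distr_r. apply Rplus_le_compat.
    + eapply Rle_trans; [exact Hb|]. right. unfold A. simpl (INR 0). field.
    + unfold EM_partial. change (Csum (fun k => f 1%nat (1 + INR k)) 0) with (RtoC 0).
      unfold Cminus. rewrite Cplus_0_l, Cmod_opp. rewrite Rmult_comm, <- Rsum_scal.
      apply Csum_Cmod. intros k _. rewrite Cmod_mult, Cmod_R.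
      replace (q * (Rabs (beta k) * power_const s0 rho k)) with (Rabs (beta k) * (power_const s0 rho k * q * exp ((1 - Re s0 - INR k + 2 * rho) * ln 1))).
      * apply Rmult_le_compat_l; [apply Rabs_pos|]. simpl (INR 0). rewrite Rplus_0_r.
        apply power_rem_bound; lra.
      * rewrite ln_1, Rmult_0_r, exp_0. ring.
Qed.

(* A form of analyticity at s0 that passes to locally uniform limits without Cauchy's formula. *)
Definition has_expansion (f : C -> C) (s0 : C) (c : nat -> C) (M rho : R) : Prop :=
  0 < rho /\ 0 <= M /\
  forall h : C, Cmod h < rho -> forall m,
    Cmod (f (s0 + h) - Csum (fun k => c k * h ^ k) m)%C <= M * (Cmod h / rho) ^ m.

Lemma ratio_pos (h : C) rho : 0 < rho -> 0 <= Cmod h / rho.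
Proof. intros H. apply Rmult_le_pos; [apply Cmod_ge_0|left; apply Rinv_0_lt_compat; auto]. Qed.

Lemma has_expansion_shrink f s0 c M rho rho' :
  0 < rho' <= rho -> has_expansion f s0 c M rho -> has_expansion f s0 c M rho'.
Proof.
  intros Hr [_ [HM H]]. split; [lra|split; auto]. intros h Hh m.
  eapply Rle_trans; [apply H; lra|]. apply Rmult_le_compat_l; auto.
  apply pow_incr. split; [apply ratio_pos; lra|].
  apply Rmult_le_compat_l; [apply Cmod_ge_0|]. apply Rinv_le_contravar; lra.
Qed.

Lemma has_expansion_minus f g s0 c d M M' rho :
  has_expansion f s0 c M rho -> has_expansion g s0 d M' rho ->
  has_expansion (fun s => f s - g s)%C s0 (fun k => c k - d k)%C (M + M') rho.
Proof.
  intros [Hr [HM H]] [_ [HM' H']]. split; [auto|split; [lra|]]. intros h Hh m.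
  rewrite (Csum_ext (fun k => (c k - d k) * h ^ k)%C (fun k => c k * h ^ k - d k * h ^ k)%C) by (intros; ring).
  rewrite Csum_minus.
  match goal with |- Cmod ?e <= _ => replace e with
   ((f (s0 + h) - Csum (fun k => c k * h ^ k) m) - (g (s0 + h) - Csum (fun k => d k * h ^ k) m))%C by ring end.
  eapply Rle_trans; [apply Cmod_minus_triangle|]. rewrite Rmult_plus_distr_r.
  apply Rplus_le_compat; auto.
Qed.

Lemma has_expansion_linear f s0 c M rho :
  has_expansion f s0 c M rho ->
  has_expansion (fun s => (1 - s) * f s)%C s0
    (fun k => (1 - s0) * c k - match k with O => 0 | S l => c l end)%C
    ((Cmod (1 - s0) + rho) * M) rho.
Proof.
  intros [Hr [HM H]]. assert (H0 := Cmod_ge_0 (1 - s0)%C).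
  split; [auto|split; [apply Rmult_le_pos; lra|]]. intros h Hh m.
  assert (E : forall m, Csum (fun k => ((1 - s0) * c k - match k with O => 0 | S l => c l end) * h ^ k)%C m
    = ((1 - s0) * Csum (fun k => c k * h ^ k) m - h * Csum (fun k => c k * h ^ k) (pred m))%C).
  { intros i. induction i; [simpl; ring|]. rewrite Csum_S, IHi. destruct i as [|i]; [simpl; ring|].
    simpl pred. rewrite (Csum_S _ (S i)), (Csum_S _ i), (Cpow_S h i). ring. }
  rewrite E.
  match goal with |- Cmod ?e <= _ => replace e with
   ((1 - s0) * (f (s0 + h) - Csum (fun k => c k * h ^ k) m) - h * (f (s0 + h) - Csum (fun k => c k * h ^ k) (pred m)))%C by ring end.
  eapply Rle_trans; [apply Cmod_minus_triangle|]. rewrite !Cmod_mult.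
  replace ((Cmod (1 - s0) + rho) * M * (Cmod h / rho) ^ m) with
    (Cmod (1 - s0)%C * (M * (Cmod h / rho) ^ m) + rho * (M * (Cmod h / rho) ^ m)) by ring.
  apply Rplus_le_compat; [apply Rmult_le_compat_l; auto|].
  eapply Rle_trans; [apply Rmult_le_compat_l; [apply Cmod_ge_0|apply H; auto]|]. destruct m as [|m]; simpl.
  - apply Rmult_le_compat_r; lra.
  - right. field. lra.
Qed.

(** Identity theorem. Near s0 the first nonzero term would dominate the error of the next order and
    exclude small zeros; once all coefficients vanish, the bound tends to 0 with the order. *)
Lemma has_expansion_isolated f s0 c M rho : has_expansion f s0 c M rho ->
  (forall eps, 0 < eps -> exists h : C, 0 < Cmod h < eps /\ f (s0 + h)%C = 0%C) ->
  (forall k, c k = 0%C) /\ forall h, Cmod h < rho -> f (s0 + h)%C = 0%C.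
Proof.
  intros [Hr [HM H]] Hz.
  assert (Hc : forall k, c k = 0%C).
  { intros k. induction k as [k IH] using Wf_nat.lt_wf_ind.
    apply Cmod_eq_0. destruct (Req_dec (Cmod (c k)) 0) as [E|E]; auto. exfalso.
    assert (Hck : 0 < Cmod (c k)) by (generalize (Cmod_ge_0 (c k)); lra).
    assert (HrS : 0 < rho ^ S k) by (apply pow_lt; auto).
    (* Below this radius |c_k h^k| exceeds the error M (|h|/rho)^(k+1). *)
    assert (He : 0 < Rmin rho (Cmod (c k) * rho ^ S k / (M + 1))).
    { apply Rmin_pos; auto. apply Rdiv_lt_0_compat; [apply Rmult_lt_0_compat; auto|lra]. }
    destruct (Hz _ He) as [h [[Hh0 Hh] Hf]].
    assert (Hh1 := Rlt_le_trans _ _ _ Hh (Rmin_l _ _)). assert (Hh2 := Rlt_le_trans _ _ _ Hh (Rmin_r _ _)).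
    specialize (H h Hh1 (S k)). rewrite Hf, Csum_S, Csum_zero in H.
    2:{ intros i Hi. rewrite IH by auto. ring. }
    replace (0 - (0 + c k * h ^ k))%C with (- (c k * h ^ k))%C in H by ring.
    rewrite Cmod_opp, Cmod_mult, Cmod_pow in H.
    assert (Hhk : 0 < Cmod h ^ k) by (apply pow_lt; auto).
    assert (H3 : Cmod (c k) <= M * Cmod h / rho ^ S k).
    { apply Rmult_le_reg_r with (Cmod h ^ k); auto. eapply Rle_trans; [exact H|]. right.
      unfold Rdiv. rewrite Rpow_mult_distr, pow_inv. simpl. field. split; [apply pow_nonzero|]; lra. }
    assert (H4 : Cmod h * (M + 1) < Cmod (c k) * rho ^ S k).
    { apply Rmult_lt_reg_r with (/ (M + 1)); [apply Rinv_0_lt_compat; lra|].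
      rewrite Rmult_assoc, Rinv_r by lra. unfold Rdiv in Hh2. lra. }
    assert (H5 : Cmod (c k) * rho ^ S k <= M * Cmod h).
    { apply Rmult_le_reg_r with (/ rho ^ S k); [apply Rinv_0_lt_compat; auto|].
      rewrite Rmult_assoc, Rinv_r by lra. unfold Rdiv in H3. lra. }
    nra. }
  split; auto. intros h Hh.
  apply Cmod_eq_0. apply Rle_antisym; [|apply Cmod_ge_0].
  assert (Hle : forall m, Cmod (f (s0 + h)%C) <= M * (Cmod h / rho) ^ m).
  { intros m. specialize (H h Hh m). rewrite Csum_zero in H.
    - replace (f (s0 + h) - 0)%C with (f (s0 + h)%C) in H by ring. exact H.
    - intros k _. rewrite Hc. ring. }
  apply (is_lim_seq_le (fun _ => Cmod (f (s0 + h)%C)) (fun m => M * (Cmod h / rho) ^ m) (Cmod (f (s0 + h)%C)) 0); auto.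
  - apply is_lim_seq_const.
  - replace (Finite 0) with (Finite (M * 0)) by (f_equal; ring).
    apply is_lim_seq_mult'; [apply is_lim_seq_const|]. apply is_lim_seq_geom.
    rewrite Rabs_pos_eq by (apply ratio_pos; auto).
    apply Rmult_lt_reg_r with rho; auto. unfold Rdiv. rewrite Rmult_assoc, Rinv_l; lra.
Qed.

Lemma is_series_Clim (u : nat -> C) (l : C) :
  is_series (K := C_AbsRing) (V := C_NormedModule) u l -> Clim (Csum u) l.
Proof.
  intros H. apply Clim_incr_1. unfold is_series in H.
  assert (H1 : filterlim (fun n => Csum u (S n)) eventually (locally l)).
  { eapply filterlim_ext; [|exact H]. intros n. apply sum_n_Csum. }
  split.
  - apply (filterlim_comp _ _ _ (fun n => Csum u (S n)) (fst (A := R) (B := R)) eventually (locally l) (locally (fst l))); auto.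
    destruct l. apply continuous_fst.
  - apply (filterlim_comp _ _ _ (fun n => Csum u (S n)) (snd (A := R) (B := R)) eventually (locally l) (locally (snd l))); auto.
    destruct l. apply continuous_snd.
Qed.

Lemma is_lim_seq_bounded (u : nat -> R) (l : R) : is_lim_seq u l -> exists M, forall n, Rabs (u n) <= M.
Proof.
  intros H. apply is_lim_seq_Reals in H.
  destruct (maj_by_pos u (exist _ l H)) as [M [_ HM]]. exists M. auto.
Qed.

(** Convergence at one point bounds the terms there, and inside a smaller disc the tail is dominated
    by a geometric series. *)
Lemma analytic_at_has_expansion f s0 : analytic_at f s0 -> exists c M rho, has_expansion f s0 c M rho.
Proof.
  intros [a [rho [Hr H]]].
  assert (Hs : forall h, Cmod h < rho -> Clim (Csum (fun k => a k * h ^ k)%C) (f (s0 + h)%C)).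
  { intros h Hh. specialize (H h Hh). apply is_series_Clim in H.
    eapply Clim_ext; [|exact H]. intros n. apply Csum_ext. intros k _.
    assert (E : forall n, @pow_n C_AbsRing h n = (h ^ n)%C).
    { intros i. induction i; simpl; [reflexivity|]. rewrite IHi. reflexivity. }
    rewrite E. unfold scal; simpl. unfold mult; simpl. apply Cmult_comm. }
  set (r := 3 / 4 * rho).
  assert (Hb : exists B, 0 <= B /\ forall k, Cmod (a k) * r ^ k <= B).
  { assert (Hc := Hs (RtoC r) ltac:(rewrite Cmod_RtoC_pos; unfold r; lra)).
    assert (Hd := Clim_minus _ _ _ _ (proj2 (Clim_incr_1 _ _) Hc) Hc).
    apply Clim_Cmod in Hd. destruct (is_lim_seq_bounded _ _ Hd) as [B HB].
    exists B. split; [eapply Rle_trans; [apply Rabs_pos|apply (HB 0%nat)]|].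
    intros k. specialize (HB k). rewrite Rabs_pos_eq in HB by apply Cmod_ge_0.
    rewrite Csum_S in HB.
    replace (Csum (fun k => a k * RtoC r ^ k) k + a k * RtoC r ^ k - Csum (fun k => a k * RtoC r ^ k) k)%C
      with (a k * RtoC r ^ k)%C in HB by ring.
    rewrite Cmod_mult, Cmod_pow, Cmod_RtoC_pos in HB by (unfold r; lra). exact HB. }
  destruct Hb as [B [HB0 HB]].
  (* The terms are bounded at 3/4 rho, so radius rho/2 gives ratio at most 2/3, and 3 is the sum of
     the geometric series with that ratio. *)
  exists a, (3 * B), (rho / 2). split; [lra|split; [lra|]]. intros h Hh m.
  set (q := Cmod h / r).
  assert (Hq0 : 0 <= q) by (apply ratio_pos; unfold r; lra).
  assert (Hq : q <= 2 / 3).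
  { unfold q. apply Rmult_le_reg_r with r; [unfold r; lra|]. unfold Rdiv at 1. rewrite Rmult_assoc, Rinv_l; unfold r in *; lra. }
  assert (Hterm : forall k, Cmod (a k * h ^ k)%C <= B * q ^ k).
  { intros k. rewrite Cmod_mult, Cmod_pow. replace (Cmod h) with (r * q) by (unfold q; field; unfold r; lra).
    rewrite Rpow_mult_distr, <- Rmult_assoc. apply Rmult_le_compat_r; [apply pow_le; auto|]. apply HB. }
  apply Rle_trans with (3 * B * q ^ m).
  - apply (Clim_Cmod_le (fun n => Csum (fun k => a k * h ^ k) n - Csum (fun k => a k * h ^ k) m)%C _ _ m).
    + apply Clim_minus; [apply Hs; lra|apply Clim_const].
    + intros n Hn. replace n with (m + (n - m))%nat by lia. rewrite Csum_split.
      match goal with |- Cmod ?e <= _ => replace e with (Csum (fun k => a (m + k)%nat * h ^ (m + k))%C (n - m)) by ring end.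
      eapply Rle_trans; [apply Csum_Cmod; intros k _; apply Hterm|].
      assert (Hg : forall i, Rsum (fun k => B * q ^ (m + k)) i <= 3 * B * q ^ m - 3 * B * q ^ (m + i)).
      { intros i. induction i; [rewrite Nat.add_0_r; simpl; lra|]. rewrite Rsum_S.
        rewrite Nat.add_succ_r. simpl. assert (0 <= B * q ^ (m + i)) by (apply Rmult_le_pos; auto; apply pow_le; auto).
        nra. }
      specialize (Hg (n - m)%nat). assert (0 <= B * q ^ (m + (n - m))) by (apply Rmult_le_pos; auto; apply pow_le; auto). lra.
  - apply Rmult_le_compat_l; [lra|]. apply pow_incr. split; auto.
    unfold q. apply Rmult_le_compat_l; [apply Cmod_ge_0|]. apply Rinv_le_contravar; unfold r; lra.
Qed.

(** * The summation constant as continuation of (1-s) zeta(s) *)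

Definition zeta_EM (s : C) : C := Clim_seq (EM_partial (power_chain s)).

Lemma EM_partial_step s0 h m n :
  (EM_partial (fun j => power_rem s0 h j m) n - EM_partial (fun j => power_rem s0 h j (S m)) n)%C
  = (EM_partial (fun j => power_coef s0 j m) n * h ^ m)%C.
Proof.
  rewrite <- (EM_partial_minus (fun j => power_rem s0 h j m) (fun j => power_rem s0 h j (S m))).
  rewrite Cmult_comm, <- EM_partial_scal. apply EM_partial_ext. intros j x.
  rewrite power_rem_step. ring.
Qed.

Definition zeta_EM_coef (s0 : C) (k : nat) : C := Clim_seq (EM_partial (fun j => power_coef s0 j k)).

(** At a single nonzero h, here 1/4, the coefficient is the difference of two convergent successive
    remainders divided by h^k. *)
Lemma zeta_EM_coef_cvg s0 k : -1 <= Re s0 -> Clim (EM_partial (fun j => power_coef s0 j k)) (zeta_EM_coef s0 k).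
Proof.
  intros Hs.
  assert (Hex : exists l, Clim (EM_partial (fun j => power_coef s0 j k)) l).
  { set (h := RtoC (1 / 4)).
    assert (Hh : Cmod h <= 1 / 4) by (unfold h; rewrite Cmod_RtoC_pos; lra).
    destruct (EM_partial_cvg s0 h (1 / 4) k ltac:(lra) Hh Hs) as [l [Hl _]].
    destruct (EM_partial_cvg s0 h (1 / 4) (S k) ltac:(lra) Hh Hs) as [l' [Hl' _]].
    exists ((l - l') * / h ^ k)%C.
    eapply Clim_ext; [|apply Clim_mult; [apply Clim_minus; [exact Hl|exact Hl']|apply Clim_const]].
    intros n. cbv beta. rewrite EM_partial_step. field. apply Cpow_nz.
    unfold h. intros E. apply RtoC_inj in E. lra. }
  destruct Hex as [l Hl]. unfold zeta_EM_coef. rewrite (Clim_seq_eq _ _ Hl). exact Hl.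
Qed.

(** For finite n the remainder of order m is the function minus its Taylor polynomial; both
    converge, and the bound on the remainder is uniform in n. *)
Lemma zeta_EM_has_expansion s0 : -1 <= Re s0 ->
  exists M rho, has_expansion zeta_EM s0 (zeta_EM_coef s0) M rho /\
    forall h, Cmod h < rho -> Clim (EM_partial (power_chain (s0 + h))) (zeta_EM (s0 + h)).
Proof.
  intros Hs.
  assert (Hcv : forall h, Cmod h < 1 / 4 -> Clim (EM_partial (power_chain (s0 + h))) (zeta_EM (s0 + h))).
  { intros h Hh. destruct (EM_partial_cvg s0 h (1 / 4) 0 ltac:(lra) (Rlt_le _ _ Hh) Hs) as [l [Hl _]].
    assert (H : Clim (EM_partial (power_chain (s0 + h))) l).
    { eapply Clim_ext; [|exact Hl]. intros n. apply EM_partial_ext. intros j x. apply power_rem_0. }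
    unfold zeta_EM. rewrite (Clim_seq_eq _ _ H). exact H. }
  set (M := 2 * EM_const 4 * power_const s0 (1 / 4) 5 + Rsum (fun j => Rabs (beta j) * power_const s0 (1 / 4) j) 5).
  exists M, (1 / 4). split; auto. split; [lra|split].
  { unfold M. apply Rplus_le_le_0_compat.
    - apply Rmult_le_pos; [generalize (EM_const_pos 4); lra|apply (power_const_pos s0 (1/4) 5); lra].
    - apply Rsum_pos. intros k _. apply Rmult_le_pos; [apply Rabs_pos|apply power_const_pos; lra]. }
  intros h Hh m.
  destruct (EM_partial_cvg s0 h (1 / 4) m ltac:(lra) (Rlt_le _ _ Hh) Hs) as [l [Hl Hb]].
  fold M in Hb. replace (zeta_EM (s0 + h) - Csum (fun k => zeta_EM_coef s0 k * h ^ k) m)%C with l; auto.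
  apply (Clim_unique _ _ _ Hl).
  eapply Clim_ext.
  2:{ apply Clim_minus; [apply (Hcv h Hh)|].
      apply (Clim_Csum (fun k n => EM_partial (fun j => power_coef s0 j k) n * h ^ k)%C).
      intros k _. apply Clim_mult; [apply zeta_EM_coef_cvg; auto|apply Clim_const]. }
  intros n. cbv beta. clear. induction m.
  - simpl Csum. rewrite (EM_partial_ext (fun j => power_rem s0 h j 0) (power_chain (s0 + h))).
    + ring.
    + intros j x. apply power_rem_0.
  - rewrite Csum_S, <- EM_partial_step.
    transitivity (EM_partial (power_chain (s0 + h)) n
       - Csum (fun k => EM_partial (fun j => power_coef s0 j k) n * h ^ k) m
       - (EM_partial (fun j => power_rem s0 h j m) n - EM_partial (fun j => power_rem s0 h j (S m)) n))%C; [ring|].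
    rewrite IHm. ring.
Qed.

Lemma power_chain_Cmod s j : exists A, forall x, 1 <= x ->
  Cmod (power_chain s j x) <= A * exp ((1 - Re s) * ln x).
Proof.
  induction j as [|j [A HA]].
  - exists 1. intros x Hx. simpl. rewrite Cmod_Cexp, Rmult_1_l, Re_mult, re_RtoC, im_RtoC, Re_minus. right.
    f_equal. simpl (Re 1). ring.
  - exists (Cmod (1 - RtoC (INR j) - s)%C * A). intros x Hx. simpl. rewrite !Cmod_mult.
    rewrite Cmod_RtoC_pos by (left; apply Rinv_0_lt_compat; lra).
    specialize (HA x Hx). set (e := exp ((1 - Re s) * ln x)) in *.
    assert (Hx1 : / x <= 1) by (rewrite <- Rinv_1; apply Rinv_le_contravar; lra).
    assert (Hx0 : 0 < / x) by (apply Rinv_0_lt_compat; lra).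
    assert (H0 := Cmod_ge_0 (1 - RtoC (INR j) - s)%C). assert (H1 := Cmod_ge_0 (power_chain s j x)).
    rewrite Rmult_assoc, Rmult_assoc. apply Rmult_le_compat_l; auto.
    apply Rle_trans with (Cmod (power_chain s j x) * 1); [apply Rmult_le_compat_l; lra|lra].
Qed.

(** For Re s > 1 all boundary terms tend to 0 and only the Dirichlet series is left. *)
Lemma zeta_EM_zeta zeta s : is_Riemann_zeta zeta -> 1 < Re s -> zeta_EM s = ((1 - s) * zeta s)%C.
Proof.
  intros [_ Hz] Hs. specialize (Hz s Hs). apply is_series_Clim in Hz.
  apply Clim_seq_eq. unfold EM_partial.
  replace ((1 - s) * zeta s)%C with ((1 - s) * zeta s - Csum (fun j => RtoC (beta j) * 0)%C 5)%C.
  2:{ rewrite Csum_zero; [ring|]. intros; ring. }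
  apply Clim_minus.
  - eapply Clim_ext; [|apply Clim_mult; [apply (Clim_const (1 - s)%C)|exact Hz]].
    intros n. cbv beta. rewrite <- Csum_scal. apply Csum_ext. intros k _.
    unfold Cpower. rewrite Clog_INR_S. simpl power_chain. rewrite (Rplus_comm 1), <- S_INR.
    assert (Hk := INR_S_pos k).
    replace ((1 - s) * RtoC (ln (INR (S k))))%C with (RtoC (ln (INR (S k))) + - s * RtoC (ln (INR (S k))))%C by ring.
    rewrite Cexp_plus, Cexp_RtoC, exp_ln, RtoC_inv by lra. simpl (INR 0). field. apply RtoC_INR_S_nz.
  - apply Clim_Csum. intros j _. apply Clim_mult; [apply Clim_const|].
    destruct (power_chain_Cmod s j) as [A HA].
    apply (Clim_squeeze _ _ (fun n => A * exp ((1 - Re s) * ln (1 + INR n))) 0).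
    + intros n _. replace (power_chain s j (1 + INR n) - 0)%C with (power_chain s j (1 + INR n)) by ring.
      apply HA. generalize (pos_INR n); lra.
    + replace (Finite 0) with (Finite (A * 0)) by (f_equal; ring).
      apply is_lim_seq_mult'; [apply is_lim_seq_const|].
      apply (is_lim_comp_seq exp (fun n => (1 - Re s) * ln (1 + INR n)) m_infty 0).
      * apply is_lim_exp_m.
      * exists 0%nat. intros; discriminate.
      * assert (Hln : is_lim_seq (fun n => ln (1 + INR n)) p_infty).
        { apply (is_lim_comp_seq ln (fun n => 1 + INR n) p_infty p_infty).
          - apply is_lim_ln_p.
          - exists 0%nat. intros; discriminate.
          - apply is_lim_seq_ext with (fun n => INR (S n)); [intros; rewrite S_INR; ring|].
            apply -> is_lim_seq_incr_1. apply is_lim_seq_INR. }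
        assert (Hm := is_lim_seq_scal_l _ (1 - Re s) _ Hln).
        replace (Rbar_mult (1 - Re s) p_infty) with m_infty in Hm; auto.
        symmetry. apply is_Rbar_mult_unique. apply is_Rbar_mult_sym, is_Rbar_mult_p_infty_neg. simpl; lra.
Qed.

(** Continuation by the supremum T of the times up to which f vanishes on the path. Points just
    before T are zeros distinct from [g T], by injectivity, and accumulate there; the identity
    theorem then carries the vanishing past T. *)
Lemma zero_along_path (f : C -> C) (g : R -> C) (lip t0 : R) :
  0 < lip -> 0 < t0 <= 1 ->
  (forall t, 0 <= t <= 1 -> exists c M rho, has_expansion f (g t) c M rho) ->
  (forall s t, 0 <= s <= 1 -> 0 <= t <= 1 -> s <> t -> 0 < Cmod (g s - g t)%C <= lip * Rabs (s - t)) ->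
  (forall t, 0 <= t <= t0 -> f (g t) = 0%C) ->
  forall t, 0 <= t <= 1 -> f (g t) = 0%C.
Proof.
  intros Hlip Ht0 Hf Hg Hz.
  set (E := fun t => 0 <= t <= 1 /\ forall s, 0 <= s <= t -> f (g s) = 0%C).
  assert (HE0 : E t0) by (split; [lra|auto]).
  destruct (completeness E) as [T [HT1 HT2]].
  { exists 1. intros t [Ht _]; lra. }
  { exists t0; auto. }
  assert (HTt0 : t0 <= T) by (apply HT1; auto).
  assert (HTle : T <= 1) by (apply HT2; intros t [Ht _]; lra).
  assert (Hbelow : forall s, 0 <= s < T -> f (g s) = 0%C).
  { intros s Hs. destruct (Req_dec (Cmod (f (g s))) 0) as [E0|E0]; [apply Cmod_eq_0; auto|].
    exfalso. assert (T <= s); [|lra]. apply HT2. intros t [Ht Ht'].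
    destruct (Rle_dec t s) as [Hle|Hle]; auto. exfalso. apply E0. rewrite Ht' by lra. apply Cmod_0. }
  destruct (Hf T ltac:(lra)) as [c [M [rho Hexp]]].
  assert (Hrho : 0 < rho) by apply Hexp.
  destruct (has_expansion_isolated _ _ _ _ _ Hexp) as [_ Hloc].
  { intros eps Heps.
    assert (Hd : 0 < Rmin (T / 2) (eps / (2 * lip))).
    { apply Rmin_pos; [lra|]. apply Rdiv_lt_0_compat; lra. }
    set (d := Rmin (T / 2) (eps / (2 * lip))) in *.
    assert (Hd1 : d <= T / 2) by apply Rmin_l. assert (Hd2 : d <= eps / (2 * lip)) by apply Rmin_r.
    exists (g (T - d)%R - g T)%C. split.
    - destruct (Hg (T - d) T) as [H1 H2]; try lra. split; auto.
      eapply Rle_lt_trans; [exact H2|]. replace (T - d - T) with (- d) by ring.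
      rewrite Rabs_Ropp, Rabs_pos_eq by lra.
      apply Rle_lt_trans with (lip * (eps / (2 * lip))); [apply Rmult_le_compat_l; lra|].
      replace (lip * (eps / (2 * lip))) with (eps / 2) by (field; lra). lra.
    - replace (g T + (g (T - d)%R - g T))%C with (g (T - d)) by ring. apply Hbelow. lra. }
  assert (Hnear : forall s, T <= s <= 1 -> s - T <= rho / (2 * lip) -> f (g s) = 0%C).
  { intros s Hs Hs2. replace (g s) with (g T + (g s - g T))%C by ring. apply Hloc.
    destruct (Req_dec s T) as [->|Hne].
    - replace (g T - g T)%C with (RtoC 0) by ring. rewrite Cmod_0; auto.
    - destruct (Hg s T) as [_ H2]; try lra. eapply Rle_lt_trans; [exact H2|].
      rewrite Rabs_pos_eq by lra.
      apply Rle_lt_trans with (lip * (rho / (2 * lip))); [apply Rmult_le_compat_l; lra|].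
      replace (lip * (rho / (2 * lip))) with (rho / 2) by (field; lra). lra. }
  assert (HT : T = 1).
  { apply Rle_antisym; auto. apply Rnot_lt_le. intros HT.
    assert (Hp : 0 < rho / (2 * lip)) by (apply Rdiv_lt_0_compat; lra).
    set (T' := Rmin 1 (T + rho / (2 * lip))).
    assert (H1 : T < T') by (apply Rmin_glb_lt; lra).
    assert (H2 : T' <= T + rho / (2 * lip)) by apply Rmin_r. assert (H3 : T' <= 1) by apply Rmin_l.
    assert (T' <= T); [|lra]. apply HT1. split; [lra|]. intros s Hs.
    destruct (Rlt_dec s T) as [Hlt|Hlt]; [apply Hbelow; lra|apply Hnear; lra]. }
  intros t Ht. destruct (Rlt_dec t T) as [Hlt|Hlt]; [apply Hbelow; lra|].
  apply Hnear; [lra|]. replace t with T by lra.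
  assert (Hp : 0 < rho / (2 * lip)) by (apply Rdiv_lt_0_compat; lra). lra.
Qed.

(** A path from 2 to -1. Its imaginary part is positive between the ends, which keeps it off the
    pole at 1. *)
Definition zeta_path (t : R) : C := (2 - 3 * t, t * (1 - t)).

Lemma zeta_path_lip s t : 0 <= s <= 1 -> 0 <= t <= 1 -> s <> t ->
  0 < Cmod (zeta_path s - zeta_path t)%C <= 4 * Rabs (s - t).
Proof.
  intros Hs Ht Hne.
  assert (Er : Re (zeta_path s - zeta_path t)%C = - 3 * (s - t)) by (unfold zeta_path; simpl; ring).
  assert (Ei : Im (zeta_path s - zeta_path t)%C = (s - t) * (1 - s - t)) by (unfold zeta_path; simpl; ring).
  assert (Hp : 0 < Rabs (s - t)) by (apply Rabs_pos_lt; lra).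
  split.
  - eapply Rlt_le_trans; [|apply re_le_Cmod]. rewrite Er, Rabs_mult, Rabs_left by lra. lra.
  - eapply Rle_trans; [apply Cmod_le_Re_Im|]. rewrite Er, Ei, !Rabs_mult, (Rabs_left (-3)) by lra.
    assert (Rabs (1 - s - t) <= 1) by (apply Rabs_le; lra). nra.
Qed.

Definition zeta_defect (zeta : C -> C) (s : C) : C := ((1 - s) * zeta s - zeta_EM s)%C.

Lemma zeta_defect_expansion zeta s0 : is_Riemann_zeta zeta -> s0 <> RtoC 1 -> -1 <= Re s0 ->
  exists a M' rho' M rho, has_expansion zeta s0 a M' rho' /\
   has_expansion (zeta_defect zeta) s0
    (fun k => (1 - s0) * a k - match k with O => 0 | S l => a l end - zeta_EM_coef s0 k)%C M rho.
Proof.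
  intros [Hz _] H1 Hs. destruct (analytic_at_has_expansion _ _ (Hz s0 H1)) as [a [M1 [r1 Ha]]].
  destruct (zeta_EM_has_expansion s0 Hs) as [M2 [r2 [Hb _]]].
  assert (Hr1 : 0 < r1) by apply Ha. assert (Hr2 : 0 < r2) by apply Hb.
  assert (Hr : 0 < Rmin r1 r2) by (apply Rmin_pos; auto).
  exists a, M1, r1. eexists. exists (Rmin r1 r2). split; auto.
  apply (has_expansion_minus (fun s => (1 - s) * zeta s)%C zeta_EM).
  - apply has_expansion_linear. apply has_expansion_shrink with r1; [split; auto; apply Rmin_l|exact Ha].
  - apply has_expansion_shrink with r2; [split; auto; apply Rmin_r|exact Hb].
Qed.

(** The defect (1-s) zeta(s) - [zeta_EM] s vanishes along the path, whose points accumulate at -1;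
    hence its Taylor coefficients at -1 are 0. With 1 - s = 2 - h this is a linear relation for the
    coefficients of zeta. *)
Lemma zeta_coef_m1 zeta : is_Riemann_zeta zeta -> exists a M rho, has_expansion zeta (RtoC (-1)) a M rho /\
  forall k, ((1 - RtoC (-1)) * a k - match k with O => 0 | S l => a l end)%C = zeta_EM_coef (RtoC (-1)) k.
Proof.
  intros Hz.
  assert (Hg : forall t, 0 <= t <= 1 -> zeta_path t <> RtoC 1 /\ -1 <= Re (zeta_path t)).
  { intros t Ht. split; [|simpl; lra]. unfold zeta_path. intros E. injection E as E1 E2.
    assert (t = 1 / 3) by lra. subst t. lra. }
  assert (Hzero : forall t, 0 <= t <= 1 -> zeta_defect zeta (zeta_path t) = 0%C).
  (* Up to t = 1/4 the real part 2 - 3t stays above 1, where the Dirichlet series applies. *)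
  { apply (zero_along_path _ zeta_path 4 (1 / 4)); try lra.
    - intros t Ht. destruct (Hg t Ht) as [H1 H2].
      destruct (zeta_defect_expansion zeta _ Hz H1 H2) as [a [_ [_ [M [rho [_ H]]]]]]. eauto.
    - apply zeta_path_lip.
    - intros t Ht. unfold zeta_defect. rewrite (zeta_EM_zeta zeta) by (auto; simpl; lra). ring. }
  assert (E1 : zeta_path 1 = RtoC (-1)) by (unfold zeta_path; apply Ceq; simpl; ring).
  destruct (Hg 1 ltac:(lra)) as [H1 H2].
  destruct (zeta_defect_expansion zeta _ Hz H1 H2) as [a [M' [rho' [M [rho [Ha H]]]]]].
  rewrite E1 in *. exists a, M', rho'. split; auto.
  destruct (has_expansion_isolated _ _ _ _ _ H) as [Hc _].
  - intros eps Heps.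
    set (d := Rmin (1 / 2) (eps / 8)).
    assert (Hd : 0 < d) by (apply Rmin_pos; lra).
    assert (Hd1 : d <= 1 / 2) by apply Rmin_l. assert (Hd2 : d <= eps / 8) by apply Rmin_r.
    exists (zeta_path (1 - d)%R - RtoC (-1))%C. split.
    + rewrite <- E1. destruct (zeta_path_lip (1 - d) 1) as [H3 H4]; try lra. split; auto.
      eapply Rle_lt_trans; [exact H4|]. replace (1 - d - 1) with (- d) by ring.
      rewrite Rabs_Ropp, Rabs_pos_eq; lra.
    + replace (RtoC (-1) + (zeta_path (1 - d)%R - RtoC (-1)))%C with (zeta_path (1 - d)) by ring.
      apply Hzero. lra.
  - intros k. specialize (Hc k). cbv beta in Hc.
    match goal with |- ?A = ?B => replace A with (A - B + B)%C by ring end. rewrite Hc. ring.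
Qed.

(** * The derivative of zeta at -1 *)

(** [C_derive] takes the limit of the parts of the difference quotient along the horizontal line
    through s0; the expansion to order 2 bounds the error by a multiple of |h|. *)
Lemma has_expansion_C_derive f s0 c M rho : has_expansion f s0 c M rho -> C_derive f s0 = c 1%nat.
Proof.
  intros [Hr [HM H]].
  assert (H0 : f s0 = c 0%nat).
  { specialize (H 0%C ltac:(rewrite Cmod_0; auto) 1%nat). rewrite Cmod_0 in H.
    replace (M * (0 / rho) ^ 1) with 0 in H by (unfold Rdiv; simpl; ring).
    simpl Csum in H. replace (s0 + 0)%C with s0 in H by ring.
    replace (f s0 - (0 + c 0%nat * 1))%C with (f s0 - c 0%nat)%C in H by ring.
    assert (E : (f s0 - c 0%nat)%C = 0%C) by (apply Cmod_eq_0, Rle_antisym; [exact H|apply Cmod_ge_0]).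
    replace (f s0) with (f s0 - c 0%nat + c 0%nat)%C by ring. rewrite E. ring. }
  assert (Hq : forall x : R, 0 < Rabs (x - Re s0) < rho ->
    Cmod ((f (x, Im s0) - f s0) / ((x, Im s0) - s0) - c 1%nat)%C <= M / (rho * rho) * Rabs (x - Re s0)).
  { intros x Hx. set (h := RtoC (x - Re s0)).
    assert (Hh : Cmod h = Rabs (x - Re s0)) by (unfold h; apply Cmod_R).
    assert (Hhnz : h <> 0%C) by (apply Cmod_gt_0; lra).
    assert (E : (x, Im s0) = (s0 + h)%C) by (unfold h; apply Ceq; simpl; [unfold Re|unfold Im]; ring).
    rewrite E. replace (s0 + h - s0)%C with h by ring.
    specialize (H h ltac:(lra) 2%nat). simpl Csum in H. rewrite <- H0 in H.
    replace ((f (s0 + h) - f s0) / h - c 1%nat)%C with ((f (s0 + h) - (0 + f s0 * 1 + c 1%nat * (h * 1))) / h)%C by (field; auto).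
    rewrite Cmod_div by auto. apply Rmult_le_reg_r with (Cmod h); [lra|].
    unfold Rdiv at 1. rewrite Rmult_assoc, Rinv_l, Rmult_1_r by lra.
    eapply Rle_trans; [exact H|]. rewrite <- Hh. right. field. lra. }
  assert (Hlim : forall (g : C -> R) , (forall w, Rabs (g w) <= Cmod w) -> (forall a b : C, g (a - b)%C = g a - g b) ->
    Lim (fun x => g ((f (x, Im s0) - f s0) / ((x, Im s0) - s0))%C) (Re s0) = g (c 1%nat)).
  { intros g Hg1 Hg2.
    assert (HL : is_lim (fun x => g ((f (x, Im s0) - f s0) / ((x, Im s0) - s0))%C) (Re s0) (g (c 1%nat))).
    { apply is_lim_spec. intros eps.
      assert (HK : 0 < M / (rho * rho) + 1).
      { assert (0 <= M / (rho * rho)); [|lra]. apply Rmult_le_pos; auto. left; apply Rinv_0_lt_compat. nra. }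
      assert (Hd : 0 < Rmin rho (eps / (M / (rho * rho) + 1))).
      { apply Rmin_pos; auto. apply Rdiv_lt_0_compat; auto. apply cond_pos. }
      exists (mkposreal _ Hd). intros y Hy Hne.
      unfold ball in Hy; simpl in Hy. unfold AbsRing_ball, abs, minus, plus, opp in Hy; simpl in Hy.
      change (y + - Re s0) with (y - Re s0) in Hy.
      assert (Hy1 := Rlt_le_trans _ _ _ Hy (Rmin_l _ _)). assert (Hy2 := Rlt_le_trans _ _ _ Hy (Rmin_r _ _)).
      assert (Hy0 : 0 < Rabs (y - Re s0)) by (apply Rabs_pos_lt; lra).
      rewrite <- Hg2. eapply Rle_lt_trans; [apply Hg1|].
      eapply Rle_lt_trans; [apply Hq; lra|].
      apply Rle_lt_trans with ((M / (rho * rho) + 1) * Rabs (y - Re s0)); [lra|].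
      apply Rmult_lt_compat_l with (r := M / (rho * rho) + 1) in Hy2; auto.
      eapply Rlt_le_trans; [exact Hy2|]. right.
      set (K := M / (rho * rho) + 1) in *. field. lra. }
    rewrite (is_lim_unique _ _ _ HL). reflexivity. }
  unfold C_derive, C_lim. apply Ceq.
  - exact (f_equal real (Hlim Re re_le_Cmod (fun _ _ => eq_refl))).
  - exact (f_equal real (Hlim Im im_le_Cmod (fun _ _ => eq_refl))).
Qed.

(** At s0 = -1 the column k = 0 holds x^2 and its derivatives, the column k = 1 holds - x^2 ln x and
    its derivatives. The entry j = 3, k = 1 is multiplied by [beta 3], which is 0. *)
Lemma power_coef_m1 x : 0 < x ->
  power_coef (RtoC (-1)) 0 0 x = (RtoC x * RtoC x)%C /\
  power_coef (RtoC (-1)) 1 0 x = (2 * RtoC x)%C /\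
  power_coef (RtoC (-1)) 2 0 x = 2%C /\
  power_coef (RtoC (-1)) 3 0 x = 0%C /\
  power_coef (RtoC (-1)) 4 0 x = 0%C /\
  power_coef (RtoC (-1)) 0 1 x = (- (RtoC x * RtoC x) * RtoC (ln x))%C /\
  power_coef (RtoC (-1)) 1 1 x = (- 2 * RtoC x * RtoC (ln x) - RtoC x)%C /\
  power_coef (RtoC (-1)) 2 1 x = (- 2 * RtoC (ln x) - 3)%C /\
  power_coef (RtoC (-1)) 4 1 x = (2 * / RtoC x * / RtoC x)%C.
Proof.
  intros Hx.
  assert (Hnz : RtoC x <> 0%C) by (intros E; apply RtoC_inj in E; lra).
  assert (E0 : Cexp ((1 - RtoC (-1)) * RtoC (ln x)) = (RtoC x * RtoC x)%C).
  { replace ((1 - RtoC (-1)) * RtoC (ln x))%C with (RtoC (ln x) + RtoC (ln x))%C.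
    - rewrite Cexp_plus, Cexp_RtoC, exp_ln; auto.
    - rewrite <- RtoC_minus, <- RtoC_mult, <- RtoC_plus. f_equal. ring. }
  assert (Em : RtoC (-1) = (- (1))%C) by (rewrite <- RtoC_opp; reflexivity).
  unfold power_coef. rewrite E0, (RtoC_inv x) by lra. simpl INR.
  rewrite Rinv_1, !RtoC_plus, Em. simpl pow.
  repeat split; field; auto.
Qed.

(** The value 2 zeta(-1). For the summand 2k Euler-Maclaurin is exact, so the sequence is
    constant. *)
Lemma zeta_EM_coef_0 : zeta_EM_coef (RtoC (-1)) 0 = RtoC (- (1 / 6)).
Proof.
  apply Clim_seq_eq. eapply Clim_ext; [|apply Clim_const]. intros n. symmetry.
  unfold EM_partial. set (x := 1 + INR n).
  assert (Hx : 0 < x) by (unfold x; generalize (pos_INR n); lra).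
  destruct (power_coef_m1 x Hx) as [P00 [P10 [P20 [P30 [P40 _]]]]].
  cbn [Csum]. rewrite P00, P10, P20, P30, P40, beta_0, beta_1, beta_2.
  rewrite (Csum_ext _ (fun k => RtoC (2 * (1 + INR k)))).
  2:{ intros k _. destruct (power_coef_m1 (1 + INR k)) as [_ [-> _]]; [generalize (pos_INR k); lra|].
      rewrite RtoC_mult. reflexivity. }
  rewrite Csum_RtoC.
  assert (Es : Rsum (fun k => 2 * (1 + INR k)) n = x * x - x).
  { unfold x. clear. induction n; [simpl; ring|]. rewrite Rsum_S, IHn, S_INR. ring. }
  rewrite Es.
  replace (RtoC (x * x - x)) with (RtoC x * RtoC x - RtoC x)%C by (rewrite RtoC_minus, RtoC_mult; reflexivity).
  replace (RtoC (- (1 / 2))) with (- (1 / 2))%C by (rewrite RtoC_opp, RtoC_div by lra; reflexivity).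
  replace (RtoC (1 / 12)) with (1 / 12)%C by (rewrite RtoC_div by lra; reflexivity).
  replace (RtoC (- (1 / 6))) with (- (1 / 6))%C by (rewrite RtoC_opp, RtoC_div by lra; reflexivity).
  field.
Qed.

Lemma beta_3 : beta 3 = 0.
Proof. apply (beta_odd 1 (Nat.le_refl 1)). Qed.

(** Since - x^2 ln x = -2 (x^2/2 ln x - x^2/4) - x^2/2, the chain is -2 times that of z log z plus
    that of - x^2/2, whose constant is 1/12. The additional boundary term j = 4 is of order
    x^(-2). *)
Lemma zeta_EM_coef_1 kappa :
  Clim (fun n => Csum (fun k => zlogz_deriv 1 (1 + RtoC (INR k))%C) n - Phi 0 3 (1 + RtoC (INR n)))%C kappa ->
  zeta_EM_coef (RtoC (-1)) 1 = (- 2 * kappa + RtoC (1 / 12))%C.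
Proof.
  intros Hk. apply Clim_seq_eq.
  replace (- 2 * kappa + RtoC (1 / 12))%C with (- 2 * kappa + RtoC (1 / 12) - RtoC (2 * beta 4) * (0 * 0))%C by ring.
  eapply Clim_ext.
  2:{ apply Clim_minus; [apply Clim_plus; [apply Clim_mult; [apply (Clim_const (- 2)%C)|exact Hk]|apply (Clim_const (RtoC (1 / 12)))]|].
      apply Clim_mult; [apply (Clim_const (RtoC (2 * beta 4)))|apply Clim_mult; apply Clim_inv_INR_S]. }
  intros n. cbv beta. symmetry. unfold EM_partial. rewrite RtoC_1_plus.
  replace (1 + INR n) with (INR (S n)) by (rewrite S_INR; ring).
  set (x := INR (S n)). assert (Hx : 0 < x) by apply INR_S_pos.
  assert (Hxn : RtoC x <> 0%C) by apply RtoC_INR_S_nz.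
  destruct (power_coef_m1 x Hx) as [_ [_ [_ [_ [_ [P01 [P11 [P21 P41]]]]]]]].
  cbn [Csum]. rewrite P01, P11, P21, P41, Phi_0_3, beta_0, beta_1, beta_2, beta_3. cbn [zlogz_deriv].
  rewrite Clog_pos by auto.
  rewrite (Csum_ext (fun k => power_coef (RtoC (-1)) 1 1 (1 + INR k))
    (fun k => (- 2) * zlogz_deriv 1 (1 + RtoC (INR k)) - RtoC (1 + INR k))%C).
  2:{ intros k _. destruct (power_coef_m1 (1 + INR k)) as [_ [_ [_ [_ [_ [_ [-> _]]]]]]]; [generalize (pos_INR k); lra|].
      cbn [zlogz_deriv]. rewrite RtoC_1_plus, Clog_INR_S. rewrite (Rplus_comm 1), <- S_INR. ring. }
  rewrite Csum_minus, Csum_scal, Csum_RtoC. cbn [zlogz_deriv].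
  assert (Es : Rsum (fun k => 1 + INR k) n = (x * x - x) / 2).
  { unfold x. clear. induction n; [simpl; field|]. rewrite Rsum_S, IHn, !S_INR. field. }
  rewrite Es. rewrite !RtoC_mult, RtoC_half.
  replace (RtoC ((x * x - x) / 2)) with ((RtoC x * RtoC x - RtoC x) / 2)%C
   by (rewrite <- RtoC_mult, <- RtoC_minus, <- RtoC_div by lra; reflexivity).
  replace (RtoC (- (1 / 2))) with (- (1 / 2))%C by (rewrite RtoC_opp, RtoC_div by lra; reflexivity).
  replace (RtoC (1 / 12)) with (1 / 12)%C by (rewrite RtoC_div by lra; reflexivity).
  field. auto.
Qed.

(** The relations are 2 a_0 = -1/6 and 2 a_1 - a_0 = -2 kappa + 1/12; the two twelfths cancel. *)
Lemma zeta_derivative_m1 zeta kappa : is_Riemann_zeta zeta ->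
  Clim (fun n => Csum (fun k => zlogz_deriv 1 (1 + RtoC (INR k))%C) n - Phi 0 3 (1 + RtoC (INR n)))%C kappa ->
  C_derive zeta (RtoC (-1)) = (- kappa)%C.
Proof.
  intros Hz Hk. destruct (zeta_coef_m1 zeta Hz) as [a [M [rho [Ha Hc]]]].
  rewrite (has_expansion_C_derive _ _ _ _ _ Ha).
  assert (H0 := Hc 0%nat). assert (H1 := Hc 1%nat). cbv iota in H0, H1.
  rewrite zeta_EM_coef_0 in H0. rewrite (zeta_EM_coef_1 _ Hk) in H1.
  replace (1 - RtoC (-1))%C with (RtoC 2) in H0, H1 by (rewrite <- RtoC_minus; f_equal; ring).
  replace (RtoC (1 / 12)) with (1 / 12)%C in H1 by (rewrite RtoC_div by lra; reflexivity).
  replace (RtoC (- (1 / 6))) with (- (1 / 6))%C in H0 by (rewrite RtoC_opp, RtoC_div by lra; reflexivity).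
  replace (a 1%nat) with (((2 * a 1%nat - a 0%nat) + (2 * a 0%nat - 0) / 2) / 2)%C by field.
  rewrite H0, H1. field.
Qed.

(** * The quotient of G by the prefactor *)

Lemma log_Gamma_seq_limit z : slit_plane z -> Clim (fun n => log_Gamma_seq n z) (log_Gamma_lim (z + 1)).
Proof.
  intros Hz.
  assert (H := log_Gamma_lim_correct (z + 1)%C ltac:(apply slit_plane_plus_R; auto; lra)).
  replace (log_Gamma_lim (z + 1)) with (log_Gamma_lim (z + 1) + 0)%C by ring.
  eapply Clim_ext; [|apply Clim_plus; [exact H|apply (lam_limit z)]].
  intros n. cbv beta. rewrite log_Gamma_euler_shift. ring.
Qed.

Lemma Barnes_G_exp (z T : C) : slit_plane z -> Clim (fun n => log_G_seq n z) T ->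
  Barnes_G (z + 1) = Cexp T.
Proof.
  intros Hz HT. unfold Barnes_G. replace (z + 1 - 1)%C with z by ring. cbv zeta.
  set (A := (z / 2 * RtoC (ln (2 * PI)) - (z + z * z * (1 + RtoC Euler_gamma)) / 2)%C).
  assert (HPI := PI_RGT_0).
  assert (E1 : (Cpower (RtoC (2 * PI)) (z / 2) * Cexp (- (z + z ^ 2 * (1 + RtoC Euler_gamma)) / 2))%C = Cexp A).
  { unfold Cpower. rewrite Clog_pos, <- Cexp_plus by lra. f_equal. unfold A. simpl. field. }
  rewrite E1, (Clim_seq_eq _ (Cexp (T - A))).
  - rewrite <- Cexp_plus. f_equal. ring.
  - eapply Clim_ext; [|apply Clim_Cexp, Clim_minus; [exact HT|apply (Clim_const A)]].
    intros n. cbv beta. unfold log_G_seq. fold A.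
    match goal with |- Cexp (A + ?S - A) = _ => replace (A + S - A)%C with S by ring end.
    symmetry. induction n; [simpl; rewrite Cexp_0; reflexivity|].
    rewrite Csum_S, Cexp_plus, <- IHn. cbn [Cprod]. f_equal.
    rewrite Cexp_plus, <- Cexp_pow, (Cexp_minus (Clog _)), Cexp_RtoC, exp_ln by apply INR_S_pos.
    assert (Hnz := RtoC_INR_S_nz n).
    rewrite Cexp_Clog.
    + f_equal.
      * f_equal. rewrite S_INR, RtoC_plus in *. field. exact Hnz.
      * f_equal. simpl. f_equal. f_equal. ring.
    + replace (z + 1 + RtoC (INR n))%C with (z + RtoC (1 + INR n))%C by (rewrite RtoC_plus; ring).
      apply slit_plane_plus_R; auto. generalize (pos_INR n); lra.
Qed.

(** As zeta'(-1) = - kappa, log A = 1/12 + kappa. This 1/12 matches the constant in (log z + 1)/12,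
    and z^2/4 comes from the antiderivative of z log z, so that only the remainder and the tail
    survive. *)
Lemma quotient_exp zeta log_Gamma (z rem : C) p :
  is_Riemann_zeta zeta -> is_log_Gamma log_Gamma -> (2 <= p)%nat -> slit_plane z ->
  Clim (Csum (fun k => EM_err 0 p (z + RtoC (INR k))%C)) rem ->
  (Barnes_G (z + 1) / prefactor zeta log_Gamma z)%C = Cexp (rem - Phi_tail p z).
Proof.
  intros Hz HL Hp Hs Hrem.
  destruct (EM_constant 0 3 ltac:(lia) ltac:(lia)) as [kappa Hk].
  assert (Hd := zeta_derivative_m1 zeta kappa Hz Hk).
  assert (HX := log_quotient_limit p z rem kappa Hp Hs Hrem Hk).
  assert (HT := Clim_plus _ _ _ _ HX (Clim_mult _ _ _ _ (Clim_const z) (log_Gamma_seq_limit z Hs))).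
  assert (HG : Clim (fun n => log_G_seq n z) (- zlogz_deriv 0 z - RtoC (/ 2) * zlogz_deriv 1 z - RtoC (1 / 12) * zlogz_deriv 2 z
     - Phi_tail p z + rem - kappa + z * log_Gamma_lim (z + 1))%C).
  { eapply Clim_ext; [|exact HT]. intros n. cbv beta. ring. }
  rewrite (Barnes_G_exp z _ Hs HG).
  unfold prefactor, Glaisher, Cpower. rewrite Hd.
  rewrite (log_Gamma_unique _ HL) by (apply slit_plane_plus_R; auto; lra).
  rewrite <- Cexp_opp, <- !Cexp_plus, <- Cexp_minus. f_equal. cbn [zlogz_deriv].
  rewrite RtoC_half. replace (RtoC (1 / 12)) with (/ 12)%C by (unfold Rdiv; rewrite Rmult_1_l, RtoC_inv by lra; reflexivity).
  simpl Cpow. field.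
Qed.

(** The odd Bernoulli numbers remove every other term, and the derivatives of 1/z that remain have
    odd order, hence a negative sign. *)
Lemma Phi_tail_even N (z : C) : z <> 0%C ->
  (- Phi_tail (2 * N + 2) z)%C = Csum (fun k => RtoC (Bernoulli_coef (S k)) * (/ (z * z)) ^ S k)%C N.
Proof.
  intros Hz. unfold Phi_tail. replace (2 * N + 2 - 2)%nat with (2 * N)%nat by lia.
  induction N; [simpl; ring|].
  replace (2 * S N)%nat with (S (S (2 * N))) by lia.
  rewrite (Csum_S _ (S (2 * N))), (Csum_S _ (2 * N)), (Csum_S _ N), <- IHN.
  assert (E0 : beta (3 + 2 * N) = 0).
  { replace (3 + 2 * N)%nat with (2 * S N + 1)%nat by lia. apply beta_odd; lia. }
  assert (E1 : Bernoulli_coef (S N) = beta (3 + S (2 * N)) * INR (fact (S (2 * N)))).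
  { unfold Bernoulli_coef, beta.
    replace (2 * S N + 2)%nat with (S (S (S (S (2 * N))))) by lia.
    replace (3 + S (2 * N))%nat with (S (S (S (S (2 * N))))) by lia.
    rewrite (fact_simpl (S (S (S (2 * N))))), (fact_simpl (S (S (2 * N)))), (fact_simpl (S (2 * N))), !mult_INR.
    replace (INR (2 * S N + 1)) with (INR (S (S (S (2 * N))))) by (f_equal; lia).
    replace (INR 2 * INR (S N)) with (INR (S (S (2 * N)))) by (rewrite <- mult_INR; f_equal; lia).
    field. repeat split; try apply INR_fact_neq_0; apply not_0_INR; lia. }
  rewrite E0, E1. unfold inv_deriv.
  replace ((-1) ^ S (2 * N)) with (-1) by (rewrite <- tech_pow_Rmult, pow_1_even; ring).
  replace ((/ z) ^ S (S (2 * N)))%C with ((/ (z * z)) ^ S N)%C.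
  - rewrite !RtoC_mult. replace (RtoC (-1)) with (- (1))%C by (rewrite <- RtoC_opp; reflexivity). ring.
  - replace (S (S (2 * N))) with (2 * S N)%nat by lia. rewrite Cpow_mult_r. f_equal. simpl. field. auto.

Qed.

Lemma sector_slit_plane (z : C) delta : 0 < delta < PI -> 0 < Cmod z -> Rabs (Carg z) <= PI - delta ->
  slit_plane z /\ - cos delta * Cmod z <= Re z.
Proof.
  intros Hd Hz Harg.
  assert (Hq : -1 <= Re z / Cmod z <= 1).
  { assert (H := re_le_Cmod z). apply Rabs_le_between in H. split.
    - apply Rmult_le_reg_r with (Cmod z); auto. unfold Rdiv. rewrite Rmult_assoc, Rinv_l; lra.
    - apply Rmult_le_reg_r with (Cmod z); auto. unfold Rdiv. rewrite Rmult_assoc, Rinv_l; lra. }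
  assert (Hb := acos_bound (Re z / Cmod z)).
  assert (Ha : acos (Re z / Cmod z) <= PI - delta).
  { unfold Carg in Harg. destruct (Rle_dec 0 (Im z)).
    - rewrite Rabs_pos_eq in Harg; lra.
    - rewrite Rabs_Ropp, Rabs_pos_eq in Harg; lra. }
  assert (Hre : - cos delta * Cmod z <= Re z).
  { assert (Hc : cos (PI - delta) <= cos (acos (Re z / Cmod z))) by (apply cos_decr_1; lra).
    rewrite cos_acos, Rtrigo_facts.cos_pi_minus in Hc by auto.
    apply Rmult_le_compat_r with (r := Cmod z) in Hc; [|lra].
    unfold Rdiv in Hc. rewrite Rmult_assoc, Rinv_l in Hc; lra. }
  split; auto. intros [H1 H2].
  assert (E := Cmod_sqr z). rewrite H1 in E.
  assert (Hcos : cos delta < 1) by (rewrite <- cos_0; apply cos_decreasing_1; lra).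
  assert (Em : Re z = - Cmod z).
  { assert (Hprod : (Re z + Cmod z) * (Re z - Cmod z) = 0) by lra.
    apply Rmult_integral in Hprod. destruct Hprod; lra. }
  rewrite Em in Hre. nra.
Qed.

Lemma sum_n_m_Csum (f : nat -> C) m : f 0%nat = 1%C -> (1 + sum_n_m (G := C_AbelianMonoid) f 1 m)%C = Csum f (S m).
Proof.
  intros H0. induction m.
  - rewrite sum_n_m_zero by lia. simpl. rewrite H0. unfold zero; simpl. ring.
  - rewrite sum_n_Sm by lia. rewrite Csum_S, <- IHm. unfold plus; simpl. ring.
Qed.

(* Raising the quotient to the power r and back is harmless since its logarithm tends to 0. *)
Lemma Barnes_expansion zeta log_Gamma r :
  is_Riemann_zeta zeta -> is_log_Gamma log_Gamma -> r <> 0 ->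
  Poincare_expansion_power (fun z => Barnes_G (z + 1)%C) (prefactor zeta log_Gamma)
    (exp_coef r Bernoulli_coef) (1 / r).
Proof.
  intros Hzeta HL Hr N HN delta Hdelta.
  set (b := exp_coef r Bernoulli_coef).
  set (c := sqrt ((1 - cos delta) / 2)).
  assert (Hcos : -1 <= cos delta < 1).
  { split; [apply COS_bound|]. rewrite <- cos_0; apply cos_decreasing_1; lra. }
  assert (Hc : 0 < c) by (apply sqrt_lt_R0; lra).
  set (Crem := 2 * (EM_const (2 * N + 2) * INR (fact (2 * N)) / c ^ S (2 * N))).
  assert (HCrem : 0 <= Crem).
  { unfold Crem. apply Rmult_le_pos; [lra|]. apply Rmult_le_pos.
    - apply Rmult_le_pos; [apply EM_const_pos|apply pos_INR].
    - left; apply Rinv_0_lt_compat, pow_lt; auto. }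
  set (CE := Rabs r * (Rabs (Bernoulli_coef N) + Crem)).
  assert (HCE : 0 <= CE).
  { apply Rmult_le_pos; [apply Rabs_pos|]. generalize (Rabs_pos (Bernoulli_coef N)); lra. }
  set (CQ := Rsum (fun k => Rabs (r * Bernoulli_coef (S k))) (N - 1)).
  assert (HCQ : 0 <= CQ) by (apply Rsum_pos; intros; apply Rabs_pos).
  destruct (exp_truncation r Bernoulli_coef (N - 1)) as [M HM]. fold b in HM.
  replace (S (N - 1)) with N in HM by lia.
  (* The first summand bounds the effect of the error E in the exponent, M that of truncating e^Q.
     The lower bound for |z| makes |Q + E| < 1. *)
  exists (exp CQ * (CE * exp CE) + M), (1 + (CQ + CE)). split; [lra|].
  intros z Hz Harg.
  assert (Hz1 : 1 <= Cmod z) by lra.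
  destruct (sector_slit_plane z delta Hdelta ltac:(lra) Harg) as [Hs Hre].
  assert (Hnz := slit_plane_nz z Hs).
  (* Order p = 2N + 2 corresponds to q = 2N, hence a remainder O(|z|^(-2N)) and a tail with the
     terms 1, ..., N. *)
  destruct (EM_remainder 0 (2 * N + 2) (2 * N) z c ltac:(lia) ltac:(lia) ltac:(lia) Hs Hz1 Hc) as [rem [Hrem Hremb]].
  { intros x Hx. apply sector_lower_bound; auto. }
  fold Crem in Hremb.
  assert (Hquot := quotient_exp zeta log_Gamma z rem (2 * N + 2) Hzeta HL ltac:(lia) Hs Hrem).
  set (x := (/ (z * z))%C).
  assert (Hzz : (z * z)%C <> 0%C) by (apply Cmult_neq_0; auto).
  assert (Hx : Cmod x = / (Cmod z * Cmod z)) by (unfold x; rewrite Cmod_inv, Cmod_mult; auto).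
  assert (Hxn : forall n, Cmod x ^ n = / Cmod z ^ (2 * n)).
  { intros n. rewrite Hx, pow_inv, pow_mult. do 2 f_equal. ring. }
  assert (Hx1 : Cmod x <= / Cmod z).
  { rewrite Hx. apply Rinv_le_contravar; nra. }
  assert (Hzi : / Cmod z <= 1) by (rewrite <- Rinv_1; apply Rinv_le_contravar; lra).
  assert (Hzi0 : 0 < / Cmod z) by (apply Rinv_0_lt_compat; lra).
  set (S0 := (rem - Phi_tail (2 * N + 2) z)%C) in *.
  set (Q := Csum (fun k => RtoC (r * Bernoulli_coef (S k)) * x ^ S k)%C (N - 1)).
  (* The last term of the tail is already of the order of the error and is counted with it; Q keeps
     the terms below N. *)
  set (E := (RtoC r * (RtoC (Bernoulli_coef N) * x ^ N + rem))%C).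
  assert (ES : (RtoC r * S0)%C = (Q + E)%C).
  { unfold S0, Cminus. rewrite Phi_tail_even by auto. fold x.
    replace N with (S (N - 1)) at 1 by lia. rewrite Csum_S. replace (S (N - 1)) with N by lia.
    unfold Q, E. rewrite (Csum_ext (fun k => RtoC (r * Bernoulli_coef (S k)) * x ^ S k)%C
      (fun k => RtoC r * (RtoC (Bernoulli_coef (S k)) * x ^ S k))%C) by (intros; rewrite RtoC_mult; ring).
    rewrite Csum_scal. ring. }
  assert (HQ : Cmod Q <= CQ * / Cmod z).
  { unfold CQ. rewrite Rmult_comm, <- Rsum_scal. apply Csum_Cmod. intros k _.
    rewrite Cmod_mult, Cmod_R, Cmod_pow, Rmult_comm. apply Rmult_le_compat_r; [apply Rabs_pos|].
    simpl. rewrite <- (Rmult_1_r (/ Cmod z)). apply Rmult_le_compat; auto.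
    - apply Cmod_ge_0.
    - apply pow_le, Cmod_ge_0.
    - rewrite <- (pow1 k). apply pow_incr. split; [apply Cmod_ge_0|lra]. }
  assert (HE : Cmod E <= CE * / Cmod z ^ (2 * N)).
  { unfold E, CE. rewrite Cmod_mult, Cmod_R, Rmult_assoc. apply Rmult_le_compat_l; [apply Rabs_pos|].
    eapply Rle_trans; [apply Cmod_triangle|]. rewrite Rmult_plus_distr_r. apply Rplus_le_compat; auto.
    rewrite Cmod_mult, Cmod_R, Cmod_pow, Hxn. lra. }
  assert (HzN : / Cmod z ^ (2 * N) <= / Cmod z).
  { apply Rinv_le_contravar; [lra|]. rewrite <- (pow_1 (Cmod z)) at 1. apply Rle_pow; [lra|lia]. }
  assert (HzN0 : 0 < / Cmod z ^ (2 * N)) by (apply Rinv_0_lt_compat, pow_lt; lra).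
  assert (HQE : Cmod (Q + E)%C < 1).
  { eapply Rle_lt_trans; [apply Cmod_triangle|].
    apply Rle_lt_trans with ((CQ + CE) * / Cmod z).
    - rewrite Rmult_plus_distr_r. apply Rplus_le_compat; auto. eapply Rle_trans; [exact HE|].
      apply Rmult_le_compat_l; auto.
    - apply Rmult_lt_reg_r with (Cmod z); [lra|]. rewrite Rmult_assoc, Rinv_l; lra. }
  set (P := Csum (fun n => RtoC (b n) * x ^ n)%C N).
  exists (Cexp (Q + E) - P)%C. split.
  - replace (Cexp (Q + E) - P)%C with (Cexp Q * (Cexp E - 1) + (Cexp Q - P))%C by (rewrite Cexp_plus; ring).
    eapply Rle_trans; [apply Cmod_triangle|]. unfold Rdiv. rewrite Rmult_plus_distr_r.
    apply Rplus_le_compat.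
    + rewrite Cmod_mult, Rmult_assoc. apply Rmult_le_compat; try apply Cmod_ge_0.
      * rewrite Cmod_Cexp. apply exp_le_compat. eapply Rle_trans; [apply Rle_abs|].
        eapply Rle_trans; [apply re_le_Cmod|]. eapply Rle_trans; [exact HQ|].
        rewrite <- (Rmult_1_r CQ) at 2. apply Rmult_le_compat_l; auto.
      * eapply Rle_trans; [apply Cexp_minus_1|].
        replace (CE * exp CE * / Cmod z ^ (2 * N)) with ((CE * / Cmod z ^ (2 * N)) * exp CE) by ring.
        apply Rmult_le_compat; auto; [apply Cmod_ge_0|left; apply exp_pos|].
        apply exp_le_compat. eapply Rle_trans; [exact HE|].
        rewrite <- (Rmult_1_r CE) at 2. apply Rmult_le_compat_l; auto. lra.
    + rewrite <- Hxn. apply HM. lra.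
  - cbv beta. rewrite Hquot.
    match goal with |- _ = Cpower ?B _ => replace B with (Cexp (Q + E)) end.
    + unfold Cpower. rewrite Clog_Cexp.
      * rewrite <- ES. f_equal. rewrite RtoC_div by auto. field. intros H; apply Hr, RtoC_inj, H.
      (* The imaginary part is below 1 < PI in modulus, so the principal logarithm inverts the
         exponential. *)
      * assert (HI := im_le_Cmod (Q + E)%C). assert (HPI := PI2_1).
        apply Rabs_le_between in HI. lra.
    + rewrite (sum_n_m_Csum (fun n => RtoC (b n) / z ^ (2 * n))%C).
      * replace (S (N - 1)) with N by lia.
        rewrite (Csum_ext _ (fun n => RtoC (b n) * x ^ n)%C).
        -- fold P. ring.
        -- intros k _. unfold x. rewrite Cpow_inv by auto. rewrite Cpow_mult_r. unfold Cdiv. do 3 f_equal. simpl; ring.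
      * simpl. unfold b, exp_coef; simpl. field.
Qed.

Theorem theorem1p1 (zeta log_Gamma : C -> C) (r : R)
  (hzeta : is_Riemann_zeta zeta)
  (hlog_Gamma : is_log_Gamma log_Gamma)
  (hr : r <> 0) :
  exists b : nat -> R,
    b 0%nat = 1 /\
    Poincare_expansion_power
      (fun z => Barnes_G (z + 1)%C) (prefactor zeta log_Gamma) b (1 / r) /\
    forall m : nat, (0 < m)%nat ->
      exists (M : R) (n0 : nat), forall n : nat, (n0 <= n)%nat -> (m < n)%nat ->
        Rabs (b n - sum_n (fun k => b k * (r * Bernoulli_coef (n - k))) (m - 1))
        <= M * Rabs (r * Bernoulli_coef (n - m)).
Proof.
  exists (exp_coef r Bernoulli_coef). split; [reflexivity|]. split.
  - apply Barnes_expansion; auto.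
  - intros m Hm. destruct (exp_coef_asymptotics r m) as [M [HM H]].
    (* The error term in the statement carries the factor |r|, which the constant divides out. *)
    exists (M / Rabs r), (2 * m)%nat. intros n Hn _.
    specialize (H m n Hm (Nat.le_refl m) Hn).
    assert (Hr : 0 < Rabs r) by (apply Rabs_pos_lt; auto).
    rewrite sum_n_Rsum. replace (S (m - 1)) with m by lia.
    rewrite (Rsum_ext _ (fun k => r * (exp_coef r Bernoulli_coef k * Bernoulli_coef (n - k)))) by (intros; ring).
    rewrite Rsum_scal, Rabs_mult. fold (alpha (n - m)).
    replace (M / Rabs r * (Rabs r * alpha (n - m))) with (M * alpha (n - m)) by (field; lra).
    exact H.
Qed.
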